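(* Let $A$ be a basic finite dimensional algebra over a field with a complete set $\{e_1,e_2\}$ of primitive orthogonal idempotents, $P_i=e_iA$. Then $A$ is $g$-convex if and only if $(e_1,e_2)$ satisfies $(\mathsf L)$ or $(\mathsf R)$ and $(e_2,e_1)$ satisfies $(\mathsf L)$ or $(\mathsf R)$. More precisely, let $Q=\{a[P_1]+b[P_2]\mid a\ge0,b\le0\}$ and for vectors $u_0=[P_1],u_1,\dots,u_r=-[P_2]$ write $\Delta(u_0,\dots,u_r)=\bigcup_{t}\operatorname{conv}\{0,u_{t-1},u_t\}$. Then: (a) $\mathcal P(A)\cap Q=\Delta([P_1],-[P_2])$ iff $e_1Ae_2=0$; (b) $\mathcal P(A)\cap Q=\Delta([P_1],[P_1]-[P_2],-[P_2])$ iff $e_1Ae_2$ is non-zero, left cyclic and right cyclic; (c) $\mathcal P(A)\cap Q=\Delta([P_1],[P_1]-[P_2],[P_1]-2[P_2],-[P_2])$ iff $(e_1,e_2)$ satisfies $(\mathsf L)$ but not $(\mathsf R)$; (d) $\mathcal P(A)\cap Q=\Delta([P_1],2[P_1]-[P_2],[P_1]-[P_2],-[P_2])$ iff $(e_1,e_2)$ satisfies $(\mathsf R)$ but not $(\mathsf L)$.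
   Context: $\mathcal P(A)=\bigcup_T\operatorname{conv}\{0,[T_1],[T_2]\}\subset K_0(\operatorname{proj}A)_{\mathbb R}$ over all basic 2-term silting complexes $T=T_1\oplus T_2$ in $\mathsf{K}^{\rm b}(\operatorname{proj}A)$ (complexes in degrees $-1,0$ with $\operatorname{Hom}(T,T[\ell])=0$ for $\ell>0$ generating the category as thick subcategory); $A$ is $g$-convex if $\mathcal P(A)$ is convex. For orthogonal primitive idempotents $e\neq e'$ and $x\in eAe'$: $x$ is a left generator if $eAx=eAe'$, a right generator if $xAe'=eAe'$; $eAe'$ is left (right) cyclic if it has a left (right) generator. $L_x=\{a\in e'Ae'\mid xa\in eAx\}$, $R_x=\{a\in eAe\mid ax\in xAe'\}$. Condition $(\mathsf L)$ for $(e,e')$: $eAe'$ is left cyclic and there are $x\in eAe'$, $u\in eAe$ with $eAe=R_x+R_xu$ and $eAe'=xAe'+uxAe'$. Condition $(\mathsf R)$ for $(e,e')$: $eAe'$ is right cyclic and there are $x\in eAe'$, $u\in e'Ae'$ with $e'Ae'=L_x+uL_x$ and $eAe'=eAx+eAxu$. *)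

(* Defs.v *)
From HB Require Import structures.
From mathcomp Require Import all_boot all_order all_algebra all_field.
From mathcomp Require Import reals.
Unset Implicit Arguments. Unset Printing Implicit Defensive.
Import Order.TTheory GRing.Theory Num.Theory.
Local Open Scope ring_scope.

Section RingNotions.
Context {A : nzRingType}.

Definition inEAE (e e' y : A) : Prop := y = e * y * e'.

Definition idem (e : A) : Prop := e * e = e.

Definition primitive (e : A) : Prop :=
  idem e /\ e <> 0 /\
  forall f g : A, idem f -> idem g -> f * g = 0 -> g * f = 0 -> e = f + g ->
    f = 0 \/ g = 0.

Definition complete_prim_orth (e1 e2 : A) : Prop :=
  primitive e1 /\ primitive e2 /\ e1 * e2 = 0 /\ e2 * e1 = 0 /\ e1 + e2 = 1.

(* A is basic: P1 = e1 A and P2 = e2 A are not isomorphic (homomorphisms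
   e_j A -> e_i A are left multiplications by elements of e_i A e_j). *)
Definition basic2 (e1 e2 : A) : Prop :=
  ~ (exists x y : A, inEAE e1 e2 x /\ inEAE e2 e1 y /\ x * y = e1 /\ y * x = e2).

Definition left_gen (e e' x : A) : Prop :=
  inEAE e e' x /\ forall y, inEAE e e' y -> exists a, y = e * a * x.
Definition right_gen (e e' x : A) : Prop :=
  inEAE e e' x /\ forall y, inEAE e e' y -> exists a, y = x * a * e'.
Definition left_cyclic (e e' : A) : Prop := exists x, left_gen e e' x.
Definition right_cyclic (e e' : A) : Prop := exists x, right_gen e e' x.

Definition Lset (e e' x a : A) : Prop :=
  inEAE e' e' a /\ exists b, x * a = e * b * x.
Definition Rset (e e' x a : A) : Prop :=
  inEAE e e a /\ exists b, a * x = x * b * e'.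

Definition condL (e e' : A) : Prop :=
  left_cyclic e e' /\
  exists x u : A, inEAE e e' x /\ inEAE e e u /\
    (forall y, inEAE e e y <->
       exists r s, Rset e e' x r /\ Rset e e' x s /\ y = r + s * u) /\
    (forall y, inEAE e e' y <->
       exists a b, y = x * a * e' + u * x * b * e').

Definition condR (e e' : A) : Prop :=
  right_cyclic e e' /\
  exists x u : A, inEAE e e' x /\ inEAE e' e' u /\
    (forall y, inEAE e' e' y <->
       exists r s, Lset e e' x r /\ Lset e e' x s /\ y = r + u * s) /\
    (forall y, inEAE e e' y <->
       exists a b, y = e * a * x + e * b * x * u).

Definition eAe'_zero (e e' : A) : Prop := forall y, inEAE e e' y -> y = 0.
Definition eAe'_nonzero (e e' : A) : Prop := exists y, inEAE e e' y /\ y <> 0.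

End RingNotions.

(* A bounded complex of finitely generated projectives is encoded as its     *)
(* total graded object: a finite list of indecomposable summands, summand i  *)
(* being e1 A (clab i = false) or e2 A (clab i = true) placed in degree       *)
(* cdeg i, together with the differential as a matrix cd (cd i j is the      *)
(* element of e_(clab i) A e_(clab j) by which summand j maps to summand i). *)
(* Composition of maps is matrix product (maps act by left multiplication).  *)
Section Complexes.
Variables (A : nzRingType).

Record cpx := Cpx {
  csz : nat;
  clab : 'I_csz -> bool;
  cdeg : 'I_csz -> int;
  cd : 'M[A]_csz }.
End Complexes.
Arguments csz {A} c.
Arguments clab {A} c i.
Arguments cdeg {A} c i.
Arguments cd {A} c.
Arguments Cpx {A} csz clab cdeg cd.
Section Complexes2.
Context {A : nzRingType} (e1 e2 : A).
Local Notation cpx := (cpx A).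

Definition eid (b : bool) : A := if b then e2 else e1.

Definition homd (C D : cpx) (s : int) (M : 'M[A]_(csz D, csz C)) : Prop :=
  forall i j, M i j = eid (clab D i) * M i j * eid (clab C j) /\
              (M i j <> 0 -> cdeg D i = cdeg C j + s).

Definition is_cpx (C : cpx) : Prop := homd C C 1 (cd C) /\ cd C *m cd C = 0.

Definition chain_map (C D : cpx) (F : 'M[A]_(csz D, csz C)) : Prop :=
  homd C D 0 F /\ cd D *m F = F *m cd C.

Definition homotopic (C D : cpx) (F G : 'M[A]_(csz D, csz C)) : Prop :=
  exists H : 'M[A]_(csz D, csz C),
    homd C D (-1) H /\ F - G = H *m cd C + cd D *m H.

Definition idm (C : cpx) : 'M[A]_(csz C) :=
  \matrix_(i, j) (if i == j then eid (clab C i) else 0).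

Definition isoK (C D : cpx) : Prop :=
  exists (F : 'M[A]_(csz D, csz C)) (G : 'M[A]_(csz C, csz D)),
    chain_map C D F /\ chain_map D C G /\
    homotopic C C (G *m F) (idm C) /\ homotopic D D (F *m G) (idm D).

Definition zero_cpx : cpx := Cpx 0 (fun _ => false) (fun _ => 0) 0.

(* shift X[1] (X[1]^k = X^(k+1), differential negated) and its inverse *)
Definition shift (C : cpx) : cpx :=
  Cpx (csz C) (clab C) (fun i => cdeg C i - 1) (- cd C).
Definition unshift (C : cpx) : cpx :=
  Cpx (csz C) (clab C) (fun i => cdeg C i + 1) (- cd C).
Definition shiftn (n : nat) (C : cpx) : cpx := iter n shift C.

Definition sumlab {m n : nat} (f : 'I_m -> bool) (g : 'I_n -> bool)
  (i : 'I_(m + n)) : bool :=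
  match split i with inl a => f a | inr b => g b end.
Definition sumdeg {m n : nat} (f : 'I_m -> int) (g : 'I_n -> int)
  (i : 'I_(m + n)) : int :=
  match split i with inl a => f a | inr b => g b end.

Definition dsum (C D : cpx) : cpx :=
  Cpx (csz C + csz D) (sumlab (clab C) (clab D)) (sumdeg (cdeg C) (cdeg D))
       (block_mx (cd C) 0 0 (cd D)).

(* mapping cone of F : C -> D:  Cone^k = C^(k+1) (+) D^k *)
Definition cone (C D : cpx) (F : 'M[A]_(csz D, csz C)) : cpx :=
  Cpx (csz C + csz D) (sumlab (clab C) (clab D))
       (sumdeg (fun i => cdeg C i - 1) (cdeg D))
       (block_mx (- cd C) 0 F (cd D)).

Definition summand (X Y : cpx) : Prop :=
  exists Z : cpx, is_cpx Z /\ isoK (dsum X Z) Y.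

Inductive thick (S : cpx -> Prop) : cpx -> Prop :=
  | thick_base X : is_cpx X -> S X -> thick S X
  | thick_iso X Y : thick S X -> is_cpx Y -> isoK X Y -> thick S Y
  | thick_shift X : thick S X -> thick S (shift X)
  | thick_unshift X : thick S X -> thick S (unshift X)
  | thick_cone X Y (F : 'M[A]_(csz Y, csz X)) :
      thick S X -> thick S Y -> chain_map X Y F -> thick S (@cone X Y F)
  | thick_summand X Y : thick S Y -> is_cpx X -> summand X Y -> thick S X.

Definition two_term (C : cpx) : Prop :=
  is_cpx C /\ forall i, cdeg C i = 0 \/ cdeg C i = -1.

Definition silting (T : cpx) : Prop :=
  is_cpx T /\
  (forall (l : nat) (F : 'M[A]_(csz (shiftn l T), csz T)),
     (0 < l)%N -> chain_map T (shiftn l T) F -> homotopic T (shiftn l T) F 0) /\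
  (forall X, is_cpx X -> thick (fun Y => Y = T) X).

Definition indecomposable (X : cpx) : Prop :=
  is_cpx X /\ ~ isoK X zero_cpx /\
  forall Y Z, is_cpx Y -> is_cpx Z -> isoK X (dsum Y Z) ->
    isoK Y zero_cpx \/ isoK Z zero_cpx.

Definition basic_two_silting (T1 T2 : cpx) : Prop :=
  two_term T1 /\ two_term T2 /\ indecomposable T1 /\ indecomposable T2 /\
  ~ isoK T1 T2 /\ silting (dsum T1 T2).

End Complexes2.

(* K_0(proj A)_R = R^2 with basis [P1], [P2]; g-vectors and P(A).            *)
Section Geometry.
Variable R : realType.

Definition vP1 : 'rV[R]_2 := delta_mx 0 0.
Definition vP2 : 'rV[R]_2 := delta_mx 0 1.

Definition vP (b : bool) : 'rV[R]_2 := if b then vP2 else vP1.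

Definition gvec {A : nzRingType} (X : cpx A) : 'rV[R]_2 :=
  \sum_(i < csz X) ((-1) ^ (cdeg X i)) *: vP (clab X i).

Definition conv0 (u v x : 'rV[R]_2) : Prop :=
  exists a b c : R, 0 <= a /\ 0 <= b /\ 0 <= c /\ a + b + c = 1 /\
    x = b *: u + c *: v.

Definition PA {A : nzRingType} (e1 e2 : A) (x : 'rV[R]_2) : Prop :=
  exists T1 T2 : cpx A, basic_two_silting e1 e2 T1 T2 /\
    conv0 (gvec T1) (gvec T2) x.

Definition convex_set (S : 'rV[R]_2 -> Prop) : Prop :=
  forall x y (t : R), S x -> S y -> 0 <= t <= 1 -> S (t *: x + (1 - t) *: y).

Definition g_convex {A : nzRingType} (e1 e2 : A) : Prop :=
  convex_set (PA e1 e2).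

Definition Qreg (x : 'rV[R]_2) : Prop :=
  exists a b : R, 0 <= a /\ b <= 0 /\ x = a *: vP1 + b *: vP2.

Definition Delta (us : seq 'rV[R]_2) (x : 'rV[R]_2) : Prop :=
  exists t : nat, (0 < t < size us)%N /\ conv0 (nth 0 us t.-1) (nth 0 us t) x.

Definition PAQ_is {A : nzRingType} (e1 e2 : A) (us : seq 'rV[R]_2) : Prop :=
  forall x, (PA e1 e2 x /\ Qreg x) <-> Delta us x.

End Geometry.

(* Main.v *)
(** Two silting pairs whose g-vector cones share a point have a common summand for every generator
    of positive weight there: the equality of g-vectors forces Hom(V, X[1]) = 0 to imply
    Hom(U, X[1]) = 0, by an Euler characteristic count on the trace submodule of V in H^0(X), and a
    two-term complex without extensions with a silting T in both directions lies in add T.  Hence the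
    simplices of P(A) have disjoint interiors, and one silting pair decides P(A) on its cone.  The
    g-vectors of a pair have determinant 1 or -1, because T generates.

    In the quadrant of [P_l] and -[P_l'], let k and m be the minimal numbers of left and right
    generators of e_l A e_l'.  The minimal approximations give the pairs ([P_l], k[P_l] - [P_l'])
    and ([P_l] - m[P_l'], -[P_l']).  Convexity gives |a + b| <= 1 on P(A), so k, m <= 2; integrality
    and the determinant rule out k = m = 2, and for k = 1, m = 2 the point (1, -3/2) can only lie in
    the simplex of (1, -1) and (1, -2).  That these two complexes form a silting pair is the vanishing
    of one Ext group, which is condition (L); the case k = 2, m = 1 is condition (R). *)

Require Import Defs.
From HB Require Import structures.
From mathcomp Require Import all_boot all_order all_algebra all_field.
From mathcomp Require Import reals boolp zify ring lra.
Import Order.TTheory GRing.Theory Num.Theory.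
Set Implicit Arguments. Unset Strict Implicit. Unset Printing Implicit Defensive.
Local Open Scope ring_scope.

(** Vanishing between two pairs results from two inequalities that meet. For a two-term X and a
    submodule W containing X^-1 and the image of the differential, X/W is a quotient of the module
    H^0(X), and the Euler characteristic of Hom(U, X/W) is linear in the g-vector of U. Let W be the
    trace of the U's that represent a point of P(A): they have no maps to X/W, so their weighted sum
    is at most 0. The V's of the other representation have no extensions with H^0(X), hence none
    with X/W, so their sum is at least 0. The sums agree, and every term vanishes. The obstacle is
    that complexes are matrices compared up to homotopy, while summands have to be exhibited.
    Fitting's lemma in the finite dimensional algebra of chain endomorphisms produces strict
    idempotents, and these split the graded object. Sizes, label counts and g-vectors are additive
    under such a splitting, which turns indecomposability of the explicit complexes into a count of
    generators. *)

(* The graded direct sum with an arbitrary differential: both [dsum] and [cone] are convertible to instances of it. *)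
Definition gsum (A : nzRingType) (C D : cpx A) d : cpx A :=
  Cpx (csz C + csz D) (sumlab (clab C) (clab D)) (sumdeg (cdeg C) (cdeg D)) d.
Arguments gsum {A} C D d.

Definition unshiftn (A : nzRingType) n (X : cpx A) := iter n unshift X.

(** * Morphisms up to homotopy *)

Section Homs.
Variables (A : nzRingType) (e1 e2 : A).
Hypothesis cpo : complete_prim_orth e1 e2.
Local Notation cpx := (cpx A).
Local Notation eid := (eid e1 e2).
Local Notation homd := (homd e1 e2).
Local Notation is_cpx := (is_cpx e1 e2).
Local Notation chain_map := (chain_map e1 e2).
Local Notation homotopic := (homotopic e1 e2).
Local Notation idm := (idm e1 e2).
Local Notation isoK := (isoK e1 e2).

Lemma eidK b : eid b * eid b = eid b.
Proof. by case: b; case: cpo => [[? _] [[? _] _]]. Qed.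

Lemma eid_orth b c : b != c -> eid b * eid c = 0.
Proof. by case: b c => [] [] //= _; case: cpo => _ [_ [? [? _]]]. Qed.

Lemma homdD C D s M M' : homd C D s M -> homd C D s M' -> homd C D s (M + M').
Proof.
move=> h h' i j; have [a b] := h i j; have [a' b'] := h' i j; rewrite !mxE.
split; first by rewrite mulrDr mulrDl -a -a'.
have [->|/eqP/b//] := eqVneq (M i j) 0; rewrite add0r; exact: b'.
Qed.

Lemma homdN C D s M : homd C D s M -> homd C D s (- M).
Proof.
move=> h i j; have [a b] := h i j; rewrite !mxE mulrN mulNr -a; split=> // n.
by apply: b => z; apply: n; rewrite z oppr0.
Qed.

Lemma homdB C D s M M' : homd C D s M -> homd C D s M' -> homd C D s (M - M').
Proof. by move=> h h'; apply: homdD => //; apply: homdN. Qed.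

Lemma homd0 C D s : homd C D s 0.
Proof. by move=> i j; rewrite !mxE mulr0 mul0r; split. Qed.

Lemma homd_eidl C D s M : homd C D s M -> forall i j, eid (clab D i) * M i j = M i j.
Proof. by move=> h i j; have [a _] := h i j; rewrite a !mulrA eidK. Qed.

Lemma homd_eidr C D s M : homd C D s M -> forall i j, M i j * eid (clab C j) = M i j.
Proof. by move=> h i j; have [a _] := h i j; rewrite a -!mulrA eidK. Qed.

Lemma homdM C D E s t (M : 'M_(csz E, csz D)) (M' : 'M_(csz D, csz C)) :
  homd D E s M -> homd C D t M' -> homd C E (t + s) (M *m M').
Proof.
move=> h h' i j; rewrite !mxE; split.
  rewrite big_distrr big_distrl /=; apply: eq_bigr => k _.
  by rewrite -mulrA -[_ * _ * eid _]mulrA (homd_eidr h') mulrA (homd_eidl h).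
have [k nk|z] := pickP (fun k => M i k * M' k j != 0); last first.
  by rewrite big1 // => k _; apply/eqP; apply: negbFE; exact: z.
have [_ b] := h i k; have [_ b'] := h' k j.
rewrite b => [|z]; last by move: nk; rewrite z mul0r eqxx.
rewrite b' => [|z]; last by move: nk; rewrite z mulr0 eqxx.
by rewrite addrA.
Qed.

Lemma homd_idm C : homd C C 0 (idm C).
Proof.
move=> i j; rewrite !mxE; case: eqP => [->|_]; rewrite ?addr0 ?eidK ?mulr0 ?mul0r; split=> //.
Qed.

Lemma idmMl C D s M : homd C D s M -> idm D *m M = M.
Proof.
move=> h; apply/matrixP=> i j; rewrite mxE (bigD1 i) //= big1 ?addr0.
  by rewrite mxE eqxx (homd_eidl h).
by move=> k; rewrite mxE eq_sym => /negPf ->; rewrite mul0r.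
Qed.

Lemma idmMr C D s M : homd C D s M -> M *m idm C = M.
Proof.
move=> h; apply/matrixP=> i j; rewrite mxE (bigD1 j) //= big1 ?addr0.
  by rewrite mxE eqxx (homd_eidr h).
by move=> k; rewrite mxE => /negPf ->; rewrite mulr0.
Qed.

Lemma idmK C : idm C *m idm C = idm C.
Proof. exact: (idmMl (@homd_idm C)). Qed.

Lemma chain_mapD C D F G : chain_map C D F -> chain_map C D G -> chain_map C D (F + G).
Proof. by move=> [h c] [h' c']; split; [apply: homdD|rewrite mulmxDr mulmxDl c c']. Qed.

Lemma chain_mapN C D F : chain_map C D F -> chain_map C D (- F).
Proof. by move=> [h c]; split; [apply: homdN|rewrite mulmxN mulNmx c]. Qed.

Lemma chain_mapB C D F G : chain_map C D F -> chain_map C D G -> chain_map C D (F - G).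
Proof. by move=> h h'; apply: chain_mapD => //; apply: chain_mapN. Qed.

Lemma chain_map0 C D : chain_map C D 0.
Proof. by split; [apply: homd0|rewrite mulmx0 mul0mx]. Qed.

Lemma chain_mapM C D E (F : 'M_(csz E, csz D)) (G : 'M_(csz D, csz C)) :
  chain_map D E F -> chain_map C D G -> chain_map C E (F *m G).
Proof.
move=> [h c] [h' c']; split; first by have := homdM h h'; rewrite addr0.
by rewrite mulmxA c -mulmxA c' mulmxA.
Qed.

Lemma chain_map_idm C : is_cpx C -> chain_map C C (idm C).
Proof. by case=> h _; split; [apply: homd_idm|rewrite (idmMl h) (idmMr h)]. Qed.

Lemma homotopic_refl C D F : homotopic C D F F.
Proof. by exists 0; split; [apply: homd0|rewrite subrr mul0mx mulmx0 addr0]. Qed.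

Lemma homotopic_sym C D F G : homotopic C D F G -> homotopic C D G F.
Proof.
move=> [H [h e]]; exists (- H); split; first exact: homdN.
by rewrite mulNmx mulmxN -opprD -e opprB.
Qed.

Lemma homotopicD C D F G F' G' : homotopic C D F G -> homotopic C D F' G' ->
  homotopic C D (F + F') (G + G').
Proof.
move=> [H [h e]] [H' [h' e']]; exists (H + H'); split; first exact: homdD.
by rewrite mulmxDl mulmxDr opprD addrACA e e' addrACA.
Qed.

Lemma homotopicN C D F G : homotopic C D F G -> homotopic C D (- F) (- G).
Proof.
move=> [H [h e]]; exists (- H); split; first exact: homdN.
by rewrite mulNmx mulmxN -!opprD e.
Qed.

Lemma homotopicB C D F G F' G' : homotopic C D F G -> homotopic C D F' G' ->
  homotopic C D (F - F') (G - G').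
Proof. by move=> h h'; apply: homotopicD => //; apply: homotopicN. Qed.

Lemma homotopic_trans C D F G H : homotopic C D F G -> homotopic C D G H -> homotopic C D F H.
Proof.
move=> [P [p e]] [P' [p' e']]; exists (P + P'); split; first exact: homdD.
by rewrite mulmxDl mulmxDr addrACA -e -e' addrA subrK.
Qed.

Lemma homotopicMl C D E (F G : 'M_(csz D, csz C)) (P : 'M_(csz E, csz D)) :
  chain_map D E P -> homotopic C D F G -> homotopic C E (P *m F) (P *m G).
Proof.
move=> [p c] [H [h e]]; exists (P *m H); split; first by have := homdM p h; rewrite addr0.
by rewrite -mulmxBr e mulmxDr !mulmxA c.
Qed.

Lemma homotopicMr C D E (F G : 'M_(csz E, csz D)) (P : 'M_(csz D, csz C)) :
  chain_map C D P -> homotopic D E F G -> homotopic C E (F *m P) (G *m P).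
Proof.
move=> [p c] [H [h e]]; exists (H *m P); split; first by have := homdM h p; rewrite add0r.
by rewrite -mulmxBl e mulmxDl -!mulmxA c.
Qed.

Definition nohom (X Y : cpx) := forall F, chain_map X Y F -> homotopic X Y F 0.

(** A direct summand up to homotopy, kept without a chosen complement: this is enough for vanishing
    of Hom to pass from [Y] to [X]. *)
Definition retract (X Y : cpx) := exists F G, chain_map X Y F /\ chain_map Y X G /\
  homotopic X X (G *m F) (idm X).

Lemma nohom_retract_l X X' Y : retract X X' -> nohom X' Y -> nohom X Y.
Proof.
move=> [F [G [f [g e]]]] n P p.
have /n/(homotopicMr f) := chain_mapM p g; rewrite mul0mx -mulmxA => h.
apply: homotopic_trans h; apply: homotopic_sym.
by have := homotopicMl p e; rewrite (idmMr (proj1 p)).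
Qed.

Lemma nohom_retract_r X Y Y' : retract Y Y' -> nohom X Y' -> nohom X Y.
Proof.
move=> [F [G [f [g e]]]] n P p.
have /n/(homotopicMl g) := chain_mapM f p; rewrite mulmx0 mulmxA => h.
apply: homotopic_trans h; apply: homotopic_sym.
by have := homotopicMr p e; rewrite (idmMl (proj1 p)).
Qed.

Lemma retract_trans X Y Z : retract X Y -> retract Y Z -> retract X Z.
Proof.
move=> [F [G [f [g e]]]] [F' [G' [f' [g' e']]]]; exists (F' *m F), (G *m G').
split; [exact: chain_mapM|split; first exact: chain_mapM].
apply: homotopic_trans e; rewrite mulmxA -[G *m _ *m _]mulmxA.
have := homotopicMr f (homotopicMl g e').
by rewrite (idmMr (proj1 g)).
Qed.

Lemma isoK_retract X Y : isoK X Y -> retract X Y.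
Proof. by move=> [F [G [f [g [e _]]]]]; exists F, G. Qed.

Lemma isoK_sym X Y : isoK X Y -> isoK Y X.
Proof. by move=> [F [G [f [g [e e']]]]]; exists G, F. Qed.

Lemma isoK_refl X : is_cpx X -> isoK X X.
Proof.
move=> cX; have i := chain_map_idm cX; exists (idm X), (idm X); split=> //; split=> //.
rewrite idmK; split; exact: homotopic_refl.
Qed.

Lemma homd_shift_r X Y s M : homd X (shift Y) s M <-> homd X Y (s + 1) M.
Proof. by split=> h i j; have [a b] := h i j; split=> // /b /=; lia. Qed.

Lemma homd_shift_l X Y s M : homd (shift X) Y s M <-> homd X Y (s - 1) M.
Proof. by split=> h i j; have [a b] := h i j; split=> // /b /=; lia. Qed.

Lemma homd_unshift_r X Y s M : homd X (unshift Y) s M <-> homd X Y (s - 1) M.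
Proof. by split=> h i j; have [a b] := h i j; split=> // /b /=; lia. Qed.

Lemma homd_unshift_l X Y s M : homd (unshift X) Y s M <-> homd X Y (s + 1) M.
Proof. by split=> h i j; have [a b] := h i j; split=> // /b /=; lia. Qed.

Lemma is_cpx_shift X : is_cpx X -> is_cpx (shift X).
Proof.
move=> [h c]; split; last by rewrite /= mulNmx mulmxN opprK.
by apply/homd_shift_l/homd_shift_r; rewrite subrK; apply: homdN.
Qed.

Lemma is_cpx_unshift X : is_cpx X -> is_cpx (unshift X).
Proof.
move=> [h c]; split; last by rewrite /= mulNmx mulmxN opprK.
by apply/homd_unshift_l/homd_unshift_r; rewrite addrK; apply: homdN.
Qed.

(** Shifting moves from one argument to the other without changing the matrices; only the homotopies
    change sign, because a shift negates the differential. *)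
Lemma nohom_adj X Y : nohom X (shift Y) <-> nohom (unshift X) Y.
Proof.
split=> n F [h c].
  have [|H [hH e]] := n F.
    split; first by apply/homd_shift_r; move/homd_unshift_l: h.
    by rewrite /= mulNmx c /= mulmxN opprK.
  exists (- H); split; last by rewrite e /= mulmxN !mulNmx mulmxN !opprK.
  by apply: homdN; apply/homd_unshift_l; move/homd_shift_r: hH.
have [|H [hH e]] := n F.
  split; first by apply/homd_unshift_l; move/homd_shift_r: h.
  by rewrite /= mulmxN -c /= mulNmx opprK.
exists (- H); split; last by rewrite e /= mulmxN !mulNmx !mulmxN opprK.
by apply: homdN; apply/homd_shift_r; move/homd_unshift_l: hH.
Qed.

Lemma nohom_shift2 X Y : nohom (shift X) (shift Y) <-> nohom X Y.
Proof.
split=> n F [h c].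
  have [|H [hH e]] := n F.
    split; first by apply/homd_shift_l/homd_shift_r; rewrite subrK.
    by rewrite /= mulNmx c mulmxN.
  exists (- H); split; last by rewrite e /= !mulmxN !mulNmx.
  by apply: homdN; move/homd_shift_l/homd_shift_r: hH; rewrite subrK.
have [|H [hH e]] := n F.
  split; first by move/homd_shift_l/homd_shift_r: h; rewrite subrK.
  by move: c; rewrite /= mulmxN mulNmx => /oppr_inj.
exists (- H); split; last by rewrite e /= !mulmxN !mulNmx !opprK.
by apply: homdN; apply/homd_shift_l/homd_shift_r; rewrite subrK.
Qed.

Lemma nohom_unshiftK X Y : nohom X (shift (unshift Y)) <-> nohom X Y.
Proof.
split=> n F [h c].
  have [|H [hH e]] := n F.
    split; first by apply/homd_shift_r/homd_unshift_r; rewrite addrK.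
    by rewrite /= opprK.
  exists H; split; last by rewrite e /= opprK.
  by move/homd_shift_r/homd_unshift_r: hH; rewrite addrK.
have [|H [hH e]] := n F.
  split; first by move/homd_shift_r/homd_unshift_r: h; rewrite addrK.
  by move: c; rewrite /= opprK.
exists H; split; last by rewrite e /= opprK.
by apply/homd_shift_r/homd_unshift_r; rewrite addrK.
Qed.

Lemma shiftnSr n (X : cpx) : shiftn n.+1 X = shiftn n (shift X).
Proof. by rewrite /shiftn iterSr. Qed.

Lemma nohom_adjn n X Y : nohom X (shiftn n Y) <-> nohom (unshiftn n X) Y.
Proof.
elim: n X Y => [|n IH] X Y //; rewrite shiftnSr; split.
  by move/IH/nohom_adj.
by move=> h; apply/IH/nohom_adj.
Qed.

Lemma nohom_shiftn_unshift n X Y : nohom X (shiftn n.+1 (unshift Y)) <-> nohom X (shiftn n Y).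
Proof.
rewrite shiftnSr; split; first by move/nohom_adjn/nohom_unshiftK/nohom_adjn.
by move=> h; apply/nohom_adjn/nohom_unshiftK/nohom_adjn.
Qed.

Lemma homd_row C D d Y s (a : 'M_(_, csz C)) (b : 'M_(_, csz D)) :
  homd (gsum C D d) Y s (row_mx a b) <-> homd C Y s a /\ homd D Y s b.
Proof.
split=> [h|[ha hb]].
  split=> i j.
    have := h i (lshift _ j); rewrite row_mxEl /= /sumlab /sumdeg.
    by rewrite (unsplitK (inl j)).
  have := h i (rshift _ j); rewrite row_mxEr /= /sumlab /sumdeg.
  by rewrite (unsplitK (inr j)).
move=> i j; rewrite mxE /= /sumlab /sumdeg; case: (split j) => k; [exact: ha|exact: hb].
Qed.

Lemma homd_col C D d X s (a : 'M_(csz C, _)) (b : 'M_(csz D, _)) :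
  homd X (gsum C D d) s (col_mx a b) <-> homd X C s a /\ homd X D s b.
Proof.
split=> [h|[ha hb]].
  split=> i j.
    have := h (lshift _ i) j; rewrite col_mxEu /= /sumlab /sumdeg.
    by rewrite (unsplitK (inl i)).
  have := h (rshift _ i) j; rewrite col_mxEd /= /sumlab /sumdeg.
  by rewrite (unsplitK (inr i)).
move=> i j; rewrite mxE /= /sumlab /sumdeg; case: (split i) => k; [exact: ha|exact: hb].
Qed.

Lemma homd_block C D d C' D' d' s (a : 'M_(csz C', csz C)) (b : 'M_(csz C', csz D))
    (a' : 'M_(csz D', csz C)) (b' : 'M_(csz D', csz D)) :
  homd C C' s a -> homd D C' s b -> homd C D' s a' -> homd D D' s b' ->
  homd (gsum C D d) (gsum C' D' d') s (block_mx a b a' b').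
Proof.
move=> h1 h2 h3 h4; rewrite /block_mx.
by apply/(@homd_col C' D' d' (gsum C D d)); split; apply/homd_row.
Qed.

Lemma is_cpx_dsum C D : is_cpx C -> is_cpx D -> is_cpx (dsum C D).
Proof.
move=> [h c] [h' c']; split.
  by apply: (@homd_block C D _ C D) => //; apply: homd0.
by rewrite /= mulmx_block !mulmx0 !mul0mx !addr0 add0r c c' -block_mx0.
Qed.

Lemma is_cpx_cone C D F : is_cpx C -> is_cpx D -> chain_map C D F -> is_cpx (cone C D F).
Proof.
move=> [h c] [h' c'] [hF cF]; split.
  apply: (@homd_block (shift C) D _ (shift C) D) => //; last 1 first.
  - by apply/homd_shift_l; rewrite subrr.
  - by apply/homd_shift_l/homd_shift_r; rewrite subrK; apply: homdN.
  exact: homd0.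
rewrite /= mulmx_block !mulmx0 !mul0mx !addr0 add0r mulNmx !mulmxN opprK c c' cF addNr.
by rewrite -block_mx0.
Qed.

(** Exactness of Hom(C[1], Y) -> Hom(cone, Y) -> Hom(D, Y): a homotopy [h] killing the component on
    D corrects the other component to [a - h *m F], which is then a chain map on C[1]. *)
Lemma nohom_cone_l C D F Y : chain_map C D F ->
  nohom (shift C) Y -> nohom D Y -> nohom (cone C D F) Y.
Proof.
move=> [hF cF] nC nD M; rewrite -[M]hsubmxK; set a := lsubmx M; set b := rsubmx M.
move=> [/(@homd_row (shift C) D) [ha hb]]; rewrite mul_mx_row mul_row_block /= mulmx0 add0r.
move=> /eq_row_mx [ca cb].
have [h [hh]] : homotopic D Y b 0 by apply: nD.
rewrite subr0 => eh.
have hhF : homd (shift C) Y 0 (h *m F) by apply/homd_shift_l; have := homdM hh hF; rewrite add0r.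
have [|g [hg]] := nC (a - h *m F).
  split; first exact: homdB.
  rewrite mulmxBr ca /= !mulmxN mulmxBl -[h *m F *m cd C]mulmxA -cF eh mulmxDl !mulmxA.
  by rewrite opprB addrA addrK addrC.
rewrite subr0 => eg.
exists (row_mx g h); split; first exact/(@homd_row (shift C) D).
rewrite subr0 mul_mx_row mul_row_block /= mulmx0 add0r add_row_mx -eh addrAC.
by rewrite -eg subrK.
Qed.

Lemma cone_col_chain X C D F (a : 'M_(csz C, csz X)) b : chain_map X (cone C D F) (col_mx a b) <->
  chain_map X (shift C) a /\ homd X D 0 b /\ F *m a + cd D *m b = b *m cd X.
Proof.
rewrite /Defs.chain_map /= mul_block_col mul0mx addr0 mul_col_mx; split.
  by move=> [/(@homd_col (shift C) D) [ha hb] /eq_col_mx [ca cb]].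
move=> [[ha ca] [hb cb]]; split; last by rewrite ca cb.
exact/(@homd_col (shift C) D).
Qed.

Lemma cone_col_homotopic X C D F (a : 'M_(csz C, csz X)) b h g :
  homd X C 0 h -> homd X D (-1) g -> a = h *m cd X - cd C *m h ->
  b = g *m cd X + F *m h + cd D *m g ->
  homotopic X (cone C D F) (col_mx a b) 0.
Proof.
move=> hh hg ea eb; exists (col_mx h g); split.
  apply/(@homd_col (shift C) D); split=> //; apply/homd_shift_r.
  by rewrite addrC subrr.
by rewrite subr0 /= mul_col_mx mul_block_col mul0mx addr0 add_col_mx ea eb mulNmx addrA.
Qed.

Lemma nohom_cone_r C D F X : chain_map C D F ->
  nohom X (shift C) -> nohom X D -> nohom X (cone C D F).
Proof.
move=> [hF cF] nC nD M; rewrite -[M]vsubmxK; set a := usubmx M; set b := dsubmx M.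
move/cone_col_chain => [/nC [h [/homd_shift_r]]]; rewrite addNr subr0 /= mulNmx => hh eh [hb cb].
have hFh : homd X D 0 (F *m h) by have := homdM hF hh; rewrite addr0.
have [|g [hg]] := nD (b - F *m h).
  split; first exact: homdB.
  rewrite mulmxBr mulmxBl -cb eh mulmxBr !mulmxA cF.
  by rewrite [RHS]addrC !addrA addNr add0r addrC.
rewrite subr0 => eg; apply: (cone_col_homotopic hh hg eh).
by rewrite addrAC -eg subrK.
Qed.

(** A map X -> D becomes null in the cone. The C-part of that null-homotopy is itself a chain map X
    -> C, hence null, and substituting it leaves a null-homotopy in D. *)
Lemma nohom_cone_target C D F X : chain_map C D F ->
  nohom X (cone C D F) -> nohom X C -> nohom X D.
Proof.
move=> [hF cF] nK nC P [hP cP].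
have [|M [hM]] := nK (col_mx 0 P).
  apply/cone_col_chain; split; first exact: chain_map0.
  by rewrite mulmx0 add0r.
rewrite subr0 -[M]vsubmxK; set h := usubmx M; set g := dsubmx M.
have [/homd_shift_r hh hg] : homd X (shift C) (-1) h /\ homd X D (-1) g.
  by apply/(@homd_col (shift C) D (cd (cone C D F))); rewrite vsubmxK.
rewrite /= mul_col_mx mul_block_col mul0mx addr0 add_col_mx => /eq_col_mx [e0 eP].
have [|p [hp]] := nC h.
  split; first by move: hh; rewrite addNr.
  by move/eqP: e0; rewrite mulNmx eq_sym subr_eq0 => /eqP.
rewrite subr0 => ep; exists (g + F *m p); split.
  by apply: homdD => //; have := homdM hF hp; rewrite addr0.
rewrite subr0 eP ep mulmxDl !mulmxDr !mulmxA cF.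
by rewrite !addrA addrAC.
Qed.

(** Once Hom(T, C[1]) = 0 has removed the first component, a chain map T -> D remains; it factors
    through [F] and so dies in the cone. The factorization is an equality of matrices, not one up to
    homotopy. *)
Lemma nohom_cone_approx C D F T : chain_map C D F ->
  (forall P, chain_map T D P -> exists2 Q, chain_map T C Q & P = F *m Q) ->
  nohom T (shift C) -> nohom T (cone C D F).
Proof.
move=> [hF cF] app nC M; rewrite -[M]vsubmxK; set a := usubmx M; set b := dsubmx M.
move/cone_col_chain => [/nC [h [/homd_shift_r]]]; rewrite addNr subr0 /= mulNmx => hh eh [hb cb].
have hFh : homd T D 0 (F *m h) by have := homdM hF hh; rewrite addr0.
have [|Q [hQ cQ] eQ] := app (b - F *m h).
  split; first exact: homdB.
  rewrite mulmxBr mulmxBl -cb eh mulmxBr !mulmxA cF.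
  by rewrite [RHS]addrC !addrA addNr add0r addrC.
have hhQ : homd T C 0 (h + Q) by move: hh; rewrite ?addNr => hh; apply: homdD.
apply: (cone_col_homotopic hhQ (@homd0 T D (-1))).
  by rewrite mulmxDl mulmxDr cQ eh opprD addrACA subrr addr0.
by rewrite mul0mx mulmx0 add0r addr0 mulmxDr -eQ addrC subrK.
Qed.
End Homs.

(** * Subspaces given by linear predicates *)

(** Induction on the codimension of a subspace contained in [P]: either it exhausts [P], or one more
    vector of [P] enlarges it. *)
Lemma vspace_of_pred (K : fieldType) (V : vectType K) (P : V -> Prop) :
  P 0 -> (forall k u v, P u -> P v -> P (k *: u + v)) ->
  exists U : {vspace V}, forall v, P v <-> v \in U.
Proof.
move=> P0 Plin.
have : forall n (U : {vspace V}), (forall v, v \in U -> P v) -> (dim V - \dim U <= n)%N ->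
    exists U' : {vspace V}, forall v, P v <-> v \in U'.
  elim=> [|n IH] U sU le.
    exists U => v; split=> [_|/sU//]; suff -> : U = fullv by rewrite memvf.
    by apply/eqP; rewrite eqEdim subvf /= dimvf; move: le; rewrite leqn0 subn_eq0.
  have [[v [Pv nv]]|nex] := pselect (exists v, P v /\ v \notin U); last first.
    exists U => v; split=> [Pv|/sU//]; apply: contrapT => nv; apply: nex.
    by exists v; split=> //; apply/negP.
  apply: (IH (U + <[v]>)%VS) => [w /memv_addP [u uU [_ /vlineP [k ->] ->]]|].
    by rewrite addrC; apply: Plin => //; apply: sU.
  have lt : (\dim U < \dim (U + <[v]>))%N.
    rewrite ltn_neqAle dimvS ?addvSl // andbT; apply: contra nv => /eqP e.
    have /eqP -> : U == (U + <[v]>)%VS by rewrite eqEdim addvSl e leqnn.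
    by rewrite memvE addvSr.
  have : (\dim (U + <[v]>) <= dim V)%N by rewrite -dimvf dimvS ?subvf.
  by move: le lt; lia.
move=> H; apply: (H _ 0%VS) (leqnn _) => v.
by rewrite memv0 => /eqP ->.
Qed.

Lemma lfun_of (K : fieldType) (U W : vectType K) (f : U -> W) :
  linear f -> exists g : 'Hom(U, W), forall u, g u = f u.
Proof.
move=> lin; pose F : {linear U -> W} := HB.pack f (GRing.isLinear.Build K U W *:%R f lin).
by exists (linfun F) => u; rewrite lfunE.
Qed.

(** * Dimensions of spaces of matrices *)

Section MatrixSpaces.
Variables (K : fieldType) (A : falgType K).

(** Matrices over [A] carry scalars from [A]; the structure over [K] is given by this map and
    transported to finite functions, where subspaces and dimensions are taken. *)
Definition kscale m n (k : K) (M : 'M[A]_(m, n)) : 'M[A]_(m, n) := map_mx (fun a => k *: a) M.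

Lemma kscaleMr m n p k (M : 'M[A]_(m, n)) (N : 'M[A]_(n, p)) :
  M *m kscale k N = kscale k (M *m N).
Proof.
apply/matrixP=> i j; rewrite !mxE scaler_sumr; apply: eq_bigr => l _.
by rewrite mxE scalerAr.
Qed.

Lemma kscaleMl m n p k (M : 'M[A]_(m, n)) (N : 'M[A]_(n, p)) :
  kscale k M *m N = kscale k (M *m N).
Proof.
apply/matrixP=> i j; rewrite !mxE scaler_sumr; apply: eq_bigr => l _.
by rewrite mxE scalerAl.
Qed.

Definition ksub m n (P : 'M[A]_(m, n) -> Prop) :=
  P 0 /\ forall k M N, P M -> P N -> P (kscale k M + N).

Definition klin m n p q (f : 'M[A]_(m, n) -> 'M[A]_(p, q)) :=
  forall k M N, f (kscale k M + N) = kscale k (f M) + f N.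

Local Notation V m n := {ffun 'I_m * 'I_n -> A}.
Definition mxv m n (M : 'M[A]_(m, n)) : V m n := [ffun ij => M ij.1 ij.2].
Definition vmx m n (v : V m n) : 'M[A]_(m, n) := \matrix_(i, j) v (i, j).

Lemma mxvK m n : cancel (@mxv m n) (@vmx m n).
Proof. by move=> M; apply/matrixP=> i j; rewrite !mxE ffunE. Qed.

Lemma vmxK m n : cancel (@vmx m n) (@mxv m n).
Proof. by move=> v; apply/ffunP=> [[i j]]; rewrite !ffunE mxE. Qed.

Lemma vmxP m n k (u v : V m n) : vmx (k *: u + v) = kscale k (vmx u) + vmx v.
Proof. by apply/matrixP=> i j; rewrite !mxE !ffunE. Qed.

Lemma vmx0 m n : vmx (0 : V m n) = 0.
Proof. by apply/matrixP=> i j; rewrite !mxE ffunE. Qed.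

Lemma mxvP m n k (M N : 'M[A]_(m, n)) : mxv (kscale k M + N) = k *: mxv M + mxv N.
Proof. by apply/ffunP=> ij; rewrite !ffunE !mxE. Qed.

Lemma ksub_vspace m n (P : 'M[A]_(m, n) -> Prop) : ksub P ->
  exists U : {vspace V m n}, forall v, P (vmx v) <-> v \in U.
Proof.
move=> [P0 Pl]; apply: vspace_of_pred; first by rewrite vmx0.
by move=> k u v pu pv; rewrite vmxP; apply: Pl.
Qed.

(** The zero space is the default value for a predicate that is not a subspace. *)
Definition mvs m n (P : 'M[A]_(m, n) -> Prop) : {vspace V m n} :=
  if pselect (exists U : {vspace V m n}, forall v, P (vmx v) <-> v \in U) is left h
  then projT1 (cid h) else 0%VS.

Lemma mvsP m n (P : 'M[A]_(m, n) -> Prop) : ksub P -> forall v, P (vmx v) <-> v \in mvs P.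
Proof.
move=> /ksub_vspace h; rewrite /mvs; case: pselect => // h'.
exact: (projT2 (cid h')).
Qed.

Lemma memmvs m n (P : 'M[A]_(m, n) -> Prop) : ksub P -> forall M, P M <-> mxv M \in mvs P.
Proof. by move=> kP M; rewrite -{1}[M]mxvK; apply: mvsP. Qed.

Definition mdim m n (P : 'M[A]_(m, n) -> Prop) : nat := \dim (mvs P).

Lemma mdimS m n (P Q : 'M[A]_(m, n) -> Prop) : ksub P -> ksub Q ->
  (forall M, P M -> Q M) -> (mdim P <= mdim Q)%N.
Proof.
move=> kP kQ h; apply: dimvS; apply/subvP=> v /(mvsP kP) /h /(mvsP kQ) //.
Qed.

Lemma mdim_eq m n (P Q : 'M[A]_(m, n) -> Prop) : ksub P -> ksub Q ->
  (forall M, P M -> Q M) -> mdim P = mdim Q -> forall M, Q M -> P M.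
Proof.
move=> kP kQ h e M /(memmvs kQ) MQ; apply/(memmvs kP).
suff -> : mvs P = mvs Q by [].
apply/eqP; rewrite eqEdim; apply/andP; split; last by rewrite /mdim in e; rewrite e.
by apply/subvP=> v /(mvsP kP) /h /(mvsP kQ) //.
Qed.

Lemma mdim_ext m n (P Q : 'M[A]_(m, n) -> Prop) : (forall M, P M <-> Q M) -> mdim P = mdim Q.
Proof. by move=> h; congr mdim; apply/funext=> M; apply/propext. Qed.

Lemma ksub_span m n (P : 'M[A]_(m, n) -> Prop) : ksub P ->
  exists s : seq 'M[A]_(m, n), (forall M, M \in s -> P M) /\
    forall M, P M -> exists c : nat -> K, M = \sum_(i < size s) kscale (c i) s`_i.
Proof.
move=> kP; pose b := vbasis (mvs P); exists [seq vmx v | v <- b]; split.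
  by move=> _ /mapP [v vb ->]; apply/(mvsP kP); apply: vbasis_mem.
move=> M /(memmvs kP) Mv; have e := coord_vbasis Mv.
exists (fun i => oapp (fun i => coord b i (mxv M)) 0 (insub i)).
rewrite -[LHS]mxvK e size_map size_tuple.
have vs r (F : 'I_r -> V m n) : vmx (\sum_i F i) = \sum_i vmx (F i).
  apply: (big_morph (@vmx m n)) => [u v|]; last exact: vmx0.
  by have := vmxP 1 u v; rewrite scale1r => ->; congr (_ + _); apply/matrixP=> i j; rewrite !mxE scale1r.
rewrite vs; apply: eq_bigr => i _; rewrite (nth_map 0) ?size_tuple //.
have := vmxP (coord b i (mxv M)) b`_i 0; rewrite addr0 vmx0 addr0 => ->.
by rewrite -e valK.
Qed.

Lemma klin0 m n p q (f : 'M[A]_(m, n) -> 'M[A]_(p, q)) : klin f -> f 0 = 0.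
Proof.
move=> lf; have := lf (-1) 0 0; rewrite (_ : kscale _ _ = 0) ?addr0 => [->|].
  by apply/matrixP=> i j; rewrite !mxE scaleN1r addNr.
by apply/matrixP=> i j; rewrite !mxE scaler0.
Qed.

Lemma ksub_preim m n p q (P : 'M[A]_(m, n) -> Prop) (Q : 'M[A]_(p, q) -> Prop) f :
  ksub P -> ksub Q -> klin f -> ksub (fun M => P M /\ Q (f M)).
Proof.
move=> [P0 Pl] [Q0 Ql] lf; split=> [|k M N [pM qM] [pN qN]]; first by rewrite klin0.
by rewrite lf; split; [apply: Pl|apply: Ql].
Qed.

Lemma ksub_img m n p q (P : 'M[A]_(m, n) -> Prop) (Q : 'M[A]_(p, q) -> Prop) f :
  ksub P -> ksub Q -> klin f -> ksub (fun N => exists M, P M /\ Q (N - f M)).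
Proof.
move=> [P0 Pl] [Q0 Ql] lf; split; first by exists 0; rewrite klin0 // subrr.
move=> k N N' [M [pM qM]] [M' [pM' qM']]; exists (kscale k M + M').
split; first exact: Pl.
rewrite lf (_ : _ - _ = kscale k (N - f M) + (N' - f M')); first exact: Ql.
by apply/matrixP=> i j; rewrite !mxE scalerBr opprD addrACA.
Qed.

(** Rank and nullity of the map from P to the quotient by Q induced by [f], with image and kernel
    both pulled back: f(P) + Q, and the part of P sent into Q. *)
Lemma mdim_rank m n p q (P : 'M[A]_(m, n) -> Prop) (Q : 'M[A]_(p, q) -> Prop) f :
  ksub P -> ksub Q -> klin f ->
  (mdim (fun N => exists M, P M /\ Q (N - f M)%R) + mdim (fun M => P M /\ Q (f M)) = mdim P + mdim Q)%N.
Proof.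
move=> kP kQ lf.

have [g gE] : exists g : 'Hom(V m n, V p q), forall v, g v = mxv (f (vmx v)).
  by apply: lfun_of => k u v; rewrite vmxP lf mxvP.
pose U := mvs P; pose Z := mvs Q; pose U' := (U :&: g @^-1: Z)%VS.
have k1 := ksub_preim kP kQ lf; have k2 := ksub_img kP kQ lf.
have -> : mdim (fun M => P M /\ Q (f M)) = \dim U'.
  congr (\dim _); apply/vspaceP=> v; apply/idP/idP.
    move/(mvsP k1) => [pv qv]; rewrite memv_cap; apply/andP; split; first exact/(mvsP kP).
    by rewrite -memv_preim gE; apply/(mvsP kQ); rewrite mxvK.
  rewrite memv_cap => /andP [/(mvsP kP) pv]; rewrite -memv_preim gE => /(mvsP kQ).
  by rewrite mxvK => qv; apply/(mvsP k1).
have -> : mdim (fun N => exists M, P M /\ Q (N - f M)) = \dim (g @: U + Z)%VS.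
  congr (\dim _); apply/vspaceP=> v; apply/idP/idP.
    move/(mvsP k2) => [M [pM qM]]; apply/memv_addP.
    exists (g (mxv M)); first by apply: memv_img; apply/(memmvs kP).
    exists (v - g (mxv M)); last by rewrite addrC subrK.
    apply/(mvsP kQ); rewrite gE mxvK.
    suff -> : vmx (v - mxv (f M)) = vmx v - f M by [].
    by apply/matrixP=> i j; rewrite !mxE !ffunE.
  move/memv_addP => [_ /memv_imgP [u uU ->] [z zZ ->]].
  apply/(mvsP k2); exists (vmx u); split; first exact/(mvsP kP).
  rewrite gE; suff -> : vmx (mxv (f (vmx u)) + z) - f (vmx u) = vmx z by apply/(mvsP kQ).
  by apply/matrixP=> i j; rewrite !mxE !ffunE addrC addKr.
have e1 := limg_ker_dim g U; have e2 := limg_ker_dim g U'.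
have e3 : (U :&: lker g = U' :&: lker g)%VS.
  apply/vspaceP=> v; rewrite !memv_cap -memv_preim.
  case: (boolP (v \in lker g)); rewrite ?andbF //.
  by rewrite memv_ker => /eqP ->; rewrite mem0v !andbT.
have e4 : (g @: U' = g @: U :&: Z)%VS.
  apply/vspaceP=> w; rewrite memv_cap; apply/idP/andP.
    move/memv_imgP=> [v]; rewrite memv_cap -memv_preim => /andP [vU gZ] ->.
    by split=> //; apply: memv_img.
  move=> [/memv_imgP [v vU ->] gZ]; apply: memv_img.
  by rewrite memv_cap vU -memv_preim.
have e6 := dimv_sum_cap (g @: U) Z.
by move: e1 e2 e6; rewrite /mdim -/U -/Z e3 e4 => <- <- e6; rewrite addnCA e6 addnA.
Qed.

(** Read as dim P/P0 <= dim Q/Q0. In [mdim_rank] for P and Q0, the image f(P) + Q0 lies in Q and the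
    kernel lies in P0. *)
Lemma mdim_inj m n p q (P P0 : 'M[A]_(m, n) -> Prop) (Q Q0 : 'M[A]_(p, q) -> Prop) f :
  ksub P -> ksub P0 -> ksub Q -> ksub Q0 -> klin f ->
  (forall M, P0 M -> P M) -> (forall N, Q0 N -> Q N) -> (forall M, P M -> Q (f M)) ->
  (forall M, P M -> Q0 (f M) -> P0 M) -> (mdim P + mdim Q0 <= mdim Q + mdim P0)%N.
Proof.
move=> kP kP0 kQ kQ0 lf sP sQ fQ fi; rewrite -(mdim_rank kP kQ0 lf).
apply: leq_add; apply: mdimS => //.
- exact: ksub_img.
- move=> N [M [pM /sQ qM]]; rewrite -[N](subrK (f M)).
  have := kQ.2 1 _ _ qM (fQ _ pM); congr Q; congr (_ + _).
  by apply/matrixP=> i j; rewrite !mxE scale1r.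
- exact: ksub_preim.
by move=> M [pM qM]; apply: fi.
Qed.
End MatrixSpaces.

(** * Direct sums, thick subcategories and approximations *)

Section Sums.
Variables (A : nzRingType) (e1 e2 : A).
Hypothesis cpo : complete_prim_orth e1 e2.
Local Notation cpx := (cpx A).
Local Notation is_cpx := (is_cpx e1 e2).
Local Notation chain_map := (chain_map e1 e2).
Local Notation idm := (idm e1 e2).
Local Notation nohom := (nohom e1 e2).
Local Notation retract := (retract e1 e2).

Lemma chain_map_row C D Y (a : 'M_(_, csz C)) (b : 'M_(_, csz D)) :
  chain_map (dsum C D) Y (row_mx a b) <-> chain_map C Y a /\ chain_map D Y b.
Proof.
rewrite /Defs.chain_map /= mul_mx_row mul_row_block !mulmx0 addr0 add0r; split.
  by move=> [/(@homd_row _ _ _ C D) [ha hb] /eq_row_mx [ca cb]].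
by move=> [[ha ca] [hb cb]]; split; [apply/(@homd_row _ _ _ C D)|rewrite ca cb].
Qed.

Lemma chain_map_col C D X (a : 'M_(csz C, _)) (b : 'M_(csz D, _)) :
  chain_map X (dsum C D) (col_mx a b) <-> chain_map X C a /\ chain_map X D b.
Proof.
rewrite /Defs.chain_map /= mul_block_col mul_col_mx !mul0mx addr0 add0r; split.
  by move=> [/(@homd_col _ _ _ C D) [ha hb] /eq_col_mx [ca cb]].
by move=> [[ha ca] [hb cb]]; split; [apply/(@homd_col _ _ _ C D)|rewrite ca cb].
Qed.

Lemma nohom_dsum_r X C D : nohom X C -> nohom X D -> nohom X (dsum C D).
Proof.
move=> nC nD M; rewrite -[M]vsubmxK => /chain_map_col [/nC [h [hh]] eh /nD [g [hg eg]]].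
exists (col_mx h g); split; first exact/(@homd_col _ _ _ C D).
by rewrite !subr0 in eh eg *; rewrite /= mul_col_mx mul_block_col !mul0mx addr0 add0r add_col_mx eh eg.
Qed.

Lemma nohom_dsum_l X C D : nohom C X -> nohom D X -> nohom (dsum C D) X.
Proof.
move=> nC nD M; rewrite -[M]hsubmxK => /chain_map_row [/nC [h [hh]] eh /nD [g [hg eg]]].
exists (row_mx h g); split; first exact/(@homd_row _ _ _ C D).
by rewrite !subr0 in eh eg *; rewrite /= mul_mx_row mul_row_block !mulmx0 addr0 add0r add_row_mx eh eg.
Qed.

Lemma is_cpx_zero : is_cpx (zero_cpx (A := A)).
Proof. by split; [case|rewrite mulmx0]. Qed.

Lemma nohom_zero_r X : nohom X zero_cpx.
Proof. by move=> F _; exists 0; split; [apply: homd0|apply/matrixP; case]. Qed.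

Lemma idm_dsum C D : idm (dsum C D) = block_mx (idm C) 0 0 (idm D).
Proof.
rewrite -[LHS]submxK; congr block_mx; apply/matrixP=> i j; rewrite !mxE /= ?eq_lshift ?eq_rshift
  ?eq_lrshift ?eq_rlshift // /sumlab.
- by rewrite (unsplitK (inl i)).
- by rewrite (unsplitK (inr i)).
Qed.

Lemma retract_dsum_l C D : is_cpx C -> is_cpx D -> retract C (dsum C D).
Proof.
move=> cC cD; have i := chain_map_idm cpo cC; exists (col_mx (idm C) 0), (row_mx (idm C) 0).
split; first by apply/chain_map_col; split=> //; apply: chain_map0.
split; first by apply/chain_map_row; split=> //; apply: chain_map0.
by rewrite mul_row_col mul0mx addr0 idmK //; apply: homotopic_refl.
Qed.

Lemma retract_dsum_r C D : is_cpx C -> is_cpx D -> retract D (dsum C D).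
Proof.
move=> cC cD; have i := chain_map_idm cpo cD; exists (col_mx 0 (idm D)), (row_mx 0 (idm D)).
split; first by apply/chain_map_col; split=> //; apply: chain_map0.
split; first by apply/chain_map_row; split=> //; apply: chain_map0.
by rewrite mul_row_col mul0mx add0r idmK //; apply: homotopic_refl.
Qed.

Definition cpow (T : cpx) n := iter n (dsum T) zero_cpx.

Lemma is_cpx_cpow T n : is_cpx T -> is_cpx (cpow T n).
Proof. by move=> cT; elim: n => [|n IH]; [apply: is_cpx_zero|apply: is_cpx_dsum]. Qed.

Lemma nohom_cpow X T n : nohom X T -> nohom X (cpow T n).
Proof. by move=> h; elim: n => [|n IH]; [apply: nohom_zero_r|apply: nohom_dsum_r]. Qed.

Lemma nohom_shiftn_cpow X T m n : nohom X (shiftn m T) -> nohom X (shiftn m (cpow T n)).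
Proof. by move/(nohom_adjn _) => h; apply/nohom_adjn/nohom_cpow. Qed.

Lemma nohom_zero_l X : nohom zero_cpx X.
Proof. by move=> F _; exists 0; split; [apply: homd0|apply/matrixP=> ? []]. Qed.

Lemma nohom_cpow_l X T n : nohom T X -> nohom (cpow T n) X.
Proof. by move=> h; elim: n => [|n IH]; [apply: nohom_zero_l|apply: nohom_dsum_l]. Qed.
End Sums.

Section Thick.
Variables (K : fieldType) (A : falgType K) (e1 e2 : A).
Hypothesis cpo : complete_prim_orth e1 e2.
Local Notation cpx := (cpx A).
Local Notation homd := (homd e1 e2).
Local Notation is_cpx := (is_cpx e1 e2).
Local Notation chain_map := (chain_map e1 e2).
Local Notation idm := (idm e1 e2).
Local Notation nohom := (nohom e1 e2).
Local Notation retract := (retract e1 e2).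
Local Notation thick := (thick e1 e2).

Lemma homd_kscale X Y s k M : homd X Y s M -> homd X Y s (kscale k M).
Proof.
move=> h i j; have [a b] := h i j; rewrite !mxE; split.
  by rewrite -scalerAr -scalerAl -a.
by move=> n; apply: b => z; apply: n; rewrite z scaler0.
Qed.

Lemma chain_map_kscale X Y k M : chain_map X Y M -> chain_map X Y (kscale k M).
Proof. by move=> [h c]; split; [apply: homd_kscale|rewrite kscaleMr kscaleMl c]. Qed.

Lemma ksub_chain_map X Y : ksub (chain_map X Y).
Proof.
split; first exact: chain_map0.
by move=> k M N hM hN; apply: chain_mapD => //; apply: chain_map_kscale.
Qed.

(** Hom(T, Y) is finite dimensional, and a spanning list of it assembles into one map from a power
    of T. *)
Lemma approximation T Y : is_cpx T -> exists n F, chain_map (cpow T n) Y F /\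
  forall P, chain_map T Y P -> exists2 Q, chain_map T (cpow T n) Q & P = F *m Q.
Proof.
move=> cT; have [s [sP sspan]] := ksub_span (ksub_chain_map T Y).
suff [F [cF fac]] : exists F, chain_map (cpow T (size s)) Y F /\
    forall i, (i < size s)%N -> exists2 Q, chain_map T (cpow T (size s)) Q & s`_i = F *m Q.
  exists (size s), F; split=> // P /sspan [c ->].
  have /choice [Q hQ] : forall i : 'I_(size s), exists Q : 'M_(csz (cpow T (size s)), csz T),
      chain_map T (cpow T (size s)) Q /\ s`_i = F *m Q.
    by move=> i; have [Q ? ?] := fac i (ltn_ord i); exists Q.
  exists (\sum_(i < size s) kscale (c i) (Q i)).
    apply: (big_ind (chain_map T (cpow T (size s)))).
    - exact: chain_map0.
    - exact: chain_mapD.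
    by move=> i _; apply: chain_map_kscale; have [] := hQ i.
  by rewrite mulmx_sumr; apply: eq_bigr => i _; rewrite kscaleMr; have [_ ->] := hQ i.
elim: s sP {sspan} => [|f s IH] sP; first by exists 0; split=> //; apply: chain_map0.
have [|F [cF fac]] := IH; first by move=> M Ms; apply: sP; rewrite inE Ms orbT.
have cf : chain_map T Y f by apply: sP; rewrite inE eqxx.
exists (row_mx f F); split; first exact/chain_map_row.
case=> [_|i /fac [Q cQ eQ]] /=.
  exists (col_mx (idm T) 0); first by apply/chain_map_col; split; [apply: chain_map_idm|apply: chain_map0].
  by rewrite mul_row_col mulmx0 addr0 (idmMr cpo cf.1).
exists (col_mx 0 Q); first by apply/chain_map_col; split=> //; apply: chain_map0.
by rewrite mul_row_col mulmx0 add0r.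
Qed.

(** Each generation step raises the bound by at most one. The bound is uniform in [Y], so it
    survives the replacement of [Y] by cocones in the induction that uses it. *)
Lemma thick_bound T Z : thick (fun Y => Y = T) Z -> exists N, forall Y,
  (forall n, (0 < n)%N -> nohom T (shiftn n Y)) -> forall n, (N <= n)%N -> nohom Z (shiftn n Y).
Proof.
elim=> {Z}.
- by move=> X _ ->; exists 1 => Y h n /h.
- move=> X Y _ [N IH] _ /isoK_sym/isoK_retract r; exists N => Z h n le.
  by apply: nohom_retract_l (IH Z h n le).
- move=> X _ [N IH]; exists N.+1 => Y h [//|n] le.
  by apply/nohom_shift2; apply: IH.
- move=> X _ [N IH]; exists N => Y h n le.
  by apply/nohom_adj; apply: (IH _ h n.+1); apply: leqW.
- move=> X Y F _ [N IH] _ [N' IH'] cF; exists (maxn N.+1 N') => Z h n.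
  rewrite geq_max => /andP [le le']; apply: nohom_cone_l => //.
  - by case: n le {le'} => // n le; apply/nohom_shift2; apply: IH.
  - exact: IH'.
move=> X Y tY [N IH] cX [Z [cZ iso]]; exists N => W h n le.
apply: nohom_retract_l (IH W h n le) => //; apply: retract_trans (isoK_retract iso) => //.
exact: retract_dsum_l.
Qed.

Section Add.
Variables (T X : cpx).
Hypotheses (cT : is_cpx T) (cX : is_cpx X) (gen : thick (fun Y => Y = T) X)
  (TT : forall n, (0 < n)%N -> nohom T (shiftn n T))
  (XT : forall n, (0 < n)%N -> nohom X (shiftn n T)).

(** For the first shift, every map T -> Y factors through the approximation and T^n has no
    self-extension with T; higher shifts follow from the long exact sequence. *)
Lemma cocone_ext Y n F : chain_map (cpow T n) Y F ->
  (forall P, chain_map T Y P -> exists2 Q, chain_map T (cpow T n) Q & P = F *m Q) ->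
  (forall n, (0 < n)%N -> nohom T (shiftn n Y)) ->
  forall m, (0 < m)%N -> nohom T (shiftn m (unshift (cone (cpow T n) Y F))).
Proof.
move=> cF fac TY [//|m] _; apply/nohom_shiftn_unshift => //.
case: m => [|m] /=.
  apply: nohom_cone_approx fac _ => //.
  exact: (@nohom_shiftn_cpow _ _ _ T T 1 n (TT _)).
apply/(@nohom_adjn _ _ _ m.+1); apply: nohom_cone_r => //; last exact/nohom_adjn/TY.
by apply/nohom_adjn; rewrite -shiftnSr; apply: nohom_shiftn_cpow; apply: TT.
Qed.

(** Dimension shifting: if Z is the cocone of an approximation T^m -> Y, then Hom(X, T^m[n]) = 0
    embeds Hom(X, Y[n]) into Hom(X, Z[n+1]). The induction descends from the degree supplied by
    [thick_bound]; [j] is the distance to it. *)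
Lemma nohom_ext_between Y n : is_cpx Y -> (forall n, (0 < n)%N -> nohom T (shiftn n Y)) ->
  (0 < n)%N -> nohom X (shiftn n Y).
Proof.
have [N bN] := thick_bound gen.
suff H : forall j Y, is_cpx Y -> (forall n, (0 < n)%N -> nohom T (shiftn n Y)) ->
    forall n, (0 < n)%N -> (N <= n + j)%N -> nohom X (shiftn n Y).
  by move=> cY h n0; apply: (H N) => //; apply: leq_addl.
elim=> [|j IH] {}Y cY h {}n n0 le; first by apply: bN => //; rewrite addn0 in le.
have [m [F [cF fac]]] := approximation Y cT.
have h' := cocone_ext cF fac h.
have /(nohom_shiftn_unshift _) : nohom X (shiftn n.+1 (unshift (cone (cpow T m) Y F))).
  apply: IH => //; last by rewrite addSnnS.
  by apply: is_cpx_unshift; apply: is_cpx_cone => //; apply: is_cpx_cpow.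
move/(nohom_adjn _) => h2; apply/nohom_adjn; apply: nohom_cone_target cF h2 _ => //.
by apply: nohom_cpow; apply/nohom_adjn; apply: XT.
Qed.

(** The connecting map from X to the shifted cocone of its approximation vanishes, so the
    approximation T^m -> X is a split epimorphism up to homotopy. *)
Lemma retract_cpow : (forall n, (0 < n)%N -> nohom T (shiftn n X)) ->
  exists n, retract X (cpow T n).
Proof.
move=> TX; have [m [F [cF fac]]] := approximation X cT; exists m.
have h := cocone_ext cF fac TX.
have /(@nohom_ext_between _ 1)/(_ h)/(_ isT)/(@nohom_shiftn_unshift _ _ _ 0) nX :
    is_cpx (unshift (cone (cpow T m) X F)).
  by apply: is_cpx_unshift; apply: is_cpx_cone => //; apply: is_cpx_cpow.
have iX := chain_map_idm cpo cX.
(* The inclusion of X in the cone. The two blocks of its null-homotopy are a section [g] of [F] and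
   the homotopy [p] witnessing it. *)
have [|M [hM]] := nX (col_mx 0 (idm X)).
  apply/cone_col_chain; split; first exact: chain_map0.
  by rewrite mulmx0 add0r; case: iX => h1 h2; split.
rewrite subr0 -[M]vsubmxK; set g := usubmx M; set p := dsubmx M.
have [/homd_shift_r hg hp] : homd X (shift (cpow T m)) (-1) g /\ homd X X (-1) p.
  by apply/(@homd_col _ _ _ (shift (cpow T m)) X (cd (cone (cpow T m) X F))); rewrite vsubmxK.
rewrite /= mul_col_mx mul_block_col mul0mx addr0 add_col_mx => /eq_col_mx [e0 eP].
exists g, F; split; first split.
- by move: hg; rewrite addNr.
- by move/eqP: e0; rewrite mulNmx eq_sym subr_eq0 => /eqP.
split=> //; apply: homotopic_sym; exists p; split=> //.
by rewrite eP addrCA addrAC subrr add0r.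
Qed.
End Add.
End Thick.

Lemma nat_seq_min (f : nat -> nat) : exists n, forall m, (f n <= f m)%N.
Proof.
have : exists k, `[<exists n, f n = k>] by exists (f 0%N); apply/asboolP; exists 0%N.
move=> h; case: (ex_minnP h) => k /asboolP [n en] mn.
by exists n => m; rewrite en; apply: mn; apply/asboolP; exists m.
Qed.

(** * Fitting idempotents and local corners *)

Section Fitting.
Variables (K : fieldType) (A : falgType K) (n : nat).
Local Notation M := 'M[A]_n.
Variable C : M -> Prop.
Hypotheses (kC : ksub C) (mC : forall x y, C x -> C y -> C (x * y)).

Lemma closed_exp x k : C x -> C (x ^+ k.+1).
Proof. by move=> cx; elim: k => // k IH; rewrite exprS; apply: mC. Qed.

Lemma ksub_mull x : ksub (fun y : M => exists2 z, C z & y = x * z).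
Proof.
split; first by exists 0; [case: kC|rewrite mulr0].
move=> k y y' [z cz ->] [z' cz' ->]; exists (kscale k z + z'); first by case: kC => _; apply.
by rewrite mulrDr; congr (_ + _); rewrite -!mulmxE kscaleMr.
Qed.

Lemma ksub_mulr x : ksub (fun y : M => exists2 z, C z & y = z * x).
Proof.
split; first by exists 0; [case: kC|rewrite mul0r].
move=> k y y' [z cz ->] [z' cz' ->]; exists (kscale k z + z'); first by case: kC => _; apply.
by rewrite mulrDl; congr (_ + _); rewrite -!mulmxE kscaleMl.
Qed.

(** The chains x^k C and C x^k are constant once their dimension is minimal. The exponent is kept
    positive because C need not contain the identity matrix: in the applications its unit is an
    idempotent such as [idm X]. *)
Lemma fitting x : C x -> exists N b b', [/\ C b, C b',
  x ^+ N.+1 = x ^+ N.+1 * x ^+ N.+1 * b & x ^+ N.+1 = b' * x ^+ N.+1 * x ^+ N.+1].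
Proof.
move=> cx.
have [p pm] := nat_seq_min (fun k => mdim (fun y : M => exists2 z, C z & y = x ^+ k * z)).
have [q qm] := nat_seq_min (fun k => mdim (fun y : M => exists2 z, C z & y = z * x ^+ k)).
pose N := (p + q)%N.
have [b cb eb] : exists2 b, C b & x ^+ N.+1 = x ^+ (N.+1 + N.+1) * b.
  have s : forall y : M, (exists2 z, C z & y = x ^+ (N.+1 + N.+1) * z) ->
      exists2 z, C z & y = x ^+ p * z.
    move=> y [z cz ->]; exists (x ^+ ((q + N.+1).+1) * z); first by apply: mC => //; apply: closed_exp.
    by rewrite mulrA -exprD; congr (_ ^+ _ * _); rewrite /N; lia.
  apply: (mdim_eq (ksub_mull _) (ksub_mull _) s).
    apply/eqP; rewrite eqn_leq pm andbT; apply: mdimS s; exact: ksub_mull.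
  exists (x ^+ q.+1); first exact: closed_exp.
  by rewrite -exprD; congr (_ ^+ _); rewrite /N; lia.
have [b' cb' eb'] : exists2 b, C b & x ^+ N.+1 = b * x ^+ (N.+1 + N.+1).
  have s : forall y : M, (exists2 z, C z & y = z * x ^+ (N.+1 + N.+1)) ->
      exists2 z, C z & y = z * x ^+ q.
    move=> y [z cz ->]; exists (z * x ^+ ((p + N.+1).+1)); first by apply: mC => //; apply: closed_exp.
    by rewrite -mulrA -exprD; congr (_ * _ ^+ _); rewrite /N; lia.
  apply: (mdim_eq (ksub_mulr _) (ksub_mulr _) s).
    apply/eqP; rewrite eqn_leq qm andbT; apply: mdimS s; exact: ksub_mulr.
  exists (x ^+ p.+1); first exact: closed_exp.
  by rewrite -exprD; congr (_ ^+ _); rewrite /N; lia.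
by exists N, b, b'; split=> //; [rewrite {1}eb exprD|rewrite {1}eb' exprD mulrA].
Qed.

(** The idempotent x^(N+1) b = b' x^(N+1) projects onto the stable image of x, on which x is
    invertible; [y] and [z] are the inverses of x relative to it. *)
Lemma fitting_idem x : C x -> exists N eps b y z,
  [/\ C eps /\ C b /\ C y /\ C z, eps * eps = eps, eps = y * x, eps = x * z &
      eps = x ^+ N.+1 * b /\ x ^+ N.+1 * eps = x ^+ N.+1].
Proof.
move=> cx; have [N [b [b' [cb cb' eb eb']]]] := fitting cx.
have e : x ^+ N.+1 * b = b' * x ^+ N.+1 by rewrite {1}eb' -!mulrA [x ^+ _ * (_ * _)]mulrA -eb.
have cX k y : C y -> C (x ^+ k * y).
  by case: k => [|k] cy; [rewrite expr0 mul1r|apply: mC => //; apply: closed_exp].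
have cX' k y : C y -> C (y * x ^+ k).
  by case: k => [|k] cy; [rewrite expr0 mulr1|apply: mC => //; apply: closed_exp].
exists N, (x ^+ N.+1 * b), b, (b' * x ^+ N), (x ^+ N * b); split=> //.
- by do !split=> //; [apply: (cX N.+1)|apply: cX'|apply: cX].
- by rewrite {1}e -mulrA [x ^+ _ * (_ * _)]mulrA -eb -e.
- by rewrite e exprSr mulrA.
- by rewrite exprS mulrA.
by rewrite mulrA -eb.
Qed.
End Fitting.

Section Local.
Variables (K : fieldType) (A : falgType K) (e1 e2 : A).
Hypothesis cpo : complete_prim_orth e1 e2.
Local Notation eid := (eid e1 e2).

Lemma corner_idem l a : a = eid l * a * eid l -> a * a = a -> a = 0 \/ a = eid l.
Proof.
move=> ea aa; have [idl [_ prim]] : primitive (eid l) by case: l {ea}; case: cpo => ? [].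
have la : eid l * a = a by rewrite ea !mulrA idl.
have ra : a * eid l = a by rewrite ea -!mulrA idl.
have [||||| -> |/eqP] := prim a (eid l - a) => //; rewrite /idem ?mulrBl ?mulrBr ?la ?ra ?aa ?idl
  ?subrr ?subr0 ?addrNK //; first by rewrite addrC subrK.
- by left.
by rewrite subr_eq0 => /eqP ->; right.
Qed.

Lemma geometric_inverse (B : pzRingType) (E x : B) N : E * E = E -> x = E * x * E ->
  (E * (\sum_(i < N) x ^+ i) * E) * (E - x) = E - E * x ^+ N * E /\
  (E - x) * (E * (\sum_(i < N) x ^+ i) * E) = E - E * x ^+ N * E.
Proof.
move=> EE ex; set S := \sum_(i < N) _.
have lx : E * x = x by rewrite ex !mulrA EE.
have rx : x * E = x by rewrite ex -!mulrA EE.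
have c : S * x = x * S.
  by rewrite mulr_sumr mulr_suml; apply: eq_bigr => i _; rewrite -exprSr exprS.
have h : (1 - x) * S = 1 - x ^+ N.
  by have := subrX1 x N => /(congr1 -%R); rewrite -mulNr !opprB => ->.
have h' : S * (1 - x) = 1 - x ^+ N by rewrite -h mulrBl mulrBr mul1r mulr1 c.
have t : E - E * x ^+ N * E = E * (1 - x ^+ N) * E by rewrite mulrBr mulrBl mulr1 EE.
have q : E - x = (1 - x) * E by rewrite mulrBl mul1r rx.
have q' : E - x = E * (1 - x) by rewrite mulrBr mulr1 lx.
split; first by rewrite -[_ * E * _]mulrA mulrBr EE lx q mulrA -[E * S * _]mulrA h' t.
by rewrite !mulrA mulrBl EE rx q' -[E * _ * S]mulrA h t.
Qed.

(** Fitting's lemma in e_l A e_l, seen as 1 x 1 matrices. By primitivity the idempotent attached to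
    [a] is 0 or e_l: in the latter case [a] is a unit, in the former it is nilpotent and the
    geometric series inverts e_l - a. *)
Lemma corner_local l a : a = eid l * a * eid l ->
  (exists2 b, b = eid l * b * eid l & a * b = eid l /\ b * a = eid l) \/
  (exists2 b, b = eid l * b * eid l & (eid l - a) * b = eid l /\ b * (eid l - a) = eid l).
Proof.
move=> ea; have ee := eidK cpo l.
pose C (M : 'M[A]_1) := M 0 0 = eid l * M 0 0 * eid l.
have kC : ksub C.
  split=> [|k M N]; rewrite /C !mxE ?mulr0 ?mul0r // => eM eN.
  by rewrite mulrDr mulrDl -scalerAr -scalerAl -eM -eN.
have m1 (x y : 'M[A]_1) : (x * y) 0 0 = x 0 0 * y 0 0 by rewrite -mulmxE mxE big_ord1.
have mC : forall x y, C x -> C y -> C (x * y).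
  by move=> x y; rewrite /C m1 => -> ->; rewrite !mulrA ee -!mulrA ee.
have [|N [eps [b [y [z [[ceps [cb [cy cz]]] ii ey ez [eb eN]]]]]]] := fitting_idem kC mC (x := a%:M).
  by rewrite /C mxE.
have aM : (a%:M : 'M[A]_1) 0 0 = a by rewrite mxE.
have [h0|h1] := corner_idem ceps (etrans (esym (m1 _ _)) (congr1 (fun M : 'M_1 => M 0 0) ii)).
  right; exists (eid l * (\sum_(i < N.+1) a ^+ i) * eid l).
    by rewrite !mulrA ee -!mulrA ee.
  have aN : a ^+ N.+1 = 0.
    have : (a%:M : 'M[A]_1) ^+ N.+1 = (a ^+ N.+1)%:M.
      elim: N.+1 => [|k IH]; first by rewrite !expr0.
      by rewrite exprS IH exprS -mulmxE -scalar_mxM.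
    move=> h; move: eN; rewrite h => /(congr1 (fun M : 'M_1 => M 0 0)).
    by rewrite m1 h0 mulr0 mxE.
  have [h h'] := geometric_inverse N.+1 ee ea.
  by rewrite h h' aN mulr0 mul0r subr0.
left; have e1' : y 0 0 * a = eid l by rewrite -h1 ey m1 aM.
have e2' : a * z 0 0 = eid l by rewrite -h1 ez m1 aM.
exists (y 0 0) => //; split=> //; suff -> : y 0 0 = z 0 0 by [].
have ye : y 0 0 * eid l = y 0 0 by rewrite [in LHS]cy -!mulrA ee !mulrA -cy.
have ze : eid l * z 0 0 = z 0 0 by rewrite [in LHS]cz !mulrA ee -cz.
by rewrite -ye -e2' mulrA e1' ze.
Qed.
End Local.

(** * Splitting of idempotents *)

(** An arbitrary additive weight on the indecomposable summands. Quantifying over [w] records that a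
    splitting distributes these summands, so that sizes, label counts, degree bounds and g-vectors
    are additive at one stroke. *)
Definition wt (A : nzRingType) (V : nmodType) (w : bool -> int -> V) (X : cpx A) : V :=
  \sum_(i < csz X) w (clab X i) (cdeg X i).

Lemma wt_gsum (A : nzRingType) (V : nmodType) (w : bool -> int -> V) (C D : cpx A) d :
  wt w (gsum C D d) = wt w C + wt w D.
Proof.
rewrite /wt big_split_ord /=; congr (_ + _); apply: eq_bigr => i _; rewrite /sumlab /sumdeg.
  by rewrite (unsplitK (inl i)).
by rewrite (unsplitK (inr i)).
Qed.

Section Split.
Variables (K : fieldType) (A : falgType K) (e1 e2 : A).
Hypothesis cpo : complete_prim_orth e1 e2.
Local Notation cpx := (cpx A).
Local Notation eid := (eid e1 e2).
Local Notation homd := (homd e1 e2).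
Local Notation is_cpx := (is_cpx e1 e2).
Local Notation chain_map := (chain_map e1 e2).
Local Notation homotopic := (homotopic e1 e2).
Local Notation idm := (idm e1 e2).
Local Notation isoK := (isoK e1 e2).
Local Notation retract := (retract e1 e2).
Local Notation indecomposable := (indecomposable e1 e2).

Definition gsplits (X : cpx) (eps : 'M[A]_(csz X)) : Prop :=
  exists (D1 D2 : cpx) (F1 : 'M_(csz D1, csz X)) (G1 : 'M_(csz X, csz D1))
    (F2 : 'M_(csz D2, csz X)) (G2 : 'M_(csz X, csz D2)),
  [/\ homd X D1 0 F1, homd D1 X 0 G1, homd X D2 0 F2 & homd D2 X 0 G2] /\
  [/\ G1 *m F1 = eps, F1 *m G1 = idm D1, G2 *m F2 = idm X - eps & F2 *m G2 = idm D2] /\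
  forall (V : nmodType) (w : bool -> int -> V), wt w X = wt w D1 + wt w D2.

Lemma gsplits_compl X eps : gsplits (X := X) eps -> gsplits (idm X - eps).
Proof.
move=> [D1 [D2 [F1 [G1 [F2 [G2 [[? ? ? ?] [[e1' ? e2' ?] h]]]]]]]].
exists D2, D1, F2, G2, F1, G1; split=> //; split.
  by split=> //; rewrite subKr.
by move=> V w; rewrite addrC.
Qed.

Lemma homdM0 C D E (M : 'M_(csz E, csz D)) (M' : 'M_(csz D, csz C)) :
  homd D E 0 M -> homd C D 0 M' -> homd C E 0 (M *m M').
Proof. by move=> h h'; have := homdM cpo h h'; rewrite addr0. Qed.

(** Peels off a summand P on which [eps] acts as the identity; what is left of [eps] is the
    idempotent [d *m eps *m c] of the complement Y. *)
Lemma gsplits_step X P Y (a : 'M_(csz X, csz P)) (b : 'M_(csz P, csz X))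
    (c : 'M_(csz X, csz Y)) (d : 'M_(csz Y, csz X)) eps :
  homd P X 0 a -> homd X P 0 b -> homd Y X 0 c -> homd X Y 0 d -> homd X X 0 eps ->
  b *m a = idm P -> d *m c = idm Y -> b *m c = 0 -> d *m a = 0 ->
  a *m b + c *m d = idm X -> eps *m eps = eps -> eps *m a = a -> b *m eps = b ->
  (forall (V : nmodType) (w : bool -> int -> V), wt w X = wt w P + wt w Y) ->
  (forall t, homd Y Y 0 t -> t *m t = t -> gsplits (X := Y) t) -> gsplits eps.
Proof.
move=> ha hb hc hd he ba dc bc da sum ee ea be hw IH.
have cd' : c *m d = idm X - a *m b by rewrite -sum addrC addKr.
have [||D1 [D2 [F1 [G1 [F2 [G2 [[h1 h2 h3 h4] [[k1 k2 k3 k4] hV]]]]]]]] := IH (d *m eps *m c).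
- by apply: homdM0 => //; apply: homdM0.
- have -> : d *m eps *m c *m (d *m eps *m c) = d *m (eps *m (c *m d) *m eps) *m c.
    by rewrite !mulmxA.
  rewrite cd' mulmxBr (idmMr cpo he) [eps *m (a *m b)]mulmxA ea mulmxBl ee -[a *m b *m eps]mulmxA be mulmxBr.
  by rewrite [d *m (a *m b)]mulmxA da mul0mx subr0.
have ct : c *m (d *m eps *m c) *m d = eps - a *m b.
  have -> : c *m (d *m eps *m c) *m d = (c *m d) *m eps *m (c *m d) by rewrite !mulmxA.
  rewrite cd' [(idm X - _) *m eps]mulmxBl (idmMl cpo he) -[a *m b *m eps]mulmxA be mulmxBl !mulmxBr.
  rewrite (idmMr cpo he).
  rewrite (idmMr cpo (homdM0 ha hb)) !mulmxA ea -[a *m b *m a]mulmxA ba (idmMr cpo ha) subrr.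
  by rewrite subr0.
exists (gsum P D1 0), D2, (col_mx b (F1 *m d)), (row_mx a (c *m G1)), (F2 *m d), (c *m G2).
split; first split.
- by apply/(@homd_col _ _ _ P D1); split=> //; apply: homdM0.
- by apply/(@homd_row _ _ _ P D1); split=> //; apply: homdM0.
- exact: homdM0.
- exact: homdM0.
split; first split.
- rewrite mul_row_col; have -> : c *m G1 *m (F1 *m d) = c *m (G1 *m F1) *m d by rewrite !mulmxA.
  by rewrite k1 ct addrC subrK.
- rewrite mul_col_row ba mulmxA bc mul0mx -mulmxA da mulmx0.
  have -> : F1 *m d *m (c *m G1) = F1 *m (d *m c) *m G1 by rewrite !mulmxA.
  rewrite dc (idmMr cpo h1) k2; exact: esym (idm_dsum _ _ P D1).
- have -> : c *m G2 *m (F2 *m d) = c *m (G2 *m F2) *m d by rewrite !mulmxA.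
  rewrite k3 mulmxBr mulmxBl ct (idmMr cpo hc) cd'.
  by rewrite opprB addrA subrK.
- have -> : F2 *m d *m (c *m G2) = F2 *m (d *m c) *m G2 by rewrite !mulmxA.
  by rewrite dc (idmMr cpo h3) k4.
by move=> V w; rewrite wt_gsum hw hV addrA.
Qed.

(** Gaussian elimination at an invertible corner [a] with inverse [c]. Idempotency gives r s = a -
    a^2, whence the column (id, s c) followed by the row (a, r) is the identity of P; the complement
    is embedded by (- c r, id). *)
Lemma gsplits_corner P Y d (a c : 'M_(csz P)) (r : 'M_(csz P, csz Y)) (s : 'M_(csz Y, csz P)) t :
  homd P P 0 a -> homd Y P 0 r -> homd P Y 0 s -> homd Y Y 0 t ->
  homd P P 0 c -> a *m c = idm P -> c *m a = idm P ->
  let eps := block_mx a r s t in eps *m eps = eps ->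
  (forall t, homd Y Y 0 t -> t *m t = t -> gsplits (X := Y) t) ->
  gsplits (X := gsum P Y d) eps.
Proof.
move=> ha hr hs ht hc ac ca eps; rewrite mulmx_block => /eq_block_mx [e1' e2' e3' e4'] IH.
have rs : r *m s = a - a *m a by rewrite -[X in X - _]e1' addrC addKr.
have ts : t *m s = s - s *m a by rewrite -[X in X - _]e3' addrC addKr.
have hscr : homd Y Y 0 (s *m c *m r) by apply: homdM0 => //; apply: homdM0.
have hsc : homd P Y 0 (s *m c) by apply: homdM0.
have cac : c *m (a - a *m a) *m c = c - idm P.
  by rewrite mulmxBr mulmxBl ca (idmMl cpo hc) mulmxA ca (idmMl cpo ha) ac.
have iP := @homd_idm _ _ _ cpo P; have iY := @homd_idm _ _ _ cpo Y.
apply: (@gsplits_step (gsum P Y d) P Y (col_mx (idm P) (s *m c)) (row_mx a r)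
  (col_mx (- (c *m r)) (idm Y)) (row_mx (- s) (idm Y - s *m c *m r))) => //.
- exact/(@homd_col _ _ _ P Y).
- exact/(@homd_row _ _ _ P Y).
- by apply/(@homd_col _ _ _ P Y); split=> //; apply: homdN; apply: homdM0.
- by apply/(@homd_row _ _ _ P Y); split; [apply: homdN|apply: homdB].
- exact: homd_block.
- rewrite mul_row_col (idmMr cpo ha) mulmxA rs mulmxBl ac -mulmxA ac (idmMr cpo ha).
  by rewrite addrC subrK.
- by rewrite mul_row_col mulNmx mulmxN opprK (idmMr cpo (homdB iY hscr)) mulmxA addrC subrK.
- by rewrite mul_row_col mulmxN mulmxA ac (idmMl cpo hr) (idmMr cpo hr) addNr.
- rewrite mul_row_col mulNmx (idmMr cpo hs) mulmxBl (idmMl cpo hsc).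
  have -> : s *m c *m r *m (s *m c) = s *m (c *m (r *m s) *m c) by rewrite !mulmxA.
  by rewrite rs cac mulmxBr (idmMr cpo hs) opprB [s *m c + _]addrC subrK addNr.
- rewrite !mul_col_row add_block_mx (idmMl cpo ha) (idmMl cpo hr).
  rewrite mulNmx mulmxN opprK -[c *m r *m s]mulmxA rs mulmxBr ca mulmxA ca (idmMl cpo ha).
  rewrite [a + _]addrC subrK.
  rewrite -[s *m c *m a]mulmxA ca (idmMr cpo hs) mulmxN (idmMl cpo hs) subrr.
  rewrite [s *m c *m r + _]addrC (idmMl cpo (homdB iY hscr)) subrK.
  suff -> : r + - (c *m r) *m (idm Y - s *m c *m r) = 0 by exact: esym (idm_dsum _ _ P Y).
  rewrite mulNmx mulmxBr (idmMr cpo (homdM0 hc hr)).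
  have -> : c *m r *m (s *m c *m r) = (c *m (r *m s) *m c) *m r by rewrite !mulmxA.
  by rewrite rs cac mulmxBl (idmMl cpo hr) subKr subrr.
- by rewrite mulmx_block e1' e2' e3' e4'.
- rewrite mul_block_col (idmMr cpo ha) (idmMr cpo hs) !mulmxA rs ts !mulmxBl ac.
  rewrite -[a *m a *m c]mulmxA ac (idmMr cpo ha) -[s *m a *m c]mulmxA ac (idmMr cpo hs).
  by rewrite [a + _]addrC subrK [s + _]addrC subrK.
- by rewrite mul_row_block e1' e2'.
by move=> V w; rewrite wt_gsum.
Qed.

(** Induction on the number of summands. The first diagonal entry lies in a local ring, so it is
    invertible either in [eps] or in its complement, and [gsplits] is symmetric in the two. *)
Lemma idempotents_split X eps : homd X X 0 eps -> eps *m eps = eps -> gsplits (X := X) eps.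
Proof.
case: X eps => n lab deg d; elim: n lab deg d => [|n IH] lab deg d eps he ee.
  exists zero_cpx, zero_cpx, 0, 0, 0, 0; split; first by split; apply: homd0.
  by split; [split; apply/matrixP=> -[] //|move=> V w; rewrite /wt !big_ord0 addr0].
pose P := Cpx 1 (fun _ => lab 0) (fun _ => deg 0) (0 : 'M[A]_1).
pose Y := Cpx n (lab \o @rshift 1 n) (deg \o @rshift 1 n) (0 : 'M[A]_n).
have eX : Cpx n.+1 lab deg d = gsum P Y d.
  rewrite /gsum.
  have <- : lab = sumlab (clab P) (clab Y).
    apply/funext => i; rewrite /sumlab; case: split_ordP => j -> /=; last by [].
    by rewrite ord1; congr lab; apply/val_inj.
  have <- // : deg = sumdeg (cdeg P) (cdeg Y).
  apply/funext => i; rewrite /sumdeg; case: split_ordP => j -> /=; last by [].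
  by rewrite ord1; congr deg; apply/val_inj.
have IHY t : homd Y Y 0 t -> t *m t = t -> gsplits (X := Y) t by apply: IH.
move: eps he ee; rewrite eX => eps he ee.
have main eta : homd (gsum P Y d) (gsum P Y d) 0 eta -> eta *m eta = eta ->
    (exists2 b, b = eid (lab 0) * b * eid (lab 0) & (eta (lshift _ 0) (lshift _ 0)) * b = eid (lab 0) /\
       b * (eta (lshift _ 0) (lshift _ 0)) = eid (lab 0)) -> gsplits (X := gsum P Y d) eta.
  move=> heta eeta [b eb [ab ba]].
  have bl : eta = block_mx (ulsubmx eta) (ursubmx eta) (dlsubmx eta) (drsubmx eta).
    by rewrite submxK.
  move: heta; rewrite bl => /(@homd_col _ _ _ P Y) [].
  move=> /(@homd_row _ _ _ P Y) [h1 h2] /(@homd_row _ _ _ P Y) [h3 h4].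
  apply: (@gsplits_corner P Y d _ (b%:M : 'M_1)) => //; last by rewrite -bl.
  - by move=> i j; rewrite !ord1 mxE addr0 eqxx mulr1n; split.
  - by apply/matrixP=> i j; rewrite !ord1 !mxE big_ord1 !mxE !eqxx mulr1n -ab.
  - by apply/matrixP=> i j; rewrite !ord1 !mxE big_ord1 !mxE !eqxx mulr1n -ba.
pose p : 'I_(1 + n) := lshift _ 0.
have lp : sumlab (clab P) (clab Y) p = lab 0 by rewrite /sumlab (unsplitK (inl 0)).
have ep : eps p p = eid (lab 0) * eps p p * eid (lab 0).
  by have [h _] := he p p; rewrite /= lp in h.
have hi := @homd_idm _ _ _ cpo (gsum P Y d).
have [h|h] := corner_local cpo ep; first exact: main.
rewrite -[eps](subKr (idm (gsum P Y d))); apply: gsplits_compl; apply: main.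
- exact: homdB.
- rewrite mulmxBr mulmxBl (idmMr cpo hi) mulmxBl (idmMr cpo he) (idmMl cpo he) ee.
  by rewrite subrr subr0.
by move: h; rewrite !mxE eqxx /= lp.
Qed.

(** As [eps] commutes with the differential, F d G is a differential on each graded piece, and the
    isomorphism with the direct sum is strict. *)
Lemma chain_idempotents_split X eps : is_cpx X -> chain_map X X eps -> eps *m eps = eps ->
  exists (D1 D2 : cpx) (F1 : 'M_(csz D1, csz X)) (G1 : 'M_(csz X, csz D1))
    (F2 : 'M_(csz D2, csz X)) (G2 : 'M_(csz X, csz D2)),
  [/\ is_cpx D1, is_cpx D2 & isoK X (dsum D1 D2)] /\
  [/\ chain_map X D1 F1, chain_map D1 X G1, chain_map X D2 F2 & chain_map D2 X G2] /\
  [/\ G1 *m F1 = eps, F1 *m G1 = idm D1, G2 *m F2 = idm X - eps & F2 *m G2 = idm D2] /\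
  forall (V : nmodType) (w : bool -> int -> V), wt w X = wt w D1 + wt w D2.
Proof.
move=> cX ceps ee; have [heps deps] := ceps; have [hd dd] := cX.
have [D1 [D2 [F1 [G1 [F2 [G2 [[h1 h2 h3 h4] [[k1 k2 k3 k4] hw]]]]]]]] := idempotents_split heps ee.
have deta : cd X *m (idm X - eps) = (idm X - eps) *m cd X.
  by rewrite mulmxBr mulmxBl deps (idmMl cpo hd) (idmMr cpo hd).
have build (D : cpx) F G e : homd X D 0 F -> homd D X 0 G -> G *m F = e -> F *m G = idm D ->
    cd X *m e = e *m cd X ->
    let D' := Cpx (csz D) (clab D) (cdeg D) (F *m cd X *m G) in
    [/\ is_cpx D', chain_map X D' F & chain_map D' X G].
  move=> hF hG ge fg de D'.
  have Fe : F *m e = F by rewrite -ge mulmxA fg (idmMl cpo hF).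
  have eG : e *m G = G by rewrite -ge -mulmxA fg (idmMr cpo hG).
  split; split=> //=.
  - by have := homdM cpo (homdM cpo hF hd) hG; rewrite add0r addr0.
  - have -> : F *m cd X *m G *m (F *m cd X *m G) = F *m cd X *m (G *m F) *m cd X *m G by rewrite !mulmxA.
    by rewrite ge -[F *m _ *m e]mulmxA de mulmxA Fe -[F *m _ *m _]mulmxA dd mulmx0 mul0mx.
  - by rewrite -mulmxA ge -mulmxA de mulmxA Fe.
  - by rewrite !mulmxA ge -de -mulmxA eG.
have [cD1 cF1 cG1] := build _ _ _ _ h1 h2 k1 k2 deps.
have [cD2 cF2 cG2] := build _ _ _ _ h3 h4 k3 k4 deta.
exists (Cpx (csz D1) (clab D1) (cdeg D1) (F1 *m cd X *m G1)),
  (Cpx (csz D2) (clab D2) (cdeg D2) (F2 *m cd X *m G2)), F1, G1, F2, G2; split=> //; split=> //.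
exists (col_mx F1 F2), (row_mx G1 G2); split; first exact/chain_map_col.
split; first exact/chain_map_row; split.
  by rewrite mul_row_col k1 k3 addrC subrK; apply: homotopic_refl.
have o : eps *m (idm X - eps) = 0 by rewrite mulmxBr ee (idmMr cpo heps) subrr.
have o' : (idm X - eps) *m eps = 0 by rewrite mulmxBl ee (idmMl cpo heps) subrr.
have z1 : F1 *m G2 = 0.
  rewrite -(idmMl cpo h1) -k2 -(idmMr cpo h4) -k4.
  have -> : F1 *m G1 *m F1 *m (G2 *m (F2 *m G2)) = F1 *m ((G1 *m F1) *m (G2 *m F2)) *m G2 by rewrite !mulmxA.
  by rewrite k1 k3 o mulmx0 mul0mx.
have z2 : F2 *m G1 = 0.
  rewrite -(idmMl cpo h3) -k4 -(idmMr cpo h2) -k2.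
  have -> : F2 *m G2 *m F2 *m (G1 *m (F1 *m G1)) = F2 *m ((G2 *m F2) *m (G1 *m F1)) *m G1 by rewrite !mulmxA.
  by rewrite k1 k3 o' mulmx0 mul0mx.
rewrite mul_col_row k2 k4 z1 z2 idm_dsum; exact: homotopic_refl.
Qed.

Definition null (X : cpx) := homotopic X X (idm X) 0.

Lemma null_isoK X : is_cpx X -> null X <-> isoK X zero_cpx.
Proof.
move=> cX; split=> [n|[F [G [cF [cG [e _]]]]]].
  exists 0, 0; split; [exact: chain_map0|split; first exact: chain_map0].
  by split; [rewrite mul0mx; apply: homotopic_sym|exists 0; split; [apply: homd0|apply/matrixP=> -[]]].
apply: homotopic_sym; apply: homotopic_trans e; suff -> : G *m F = 0 by apply: homotopic_refl.
by apply/matrixP=> i j; rewrite !mxE big_ord0.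
Qed.

Lemma retract_null X Y : retract X Y -> null Y -> null X.
Proof.
move=> [F [G [cF [cG e]]]] nY; apply: homotopic_trans (homotopic_sym e) _.
have := homotopicMr cpo cF (homotopicMl cpo cG nY).
by rewrite (idmMr cpo cG.1) mulmx0 mul0mx.
Qed.

(** The working form of indecomposability. It concerns strict idempotents, which can be split;
    idempotents up to homotopy are reduced to them by [lift_idempotent]. *)
Definition trivial_idem (X : cpx) := forall eps, chain_map X X eps -> eps *m eps = eps ->
  homotopic X X eps 0 \/ homotopic X X eps (idm X).

Lemma indecomposable_trivial_idem X : indecomposable X -> trivial_idem X.
Proof.
move=> [cX [nX ind]] eps ceps ee.
have [D1 [D2 [F1 [G1 [F2 [G2 [[c1 c2 iso] [[f1 g1 f2 g2] [[k1 k2 k3 k4] _]]]]]]]]] :=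
  chain_idempotents_split cX ceps ee.
have aux D F G : chain_map X D F -> chain_map D X G -> is_cpx D -> isoK D zero_cpx ->
    homotopic X X (G *m F) 0.
  move=> cF cG cD /(null_isoK cD) n.
  have := homotopicMr cpo cF (homotopicMl cpo cG n).
  by rewrite (idmMr cpo cG.1) mulmx0 mul0mx.
have [z|z] := ind _ _ c1 c2 iso; [left|right].
  by rewrite -k1; apply: aux z.
have := aux _ _ _ f2 g2 c2 z; rewrite k3 => h.
have := homotopicD (homotopic_refl _ _ eps) h; rewrite addr0 addrC subrK.
exact: homotopic_sym.
Qed.

Lemma homotopic_exp X x k : is_cpx X -> chain_map X X x -> homotopic X X (x *m x) x ->
  homotopic X X (x ^+ k.+1) x.
Proof.
move=> cX cx h; elim: k => [|k IH]; first exact: homotopic_refl.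
by apply: homotopic_trans h; rewrite exprS -mulmxE; apply: homotopicMl.
Qed.

Lemma chain_map_closed X : (forall x y, chain_map X X x -> chain_map X X y -> chain_map X X (x * y)).
Proof. by move=> x y cx cy; rewrite -mulmxE; apply: chain_mapM. Qed.

(** Up to homotopy all positive powers of [x] are [x]. Since eps = x^(N+1) b, it is homotopic to x
    eps, then to x^(N+1) eps = x^(N+1), then to [x]. *)
Lemma lift_idempotent X x : is_cpx X -> chain_map X X x -> homotopic X X (x *m x) x ->
  exists eps, [/\ chain_map X X eps, eps *m eps = eps & homotopic X X eps x].
Proof.
move=> cX cx h.
have [N [eps [b [y [z [[ceps [cb _]] ii _ _ [eb eN]]]]]]] :=
  fitting_idem (ksub_chain_map e1 e2 X X) (@chain_map_closed X) cx.
exists eps; split=> //.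
have hN k := homotopic_exp k cX cx h.
apply: (@homotopic_trans _ _ _ _ _ _ (x *m eps)).
  apply: homotopic_sym; rewrite eb -mulmxE mulmxA.
  have := homotopicMr cpo cb (homotopic_trans (hN N.+1) (homotopic_sym (hN N))).
  by rewrite exprS -mulmxE.
apply: homotopic_trans (hN N); rewrite -eN -mulmxE.
by apply: homotopicMr => //; apply: homotopic_sym.
Qed.

(** The projection of the direct sum onto Y, carried to X, is idempotent up to homotopy. Its strict
    lift is homotopic to 0 or to the identity, which makes Y, respectively Z, null. *)
Lemma trivial_idem_indecomposable X : is_cpx X -> ~ null X -> trivial_idem X -> indecomposable X.
Proof.
move=> cX nX tX; split=> //; split; first by move/(null_isoK cX).
move=> Y Z cY cZ [F [G [cF [cG [e e']]]]].
have iY := chain_map_idm cpo cY; have iZ := chain_map_idm cpo cZ.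
pose p : 'M_(csz (dsum Y Z)) := block_mx (idm Y) 0 0 0.
have cp : chain_map (dsum Y Z) (dsum Y Z) p.
  by apply/chain_map_col; split; apply/chain_map_row; split=> //; apply: chain_map0.
have pp : p *m p = p by rewrite mulmx_block !mulmx0 !mul0mx !addr0 idmK.
have cx : chain_map X X (G *m p *m F) by do 2!apply: chain_mapM => //.
have xx : homotopic X X ((G *m p *m F) *m (G *m p *m F)) (G *m p *m F).
  have -> : G *m p *m F *m (G *m p *m F) = (G *m p) *m (F *m G) *m (p *m F) by rewrite !mulmxA.
  have -> : G *m p *m F = (G *m p) *m idm (dsum Y Z) *m (p *m F).
    by rewrite (idmMr cpo (chain_mapM cpo cG cp).1) mulmxA -[G *m p *m p]mulmxA pp.
  by apply: homotopicMr; [|apply: chain_mapM|apply: homotopicMl => //; apply: chain_mapM].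
have [eps [ceps ee heps]] := lift_idempotent cX cx xx.
have back q : homotopic X X (G *m p *m F) q -> homotopic (dsum Y Z) (dsum Y Z) p (F *m q *m G).
  move=> h; have := homotopicMr cpo cG (homotopicMl cpo cF h); apply: homotopic_trans.
  have -> : F *m (G *m p *m F) *m G = (F *m G) *m p *m (F *m G) by rewrite !mulmxA.
  have cFG := chain_mapM cpo cF cG.
  apply: homotopic_sym; apply: (@homotopic_trans _ _ _ _ _ _ ((F *m G) *m p)).
    have := homotopicMl cpo (chain_mapM cpo cFG cp) e'.
    by rewrite (idmMr cpo (chain_mapM cpo cFG cp).1).
  by have := homotopicMr cpo cp e'; rewrite (idmMl cpo cp.1).
have inY : chain_map Y (dsum Y Z) (col_mx (idm Y) 0).
  by apply/chain_map_col; split=> //; apply: chain_map0.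
have prY : chain_map (dsum Y Z) Y (row_mx (idm Y) 0).
  by apply/chain_map_row; split=> //; apply: chain_map0.
have inZ : chain_map Z (dsum Y Z) (col_mx 0 (idm Z)).
  by apply/chain_map_col; split=> //; apply: chain_map0.
have prZ : chain_map (dsum Y Z) Z (row_mx 0 (idm Z)).
  by apply/chain_map_row; split=> //; apply: chain_map0.
have [h|h] := tX _ ceps ee.
  left; apply/(null_isoK cY).
  have := back _ (homotopic_trans (homotopic_sym heps) h); rewrite mulmx0 mul0mx => h'.
  have := homotopicMr cpo inY (homotopicMl cpo prY h').
  by rewrite /p mul_row_block mul_row_col !(mulmx0, mul0mx, addr0) !idmK.
right; apply/(null_isoK cZ).
have := back _ (homotopic_trans (homotopic_sym heps) h); rewrite (idmMr cpo cF.1) => h'.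
have := homotopic_trans h' e' => h2.
have := homotopic_sym (homotopicMr cpo inZ (homotopicMl cpo prZ h2)).
by rewrite /p idm_dsum !mul_row_block !mul_row_col !(mulmx0, mul0mx, addr0, add0r) !idmK.
Qed.

(** The Fitting idempotent of [x] is homotopic to the identity or to 0. In the first case [x] has a
    left inverse; in the second a power of [x] is null and the geometric series inverts id - x,
    which is homotopic to [y]. *)
Lemma trivial_idem_local X x y : is_cpx X -> trivial_idem X -> chain_map X X x -> chain_map X X y ->
  homotopic X X (x + y) (idm X) ->
  (exists2 z, chain_map X X z & homotopic X X (z *m x) (idm X)) \/
  (exists2 z, chain_map X X z & homotopic X X (z *m y) (idm X)).
Proof.
move=> cX tX cx cy h; have iX := chain_map_idm cpo cX.
have [N [eps [b [z [w [[ceps [cb [cz _]]] ii ez _ [eb eN]]]]]]] :=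
  fitting_idem (ksub_chain_map e1 e2 X X) (@chain_map_closed X) cx.
have [h0|h1] := tX eps ceps ii; last first.
  by left; exists z => //; rewrite mulmxE -ez.
right; pose S : 'M_(csz X) := \sum_(i < N.+1) x ^+ i.
have xE : x = idm X * x * idm X by rewrite -!mulmxE (idmMl cpo cx.1) (idmMr cpo cx.1).
have [gi _] := geometric_inverse N.+1 (idmK cpo X) xE.
have cS : chain_map X X (idm X *m S *m idm X).
  rewrite mulmx_sumr mulmx_suml; apply: (big_ind (chain_map X X)) => [||i _].
  - exact: chain_map0.
  - exact: chain_mapD.
  case: (nat_of_ord i) => [|k]; first by rewrite expr0 mulmx1 idmK.
  have := closed_exp (@chain_map_closed X) k cx => ck.
  by rewrite (idmMl cpo ck.1) (idmMr cpo ck.1).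
exists (idm X *m S *m idm X) => //.
have cN := closed_exp (@chain_map_closed X) N cx.
apply: (@homotopic_trans _ _ _ _ _ _ ((idm X *m S *m idm X) *m (idm X - x))).
  apply: homotopicMl => //; have := homotopicB h (homotopic_refl _ _ x).
  by rewrite addrC addKr.
rewrite mulmxE gi -!mulmxE (idmMl cpo cN.1) (idmMr cpo cN.1).
have : homotopic X X (x ^+ N.+1) 0.
  by rewrite -eN -mulmxE -(mulmx0 _ (x ^+ N.+1)); apply: homotopicMl.
move/(homotopicB (homotopic_refl _ _ (idm X))); by rewrite subr0.
Qed.

(** The identity of X is homotopic to the sum of two endomorphisms, one factoring through C and one
    through D; by locality one of them has a left inverse. *)
Lemma retract_dsum_cases X C D : is_cpx X -> is_cpx C -> is_cpx D -> trivial_idem X ->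
  retract X (dsum C D) -> retract X C \/ retract X D.
Proof.
move=> cX cC cD tX [F [G [cF [cG e]]]].
move: cF cG e; rewrite -[F]vsubmxK -[G]hsubmxK mul_row_col => /chain_map_col [cF1 cF2].
move=> /chain_map_row [cG1 cG2] e.
have [[z cz hz]|[z cz hz]] := trivial_idem_local cX tX (chain_mapM cpo cG1 cF1) (chain_mapM cpo cG2 cF2) e.
  left; exists (usubmx F), (z *m lsubmx G); split=> //; split; first exact: chain_mapM.
  by rewrite -mulmxA.
right; exists (dsubmx F), (z *m rsubmx G); split=> //; split; first exact: chain_mapM.
by rewrite -mulmxA.
Qed.

(** F G and id - F G add up to the identity of Y. A left inverse of the first makes the retraction
    an isomorphism; a left inverse of the second makes [F] null, and X with it. *)
Lemma retract_isoK X Y : is_cpx X -> is_cpx Y -> trivial_idem Y -> ~ null X -> retract X Y -> isoK X Y.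
Proof.
move=> cX cY tY nX [F [G [cF [cG e]]]].
have iY := chain_map_idm cpo cY; have cFG := chain_mapM cpo cF cG.
have [|[z cz hz]|[z cz hz]] := trivial_idem_local cY tY cFG (chain_mapB iY cFG).
- by rewrite addrC subrK; apply: homotopic_refl.
- exists F, G; split=> //; split=> //; split=> //.
  apply: homotopic_trans (hz).
  apply: (@homotopic_trans _ _ _ _ _ _ ((z *m (F *m G)) *m (F *m G))).
    by have := homotopic_sym (homotopicMr cpo cFG hz); rewrite (idmMl cpo cFG.1).
  have -> : z *m (F *m G) *m (F *m G) = (z *m F) *m (G *m F) *m G by rewrite !mulmxA.
  have -> : z *m (F *m G) = (z *m F) *m idm X *m G.
    by rewrite (idmMr cpo (chain_mapM cpo cz cF).1) mulmxA.
  by apply: homotopicMr => //; apply: homotopicMl => //; apply: chain_mapM.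
case: nX; have hF : homotopic X Y F 0.
  apply: (@homotopic_trans _ _ _ _ _ _ ((z *m (idm Y - F *m G)) *m F)).
    by have := homotopic_sym (homotopicMr cpo cF hz); rewrite (idmMl cpo cF.1).
  rewrite -mulmxA mulmxBl (idmMl cpo cF.1) -mulmxA -(mulmx0 _ z); apply: homotopicMl => //.
  have := homotopicB (homotopic_refl _ _ F) (homotopicMl cpo cF e).
  by rewrite (idmMr cpo cF.1) subrr.
apply: homotopic_trans (homotopic_sym e) _.
by have := homotopicMl cpo cG hF; rewrite mulmx0.
Qed.

Lemma retract_cpow_cases X T1 T2 n : is_cpx X -> is_cpx T1 -> is_cpx T2 -> trivial_idem X ->
  ~ null X -> retract X (cpow (dsum T1 T2) n) -> retract X T1 \/ retract X T2.
Proof.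
move=> cX c1 c2 tX nX; have cT := is_cpx_dsum c1 c2.
elim: n => [|n IH] r.
  case: nX; apply: retract_null r _; exists 0; split; first exact: homd0.
  by apply/matrixP=> -[].
have [r'|/IH//] := retract_dsum_cases cX cT (is_cpx_cpow n cT) tX r.
exact: retract_dsum_cases r'.
Qed.
End Split.

(** * Euler characteristics relative to a submodule *)

Section ColumnDims.
Variables (K : fieldType) (A : falgType K).

Lemma ksub_zero m n : ksub (fun M : 'M[A]_(m, n) => M = 0).
Proof.
split=> // k M N -> ->; rewrite addr0.
by apply/matrixP=> i j; rewrite !mxE scaler0.
Qed.

Lemma mdim_zero m n : mdim (fun M : 'M[A]_(m, n) => M = 0) = 0%N.
Proof.
apply/eqP; rewrite /mdim dimv_eq0; apply/eqP/vspaceP=> v; rewrite memv0.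
apply/idP/eqP => [/(mvsP (ksub_zero _ _)) e|->]; last exact: mem0v.
by rewrite -[v]vmxK e; apply/ffunP=> ij; rewrite !ffunE mxE.
Qed.

Lemma mdim_bij m n p q (P : 'M[A]_(m, n) -> Prop) (Q : 'M[A]_(p, q) -> Prop) f :
  ksub P -> klin f -> (forall N, Q N <-> exists2 M, P M & N = f M) ->
  (forall M, P M -> f M = 0 -> M = 0) -> mdim Q = mdim P.
Proof.
move=> kP lf imf injf; have := mdim_rank kP (ksub_zero p q) lf.
rewrite mdim_zero addn0 => <-.
rewrite (@mdim_ext _ _ _ _ (fun M => P M /\ f M = 0) (fun M => M = 0)).
  rewrite mdim_zero addn0; apply: mdim_ext => N; split.
    by move/imf=> [M pM ->]; exists M; rewrite subrr.
  by move=> [M [pM /eqP]]; rewrite subr_eq0 => /eqP ->; apply/imf; exists M.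
by move=> M; split=> [[pM /injf]|->]; [apply|split; [case: kP|apply: klin0]].
Qed.

Lemma klin_mulr m n p (N : 'M[A]_(n, p)) : klin (fun M : 'M[A]_(m, n) => M *m N).
Proof. by move=> k M M'; rewrite mulmxDl kscaleMl. Qed.

Lemma ksub_cols m n (T : 'I_n -> 'cV[A]_m -> Prop) : (forall j, ksub (T j)) ->
  ksub (fun M : 'M[A]_(m, n) => forall j, T j (col j M)).
Proof.
move=> kT; split=> [j|k M N hM hN j].
  by rewrite col0; case: (kT j).
have -> : col j (kscale k M + N) = kscale k (col j M) + col j N by apply/colP=> i; rewrite !mxE.
by apply: (proj2 (kT j)).
Qed.

Lemma mdim_cols m n (T : 'I_n -> 'cV[A]_m -> Prop) : (forall j, ksub (T j)) ->
  mdim (fun M : 'M[A]_(m, n) => forall j, T j (col j M)) = (\sum_(j < n) mdim (T j))%N.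
Proof.
elim: n T => [|n IH] T kT.
  rewrite big_ord0; apply: etrans (mdim_zero m 0); apply: mdim_ext => M; split=> [_|_ []//].
  by apply/matrixP=> i [].
rewrite big_ord_recl; pose T' j := T (lift ord0 j).
have kT' j : ksub (T' j) by apply: kT.
have h0 (N : 'cV[A]_m) (M : 'M[A]_(m, n)) : col ord0 (row_mx N M : 'M_(m, n.+1)) = N.
  by apply/colP=> i; rewrite !mxE; case: splitP => k //= _; rewrite ord1.
have hS (N : 'cV[A]_m) (M : 'M[A]_(m, n)) j : col (lift ord0 j) (row_mx N M : 'M_(m, n.+1)) = col j M.
  apply/colP=> i; rewrite !mxE; case: splitP => k /=; rewrite /bump /= add1n; first by rewrite ord1.
  by case=> e; congr (M _ _); apply/val_inj.
have kP := ksub_cols kT.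
have lf : klin (fun M : 'M[A]_(m, n.+1) => col ord0 M).
  by move=> k M N; apply/colP=> i; rewrite !mxE.
have := mdim_rank kP (ksub_zero m 1) lf; rewrite mdim_zero addn0 => <-; congr (_ + _)%N.
  apply: mdim_ext => N; split=> [[M [/(_ ord0) tM /eqP]]|tN]; first by rewrite subr_eq0 => /eqP ->.
  exists (row_mx N (0 : 'M_(m, n))); rewrite h0 subrr; split=> // j.
  have [j'|] := unliftP ord0 j; last by move->; rewrite h0.
  by move->; rewrite hS col0; case: (kT (lift ord0 j')).
rewrite -(IH _ kT').
apply: (mdim_bij (f := fun M : 'M[A]_(m, n) => row_mx (0 : 'cV[A]_m) M : 'M_(m, n.+1)) (ksub_cols kT')).
- by move=> k M N; apply/matrixP=> i j; rewrite !mxE; case: (split _) => ?; rewrite !mxE ?scaler0 ?addr0.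
- move=> M; split=> [[tM c0]|[N tN ->]].
    exists (rsubmx (M : 'M_(m, 1 + n))).
      move=> j; have := tM (lift ord0 j); congr (T _ _); apply/colP=> i; rewrite !mxE.
      by congr (M _ _); apply/val_inj.
    suff e : lsubmx (M : 'M_(m, 1 + n)) = 0 by rewrite -e hsubmxK.
    apply/colP=> i; have /colP/(_ i) := c0; rewrite !mxE => <-; congr (M _ _); exact/val_inj.
  split; last exact: h0.
  move=> j; have [j'|] := unliftP ord0 j; last by move->; rewrite h0; case: (kT ord0).
  by move->; rewrite hS; apply: tN.
move=> M tM e; apply/matrixP=> i j; have := congr1 (col (lift ord0 j)) e.
by rewrite hS col0 => /colP/(_ i); rewrite !mxE.
Qed.
End ColumnDims.

(** * Right submodules of a free module of columns *)

Section Submodules.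
Variables (K : fieldType) (A : falgType K) (q : nat).

Definition submod (W : 'cV[A]_q -> Prop) :=
  [/\ W 0, forall u v, W u -> W v -> W (u + v) & forall v (a : A), W v -> W (v *m a%:M)].

Definition inW (W : 'cV[A]_q -> Prop) n (M : 'M[A]_(q, n)) := forall j, W (col j M).

Definition fullW (v : 'cV[A]_q) := True.

Lemma submod_full : submod fullW. Proof. by []. Qed.

Variable W : 'cV[A]_q -> Prop.
Hypothesis sW : submod W.

Lemma submodN v : W v -> W (- v).
Proof.
case: sW => _ _ /(_ v (-1)) h /h; congr W; apply/colP=> i.
by rewrite !mxE big_ord1 mxE mulr1n mulrN1.
Qed.

Lemma submod_sum n (F : 'I_n -> 'cV[A]_q) : (forall i, W (F i)) -> W (\sum_i F i).
Proof. by move=> h; case: sW => W0 WD _; apply: (big_ind W). Qed.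

Lemma submod_kscale k v : W v -> W (kscale k v).
Proof.
case: sW => _ _ /(_ v (k%:A)) h /h; congr W; apply/colP=> i.
by rewrite !mxE big_ord1 mxE mulr1n mulr_algr.
Qed.

Lemma submod_mulmx n (M : 'M[A]_(q, n)) (v : 'cV[A]_n) : inW W M -> W (M *m v).
Proof.
move=> h; have -> : M *m v = \sum_k col k M *m (v k 0)%:M.
  apply/colP=> i; rewrite summxE mxE; apply: eq_bigr => k _.
  by rewrite !mxE big_ord1 !mxE mulr1n.
by apply: submod_sum => k; case: sW => _ _; apply; apply: h.
Qed.

Lemma inW_mul n p (M : 'M[A]_(q, n)) (B : 'M[A]_(n, p)) : inW W M -> inW W (M *m B).
Proof. by move=> h j; rewrite colE -mulmxA -colE; apply: submod_mulmx. Qed.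

Lemma inWD n (M N : 'M[A]_(q, n)) : inW W M -> inW W N -> inW W (M + N).
Proof.
move=> hM hN j; have -> : col j (M + N) = col j M + col j N by apply/colP=> i; rewrite !mxE.
by case: sW => _ h _; apply: h.
Qed.

Lemma inWN n (M : 'M[A]_(q, n)) : inW W M -> inW W (- M).
Proof.
move=> hM j; have -> : col j (- M) = - col j M by apply/colP=> i; rewrite !mxE.
exact: submodN.
Qed.

Lemma inWB n (M N : 'M[A]_(q, n)) : inW W M -> inW W N -> inW W (M - N).
Proof. by move=> hM hN; apply: inWD => //; apply: inWN. Qed.

Lemma inW0 n : inW W (0 : 'M[A]_(q, n)).
Proof. by move=> j; rewrite col0; case: sW. Qed.
End Submodules.

Section Euler.
Variables (K : fieldType) (A : falgType K) (e1 e2 : A).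
Hypothesis cpo : complete_prim_orth e1 e2.
Local Notation cpx := (cpx A).
Local Notation eid := (eid e1 e2).
Local Notation homd := (homd e1 e2).
Local Notation is_cpx := (is_cpx e1 e2).
Local Notation chain_map := (chain_map e1 e2).
Local Notation homotopic := (homotopic e1 e2).
Local Notation idm := (idm e1 e2).
Local Notation isoK := (isoK e1 e2).
Local Notation nohom := (nohom e1 e2).
Local Notation two_term := (two_term e1 e2).

Variable X : cpx.

(** The columns that a graded map to X may have at a summand e_l A when it lands in degree [d]. *)
Definition colof l (d : int) (v : 'cV[A]_(csz X)) :=
  forall i, v i 0 = eid (clab X i) * v i 0 * eid l /\ (v i 0 <> 0 -> cdeg X i = d).

Lemma ksub_colof l d W : submod W -> ksub (fun v => colof l d v /\ W v).
Proof.
move=> sW; split.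
  by split; [move=> i; rewrite mxE mulr0 mul0r|case: sW].
move=> k u v [cu wu] [cv wv]; split; last first.
  by case: (sW) => _ h _; apply: h => //; apply: submod_kscale.
move=> i; have [a b] := cu i; have [a' b'] := cv i; rewrite !mxE; split.
  by rewrite mulrDr mulrDl -scalerAr -scalerAl -a -a'.
by have [z|/eqP/b//] := eqVneq (u i 0) 0; rewrite z scaler0 add0r; apply: b'.
Qed.

Lemma homd_colof U s M : homd U X s M <-> forall j, colof (clab U j) (cdeg U j + s) (col j M).
Proof. by split=> [h j i|h i j]; [rewrite mxE; apply: h|have := h j i; rewrite mxE]. Qed.

Definition cdim l d W := mdim (fun v => colof l d v /\ W v).

Definition hdim U s W := mdim (fun M => homd U X s M /\ inW W M).

Lemma hdimE U s W : submod W -> hdim U s W = (\sum_j cdim (clab U j) (cdeg U j + s) W)%N.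
Proof.
move=> sW; rewrite -mdim_cols; last by move=> j; apply: ksub_colof.
apply: mdim_ext => M; split=> [[/homd_colof h w] j|h]; first by split.
by split; [apply/homd_colof => j|move=> j]; case: (h j).
Qed.

Lemma ksub_homd U s W : submod W -> ksub (fun M => homd U X s M /\ inW W M).
Proof.
move=> sW; split; first by split; [apply: homd0|apply: inW0].
move=> k M N [hM wM] [hN wN]; split; first by apply: homdD => //; apply: homd_kscale.
apply: inWD => // j; have -> : col j (kscale k M) = kscale k (col j M) by apply/colP=> i; rewrite !mxE.
exact: submod_kscale.
Qed.

Definition ncol l d W : int := (cdim l d (@fullW K A _))%:Z - (cdim l d W)%:Z.

(** The Euler characteristic of Hom^0(U, X/W) -> Hom^1(U, X/W), where the map is composition with
    the differential of U. The differential of X does not enter: in the applications its image lies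
    in W. *)
Definition chi (U : cpx) W : int := \sum_(j < csz U) (ncol (clab U j) (cdeg U j) W - ncol (clab U j) (cdeg U j + 1) W).

Lemma chiE U W : submod W -> chi U W = ((hdim U 0 (@fullW K A _))%:Z - (hdim U 0 W)%:Z) -
  ((hdim U 1 (@fullW K A _))%:Z - (hdim U 1 W)%:Z).
Proof.
move=> sW; have sT := submod_full A (csz X); rewrite !hdimE //.
have pz n (F : 'I_n -> nat) : (\sum_j F j)%N%:Z = \sum_j (F j)%:Z.
  exact: (big_morph Posz PoszD).
rewrite !pz /chi sumrB /ncol !sumrB.
by congr (_ - _ - _); apply: eq_bigr => j _; rewrite addr0.
Qed.

Definition homW0 (U : cpx) W := forall M, homd U X 0 M -> inW W (M *m cd U) -> inW W M.
Definition extW0 (U : cpx) W := forall N, homd U X 1 N ->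
  exists2 M, homd U X 0 M & inW W (N - M *m cd U).

(** Kernel and image of composition with [cd U] modulo W, both pulled back to maps into X as in
    [mdim_rank]. *)
Definition kerP (U : cpx) W M := (homd U X 0 M /\ inW (@fullW K A _) M) /\
  homd U X 1 (M *m cd U) /\ inW W (M *m cd U).
Definition imgP (U : cpx) W N := exists M, (homd U X 0 M /\ inW (@fullW K A _) M) /\
  homd U X 1 (N - M *m cd U) /\ inW W (N - M *m cd U).

Arguments kerP : clear implicits.
Arguments imgP : clear implicits.

Lemma homd_mul_cd U M : is_cpx U -> homd U X 0 M -> homd U X 1 (M *m cd U).
Proof. by move=> [hd _] h; have := homdM cpo h hd. Qed.

Lemma ksub_kerP U W : submod W -> ksub (kerP U W).
Proof.
move=> sW; have sT := submod_full A (csz X).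
exact: (ksub_preim (ksub_homd U 0 sT) (ksub_homd U 1 sW) (klin_mulr (cd U) (m := csz X))).
Qed.

Lemma ksub_imgP U W : submod W -> ksub (imgP U W).
Proof.
move=> sW; have sT := submod_full A (csz X).
exact: (ksub_img (ksub_homd U 0 sT) (ksub_homd U 1 sW) (klin_mulr (cd U) (m := csz X))).
Qed.

Lemma kerP_sub U W M : submod W -> is_cpx U -> homd U X 0 M /\ inW W M -> kerP U W M.
Proof.
by move=> sW cU [h w]; exact: (conj (conj h (fun _ => I)) (conj (homd_mul_cd cU h) (inW_mul sW _ w))).
Qed.

Lemma imgP_sub U W N : is_cpx U -> imgP U W N -> homd U X 1 N /\ inW (@fullW K A _) N.
Proof.
move=> cU [M [[h _] [h' _]]]; split=> //; rewrite -[N](subrK (M *m cd U)).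
by apply: homdD => //; apply: homd_mul_cd.
Qed.

Lemma chi_kerP_imgP U W : submod W ->
  chi U W = ((mdim (kerP U W))%:Z - (hdim U 0 W)%:Z) -
    ((hdim U 1 (@fullW K A _))%:Z - (mdim (imgP U W))%:Z).
Proof.
move=> sW; have sT := submod_full A (csz X).
have rk : (mdim (imgP U W) + mdim (kerP U W) = hdim U 0 (@fullW K A _) + hdim U 1 W)%N.
  exact: (mdim_rank (ksub_homd U 0 sT) (ksub_homd U 1 sW) (klin_mulr (cd U) (m := csz X))).
by rewrite chiE //; move: rk; lia.
Qed.

Lemma chi_rank U W : submod W -> is_cpx U -> 
  [/\ (hdim U 0 W <= mdim (kerP U W))%N, (mdim (imgP U W) <= hdim U 1 (@fullW K A _))%N,
      (mdim (kerP U W) = hdim U 0 W <-> homW0 U W) &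
      (mdim (imgP U W) = hdim U 1 (@fullW K A _) <-> extW0 U W)].
Proof.
move=> sW cU; have sT := submod_full A (csz X).
have s1 M := @kerP_sub U W M sW cU; have s2 N := @imgP_sub U W N cU.
have kI := ksub_imgP U sW; have kP := ksub_kerP U sW.
have kT s := ksub_homd U s sT; have kW s := ksub_homd U s sW.
split.
- exact: mdimS.
- exact: mdimS.
- split=> [e M hM wM|h0]; last first.
    apply: mdim_ext => M; split; last exact: s1.
    by move=> [[h _] [_ w]]; split=> //; apply: h0.
  by have [] := mdim_eq (kW 0) kP s1 (esym e) (conj (conj hM (fun _ => I)) (conj (homd_mul_cd cU hM) wM)).
split=> [e N hN|e0].
  have [M [[h _] [_ w]]] := mdim_eq kI (kT 1) s2 e (conj hN (fun _ => I)).
  by exists M.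
apply: mdim_ext => N; split; first exact: s2.
move=> [/[dup] h /e0 [M hM w] _]; exists M.
exact: (conj (conj hM (fun _ => I)) (conj (homdB h (homd_mul_cd cU hM)) w)).
Qed.

(** chi is h^0 - h^1 with h^0 = 0 here; [extW0_chi] treats h^1 = 0 in the same way. *)
Lemma homW0_chi U W : submod W -> is_cpx U -> homW0 U W -> chi U W <= 0 /\ (chi U W = 0 -> extW0 U W).
Proof.
move=> sW cU h; have e := chi_kerP_imgP U sW; have [l1 l2 h1 h2] := chi_rank sW cU.
have ek := (proj2 h1) h; split; first by rewrite e ek; lia.
by move=> z; apply/h2; move: z; rewrite e ek; lia.
Qed.

Lemma extW0_chi U W : submod W -> is_cpx U -> extW0 U W -> 0 <= chi U W /\ (chi U W = 0 -> homW0 U W).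
Proof.
move=> sW cU h; have e := chi_kerP_imgP U sW; have [l1 l2 h1 h2] := chi_rank sW cU.
have ek := (proj2 h2) h; split; first by rewrite e ek; lia.
by move=> z; apply/h1; move: z; rewrite e ek; lia.
Qed.

Section Invariance.
Variables (U V : cpx) (F : 'M[A]_(csz V, csz U)) (G : 'M[A]_(csz U, csz V))
  (W : 'cV[A]_(csz X) -> Prop).
Hypotheses (degX : forall i, cdeg X i = 0) (tU : two_term U) (tV : two_term V) (sW : submod W)
  (cF : chain_map U V F) (cG : chain_map V U G) (FG : homotopic V V (F *m G) (idm V)).

(** h^0 of V embeds into h^0 of U by composition with [F]. Composing back with [G] returns M up to M
    d H, which lies in W; the other homotopy term M H d is 0 because X sits in degree 0 and V has
    nothing in degree 1. *)
Lemma kerP_retract : (mdim (kerP V W) + hdim U 0 W <= mdim (kerP U W) + hdim V 0 W)%N.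
Proof.
have [hF dF] := cF; have [hG dG] := cG; have [H [hH eH]] := FG.
apply: (mdim_inj (ksub_kerP V sW) (ksub_homd V 0 sW) (ksub_kerP U sW) (ksub_homd U 0 sW)
  (klin_mulr F (m := csz X))).
- by move=> M; apply: kerP_sub; case: tV.
- by move=> M; apply: kerP_sub; case: tU.
- move=> M [[hM _] [hMd wM]]; rewrite /kerP -mulmxA -dF mulmxA.
  have hMF : homd U X 0 (M *m F) by have := homdM cpo hM hF; rewrite addr0.
  have hMdF : homd U X 1 (M *m cd V *m F) by have := homdM cpo hMd hF; rewrite add0r.
  exact: (conj (conj hMF (fun _ => I)) (conj hMdF (inW_mul sW _ wM))).
move=> M [[hM _] [hMd wM]] [_ wMF]; split=> //.
have -> : M = M *m F *m G - M *m cd V *m H.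
  have zMH : M *m H = 0.
    apply/matrixP=> i j; rewrite [RHS]mxE; apply/eqP; apply: contraT => /eqP.
    move/(proj2 (homdM cpo hM hH i j)); rewrite degX addr0.
    by case: (proj2 tV j) => ->.
  rewrite -[M *m F *m G]mulmxA -[F *m G](subrK (idm V)) eH mulmxDr (idmMr cpo hM).
  by rewrite mulmxDr !mulmxA zMH mul0mx add0r addrAC subrr add0r.
by apply: inWB => //; apply: inW_mul.
Qed.

(** The same comparison for h^1; the term that must vanish for reasons of degree is now N d. *)
Lemma imgP_retract : (hdim V 1 (@fullW K A _) + mdim (imgP U W) <=
  hdim U 1 (@fullW K A _) + mdim (imgP V W))%N.
Proof.
have [hF dF] := cF; have [hG dG] := cG; have [H [hH eH]] := FG; have sT := submod_full A (csz X).
apply: (mdim_inj (ksub_homd V 1 sT) (ksub_imgP V sW) (ksub_homd U 1 sT) (ksub_imgP U sW)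
  (klin_mulr F (m := csz X))).
- by move=> N; apply: imgP_sub; case: tV.
- by move=> N; apply: imgP_sub; case: tU.
- by move=> N [hN _]; split=> //; have := homdM cpo hN hF; rewrite add0r.
move=> N [hN _] [M [[hM _] [hE wE]]].
have hMG : homd V X 0 (M *m G) by have := homdM cpo hM hG; rewrite addr0.
have hNH : homd V X 0 (N *m H) by have := homdM cpo hN hH; rewrite addNr.
have hMNH := homdB hMG hNH.
have e : N - (M *m G - N *m H) *m cd V = (N *m F - M *m cd U) *m G.
  have zN : N *m cd V = 0.
    apply/matrixP=> i j; rewrite [RHS]mxE; apply/eqP; apply: contraT => /eqP.
    move/(proj2 (homdM cpo hN tV.1.1 i j)); rewrite degX.
    by case: (proj2 tV j) => ->.
  rewrite !mulmxBl -[N *m F *m G]mulmxA -[F *m G](subrK (idm V)) eH mulmxDr (idmMr cpo hN).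
  rewrite mulmxDr !mulmxA zN mul0mx addr0 -[M *m cd U *m G]mulmxA dG mulmxA.
  by rewrite opprB addrA [N + _]addrC.
exists (M *m G - N *m H); rewrite e; split=> //; split; last exact: inW_mul.
by have := homdM cpo hE hG; rewrite add0r.
Qed.
End Invariance.

Lemma chi_isoK U V W : (forall i, cdeg X i = 0) -> two_term U -> two_term V -> submod W ->
  isoK U V -> chi U W = chi V W.
Proof.
move=> dX tU tV sW [F [G [cF [cG [e e']]]]]; rewrite !chi_kerP_imgP //.
have := kerP_retract dX tU tV sW cF cG e'; have := kerP_retract dX tV tU sW cG cF e.
have := imgP_retract dX tU tV sW cF cG e'; have := imgP_retract dX tV tU sW cG cF e.
have [l1 l2 _ _] := chi_rank sW tU.1; have [l3 l4 _ _] := chi_rank sW tV.1.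
by move: l1 l2 l3 l4; lia.
Qed.

Hypothesis tX : two_term X.

(** W contains everything in degree -1, so X/W is a module in degree 0. *)
Definition containsX1 (W : 'cV[A]_(csz X) -> Prop) := forall v : 'cV_(csz X), (forall i, cdeg X i = 0 -> v i 0 = 0) -> W v.

Lemma chi_two_term U W : containsX1 W -> two_term U ->
  chi U W = \sum_(j < csz U) (-1) ^ cdeg U j * ncol (clab U j) 0 W.
Proof.
move=> cW [_ tU]; apply: eq_bigr => j _.
have n1 l : ncol l 1 W = 0.
  apply/eqP; rewrite subr_eq0; apply/eqP; congr Posz; apply: mdim_ext => v.
  split=> -[c _]; split=> //.
  apply: cW => i d; apply/eqP; apply: contraT => /eqP; case: (c i) => _ h /h.
  by rewrite d.
have nN1 l : ncol l (-1) W = 0.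
  apply/eqP; rewrite subr_eq0; apply/eqP; congr Posz; apply: mdim_ext => v.
  split=> -[c _]; split=> //.
  apply: cW => i d; apply/eqP; apply: contraT => /eqP; case: (c i) => _ h /h.
  by rewrite d.
have [-> | ->] := tU j; first by rewrite add0r n1 subr0 expr0z mul1r.
by rewrite nN1 addNr sub0r exprN1 invrN1 mulN1r.
Qed.

(** Only degree 0 of X survives in X/W, so a summand of U contributes with the sign of its degree,
    exactly as it does to the g-vector. *)
Lemma chi_gvec (R : realType) U W : containsX1 W -> two_term U ->
  (chi U W)%:~R = gvec R U 0 0 * (ncol false 0 W)%:~R + gvec R U 0 1 * (ncol true 0 W)%:~R.
Proof.
move=> cW tU; rewrite (chi_two_term cW tU) rmorph_sum /gvec !summxE !mulr_suml -big_split /=.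
apply: eq_bigr => j _; have [_ /(_ j) h] := tU.
rewrite rmorphM /= !mxE /vP.
have -> : ((-1) ^ cdeg U j : int)%:~R = (-1) ^ cdeg U j :> R.
  by case: h => ->; rewrite ?expr0z // !exprN1 !invrN1 rmorphN1.
by case: (clab U j); rewrite /vP1 /vP2 !mxE /= ?mulr0 ?mulr1 ?mul0r ?addr0 ?add0r.
Qed.

(** The image of the differential together with all of degree -1; the quotient of X by it is
    H^0(X). *)
Definition imW (v : 'cV[A]_(csz X)) := exists u : 'cV[A]_(csz X), forall i, cdeg X i = 0 -> v i 0 = (cd X *m u) i 0.

Lemma submod_imW : submod imW.
Proof.
split.
- by exists 0 => i _; rewrite mulmx0 !mxE.
- by move=> u v [u' hu] [v' hv]; exists (u' + v') => i d; rewrite mulmxDr !mxE hu // hv // !mxE.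
by move=> v a [u hu]; exists (u *m a%:M) => i d; rewrite mulmxA mxE [RHS]mxE !big_ord1 hu.
Qed.

Lemma two_term_dX i j : cd X i j <> 0 -> cdeg X i = 0 /\ cdeg X j = -1.
Proof.
case: tX => [[h _] t]; have [_ b] := h i j => /b.
by case: (t i) (t j) => [-> [->|->]|-> [->|->]].
Qed.

(** A map U -> X[1] is a map U^-1 -> X^0, null-homotopic when it has the form M d_U + d_X H. Since
    U^-1 is projective, it is enough that it equal M d_U modulo the image of d_X: preimages are
    chosen column by column. *)
Lemma extW0_nohom U : two_term U -> extW0 U imW <-> nohom U (shift X).
Proof.
move=> [cU tU]; have [hX _] := tX.1; have [hU _] := cU.
split=> [ext F [/homd_shift_r hF cF]|nh N hN].
  rewrite add0r in hF; have [M hM /choice [u hu]] := ext F hF.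
  pose H : 'M[A]_(csz X, csz U) := \matrix_(i, j)
    (if cdeg X i == cdeg U j then eid (clab X i) * u j i 0 * eid (clab U j) else 0).
  have hH : homd U X 0 H.
    move=> i j; rewrite mxE addr0; case: eqP => [->|_]; last by rewrite mulr0 mul0r.
    by rewrite -!mulrA eidK // !mulrA eidK.
  have hMd : homd U X 1 (M *m cd U) by have := homdM cpo hM hU.
  have hdH : homd U X 1 (cd X *m H) by have := homdM cpo hX hH; rewrite add0r.
  have eF : F - M *m cd U = cd X *m H.
    have hE := homdB hF hMd.
    apply/matrixP=> i j; have [/andP [/eqP di /eqP dj]|nd] := boolP ((cdeg X i == 0) && (cdeg U j == -1)).
      rewrite -(homd_eidr cpo hE i j).
      have /(_ i di) := hu j; rewrite mxE => ->; rewrite !mxE mulr_suml; apply: eq_bigr => k _.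
      have [->|/eqP/two_term_dX [_ dk]] := eqVneq (cd X i k) 0; first by rewrite !mul0r.
      by rewrite mxE dk dj eqxx !mulrA (homd_eidr cpo hX).
    have z s M' : homd U X s M' -> s = 1 -> M' i j = 0.
      move=> h es; apply/eqP; apply: contraT => /eqP/(proj2 (h i j)); rewrite es => d.
      by case/negP: nd; move: d; case: (tU j) (proj2 tX i) => [-> [->|->]|-> [->|->]].
    by rewrite (z _ _ hE) // (z _ _ hdH).
  (* One homotopy from two pieces: [M] on degree 0 of U and - [H] on degree -1, the sign
     compensating the negated differential of the shift. *)
  pose H' : 'M[A]_(csz X, csz U) := \matrix_(i, j) (if cdeg U j == 0 then M i j else - H i j).
  exists H'; split.
    apply/homd_shift_r => i j; rewrite addNr mxE; case: ifP => _; first exact: hM.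
    by have := homdN hH i j; rewrite mxE.
  have e1' : H' *m cd U = M *m cd U.
    apply/matrixP=> i j; rewrite !mxE; apply: eq_bigr => k _; rewrite mxE.
    have [->|/eqP/(proj2 (hU k j)) d] := eqVneq (cd U k j) 0; first by rewrite !mulr0.
    by rewrite ifT //; move: d; case: (tU k) (tU j) => [-> [->|->]|-> [->|->]].
  have e2' : cd X *m H' = - (cd X *m H).
    apply/matrixP=> i j; rewrite !mxE -sumrN; apply: eq_bigr => k _; rewrite mxE.
    have [->|/eqP/two_term_dX [_ dk]] := eqVneq (cd X i k) 0; first by rewrite !mul0r oppr0.
    case: eqP => dj; last by rewrite mulrN.
    rewrite mxE dk dj (_ : M k j = 0) ?mulr0 ?oppr0 //.
    by apply/eqP; apply: contraT => /eqP/(proj2 (hM k j)); rewrite dk dj.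
  by rewrite subr0 /= e1' mulNmx e2' opprK -eF addrC subrK.
have zX : cd X *m N = 0.
  apply/matrixP=> i j; rewrite !mxE big1 // => k _.
  have [->|/eqP/two_term_dX [_ dk]] := eqVneq (cd X i k) 0; first by rewrite mul0r.
  have [->|/eqP/(proj2 (hN k j))] := eqVneq (N k j) 0; first by rewrite mulr0.
  by rewrite dk; case: (tU j) => ->.
have zU : N *m cd U = 0.
  apply/matrixP=> i j; rewrite !mxE big1 // => k _.
  have [->|/eqP/(proj2 (hU k j)) d] := eqVneq (cd U k j) 0; first by rewrite mulr0.
  have [->|/eqP/(proj2 (hN i k))] := eqVneq (N i k) 0; first by rewrite mul0r.
  move=> d2; exfalso; move: d d2 (tU k) (tU j) (proj2 tX i); lia.
have [|H [/homd_shift_r]] := nh N.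
  by split; [apply/homd_shift_r; rewrite add0r|rewrite /= mulNmx zX zU oppr0].
rewrite addNr subr0 /= mulNmx => hH e; exists H => // j.
exists (- col j H) => i _; by rewrite e mulmxN addrC addKr !mxE; congr (- _); apply: eq_bigr => k _; rewrite mxE.
Qed.

(** * The trace of a family of complexes in H^0(X) *)

Section Trace.
Variable act : cpx -> Prop.

(** The submodule generated by [imW] and by the images of maps U -> H^0(X) with U active; [M]
    represents such a map when M d_U lands in [imW]. Adding one generator at a time makes the proofs
    inductions. *)
Inductive traceW : 'cV[A]_(csz X) -> Prop :=
| traceW_im v : imW v -> traceW v
| traceW_add U M (a : 'cV[A]_(csz U)) v : act U -> homd U X 0 M -> inW imW (M *m cd U) ->
    traceW v -> traceW (v + M *m a).

Lemma submod_trace : submod traceW.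
Proof.
split.
- by apply: traceW_im; case: submod_imW.
- move=> u v tu; elim=> {v} [v iv|U M a v aU hM wM _ IH]; last by rewrite addrA; apply: traceW_add.
  elim: tu => {u} [u iu|U M a u aU hM wM _ IH].
    by apply: traceW_im; case: submod_imW => _ h _; apply: h.
  by rewrite addrAC; apply: traceW_add.
move=> v b; elim=> {v} [v iv|U M a v aU hM wM _ IH].
  by apply: traceW_im; case: submod_imW => _ _; apply.
by rewrite mulmxDl -mulmxA; apply: traceW_add.
Qed.

Lemma containsX1_trace : containsX1 traceW.
Proof. by move=> v h; apply: traceW_im; exists 0 => i d; rewrite mulmx0 h // mxE. Qed.

(** Ext^1(Z, trace) = 0: on a summand of Z in degree -1, a map into the trace is, modulo [imW], a
    sum of maps that factor through some Z -> U[1], and these are null-homotopic. *)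
Lemma trace_lift Z : two_term Z -> (forall U, act U -> two_term U /\ nohom Z (shift U)) ->
  forall N, homd Z X 1 N -> inW traceW N ->
  exists2 M, homd Z X 0 M & inW traceW M /\ inW imW (N - M *m cd Z).
Proof.
move=> [cZ tZ] nh; have [hZ _] := cZ; have sT := submod_trace; have sI := submod_imW.
pose G (N : 'M_(csz X, csz Z)) := exists2 M, homd Z X 0 M & inW traceW M /\ inW imW (N - M *m cd Z).
have G0 N : inW imW N -> G N.
  by exists 0; [apply: homd0|split; [apply: inW0|rewrite mul0mx subr0]].
have GD N N' : G N -> G N' -> G (N + N').
  move=> [M hM [tM iM]] [M' hM' [tM' iM']]; exists (M + M'); first exact: homdD.
  split; first exact: inWD.
  by rewrite mulmxDl opprD addrACA; apply: inWD.
have Gcol v j : cdeg Z j = -1 -> traceW v -> G (v *m (eid (clab Z j))%:M *m delta_mx 0 j).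
  move=> dj; elim=> {v} [v iv|U M a v aU hM wM _ IH].
    by apply: G0; apply: inW_mul => //; apply: inW_mul => // k; rewrite (_ : col k v = v) //;
      apply/colP=> i; rewrite mxE ord1.
  rewrite !mulmxDl; apply: GD => //.
  have [[cU tU] nZU] := nh U aU; have [hU _] := cU.
  (* The coefficients of the generator M a, cut by idempotents and read as a map from summand j of Z
     to degree 0 of U, that is as a chain map Z -> U[1]. *)
  pose B : 'M[A]_(csz U, csz Z) := \matrix_(i, k)
    (if (cdeg U i == 0) && (k == j) then eid (clab U i) * a i 0 * eid (clab Z j) else 0).
  have hB : homd Z U 1 B.
    move=> i k; rewrite mxE; case: andP => [[/eqP -> /eqP ->]|_]; last by rewrite mulr0 mul0r.
    by rewrite dj; split=> //; rewrite -!mulrA eidK // !mulrA eidK.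
  have zU : cd U *m B = 0.
    apply/matrixP=> i k; rewrite !mxE big1 // => h _; rewrite mxE.
    case: andP => [[/eqP dh _]|_]; last by rewrite mulr0.
    have [->|/eqP/(proj2 (hU i h))] := eqVneq (cd U i h) 0; first by rewrite mul0r.
    by rewrite dh; case: (tU i) => ->.
  have zZ : B *m cd Z = 0.
    apply/matrixP=> i k; rewrite !mxE big1 // => h _; rewrite mxE.
    case: andP => [[_ /eqP ->]|_]; last by rewrite mul0r.
    have [->|/eqP/(proj2 (hZ j k))] := eqVneq (cd Z j k) 0; first by rewrite mulr0.
    by rewrite dj; case: (tZ k) => ->.
  have [|H [/homd_shift_r]] := nZU B.
    by split; [apply/homd_shift_r; rewrite add0r|rewrite /= mulNmx zU zZ oppr0].
  rewrite addNr subr0 /= mulNmx => hH e.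
  exists (M *m H); first by have := homdM cpo hM hH; rewrite addr0.
  split.
    move=> k; rewrite colE -mulmxA -colE -[M *m _]add0r; apply: traceW_add => //.
    by case: sT.
  have -> : M *m a *m (eid (clab Z j))%:M *m delta_mx 0 j - M *m H *m cd Z =
      (M *m a *m (eid (clab Z j))%:M *m delta_mx 0 j - M *m B) - M *m cd U *m H.
    by rewrite e mulmxBr !mulmxA opprB addrA addrAC addrK.
  apply: inWB => //; last exact: inW_mul.
  move=> k; exists 0 => i di; rewrite mulmx0 !mxE.
  have [->|nk] := eqVneq k j; last first.
    by rewrite !big1 ?subrr // => h _; rewrite !mxE (negPf nk) andbF mulr0.
  rewrite big_ord1 !mxE !eqxx mulr1 big_ord1 !mxE eqxx mulr1n mulr_suml -sumrB big1 // => h _.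
  rewrite mxE eqxx andbT; have [->|/eqP/(proj2 (hM i h))] := eqVneq (M i h) 0.
    by rewrite !mul0r subrr.
  by rewrite di addr0 => <-; rewrite eqxx !mulrA (homd_eidr cpo hM) subrr.
move=> N hN tN.
have -> : N = \sum_j col j N *m (eid (clab Z j))%:M *m delta_mx 0 j.
  apply/matrixP=> i j; rewrite summxE (bigD1 j) //= big1 ?addr0.
    by rewrite !mxE big_ord1 !mxE !eqxx mulr1 big_ord1 !mxE eqxx mulr1n (homd_eidr cpo hN).
  by move=> k nk; rewrite !mxE big_ord1 !mxE eqxx eq_sym (negPf nk) mulr0.
apply: (big_ind G) => // [|j _]; first by apply: G0; apply: inW0.
have [d|d] := tZ j; last exact: Gcol.
apply: G0; rewrite (_ : col j N = 0) ?mul0mx; first exact: inW0.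
apply/colP=> i; rewrite !mxE; apply/eqP; apply: contraT => /eqP/(proj2 (hN i j)).
by rewrite d; case: (proj2 tX i) => ->.
Qed.

(** By [trace_lift] there is no obstruction to lifting a map U -> X/trace to H^0(X), and the lift is
    one of the maps whose images generate the trace. *)
Lemma homW0_trace U : act U -> two_term U -> (forall U', act U' -> two_term U' /\ nohom U (shift U')) ->
  homW0 U traceW.
Proof.
move=> aU tU nh M hM tM; have [hU _] := tU.1.
have hMd : homd U X 1 (M *m cd U) by have := homdM cpo hM hU.
have [M' hM' [tM' iM']] := trace_lift tU nh hMd tM.
rewrite -[M](subrK M'); apply: (inWD submod_trace) => // j.
rewrite colE -[_ *m _]add0r; apply: traceW_add aU (homdB hM hM') _ _; last by case: submod_trace.
by rewrite mulmxBl.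
Qed.
End Trace.
End Euler.

(** * Comparison of extensions through g-vectors *)

Section Theta.
Variables (K : fieldType) (A : falgType K) (e1 e2 : A) (R : realType).
Hypothesis cpo : complete_prim_orth e1 e2.
Local Notation cpx := (cpx A).
Local Notation homd := (homd e1 e2).
Local Notation idm := (idm e1 e2).
Local Notation nohom := (nohom e1 e2).
Local Notation two_term := (two_term e1 e2).

Section Same.
Variables (U V : bool -> cpx) (w w' : bool -> R).
Hypotheses (tU : forall b, two_term (U b)) (tV : forall b, two_term (V b))
  (w0 : forall b, 0 <= w b) (w0' : forall b, 0 <= w' b)
  (eqg : \sum_b w b *: gvec R (U b) = \sum_b w' b *: gvec R (V b))
  (nU : forall i j, 0 < w i -> 0 < w j -> nohom (U i) (shift (U j)))
  (nV : forall i j, 0 < w' i -> 0 < w' j -> nohom (V i) (shift (V j))).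

Let act Z := exists2 i, 0 < w i & Z = U i.

(** The active U's have no maps to X/trace, so their chi is nonpositive; the V's have no extensions
    with it, so theirs is nonnegative. The weighted sums agree by linearity in the g-vector, so each
    active chi is 0, and the complementary vanishing follows. *)
Lemma theta_chi X : two_term X ->
  let W := traceW e1 e2 (X := X) act in
  (forall j, 0 < w' j -> extW0 e1 e2 (V j) W) ->
  (forall i, 0 < w i -> extW0 e1 e2 (U i) W) /\ (forall j, 0 < w' j -> homW0 e1 e2 (V j) W).
Proof.
move=> tX W ext; have sW := submod_trace e1 e2 X act.
have hom i : 0 < w i -> homW0 e1 e2 (U i) W.
  move=> wi M; apply: homW0_trace => //; first by exists i.
  by move=> _ [j wj ->]; split=> //; apply: nU.
have cU i : w i * (chi e1 e2 (U i) W)%:~R <= 0.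
  have := w0 i; rewrite le_eqVlt => /orP [/eqP <-|wi]; first by rewrite mul0r.
  have [h _] := homW0_chi cpo sW (tU i).1 (hom i wi).
  by rewrite pmulr_rle0 // lerz0.
have cV j : 0 <= w' j * (chi e1 e2 (V j) W)%:~R.
  have := w0' j; rewrite le_eqVlt => /orP [/eqP <-|wj]; first by rewrite mul0r.
  have [h _] := extW0_chi cpo sW (tV j).1 (ext j wj).
  by rewrite pmulr_rge0 // ler0z.
have cW := @containsX1_trace K A e1 e2 X act.
have e : \sum_b w b * (chi e1 e2 (U b) W)%:~R = \sum_b w' b * (chi e1 e2 (V b) W)%:~R.
  have gen (Y : bool -> cpx) (v : bool -> R) : (forall b, two_term (Y b)) ->
    \sum_b v b * (chi e1 e2 (Y b) W)%:~R =
      (\sum_b v b *: gvec R (Y b)) 0 0 * (ncol e1 e2 (X := X) false 0 W)%:~R +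
      (\sum_b v b *: gvec R (Y b)) 0 1 * (ncol e1 e2 (X := X) true 0 W)%:~R.
    move=> tY; rewrite !summxE !mulr_suml -big_split /=; apply: eq_bigr => b _.
    by rewrite (chi_gvec R cW (tY b)) !mxE mulrDr !mulrA.
  by rewrite !gen // eqg.
rewrite !big_bool /= in e.
move: e (cU true) (cU false) (cV true) (cV false) => e cUt cUf cVt cVf.
have zU i : w i * (chi e1 e2 (U i) W)%:~R = 0 by case: i; lra.
have zV j : w' j * (chi e1 e2 (V j) W)%:~R = 0 by case: j; lra.
split=> [i wi|j wj].
  have [_] := homW0_chi cpo sW (tU i).1 (hom i wi); apply.
  by have /eqP := zU i; rewrite mulf_eq0 (gt_eqF wi) /= intr_eq0 => /eqP.
have [_] := extW0_chi cpo sW (tV j).1 (ext j wj); apply.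
by have /eqP := zV j; rewrite mulf_eq0 (gt_eqF wj) /= intr_eq0 => /eqP.
Qed.

Lemma extW0_trace X Z : two_term X -> extW0 e1 e2 Z (imW (X := X)) ->
  extW0 e1 e2 Z (traceW e1 e2 (X := X) act).
Proof. by move=> tX h N /h [M hM iM]; exists M => // j; apply: traceW_im. Qed.

(** Extensions of U by X/trace vanish by [theta_chi], because the V's have none with H^0(X) and
    hence none with its quotient; extensions of U by the trace vanish by [trace_lift]. *)
Lemma theta_left X : two_term X -> (forall j, 0 < w' j -> nohom (V j) (shift X)) ->
  forall i, 0 < w i -> nohom (U i) (shift X).
Proof.
move=> tX nX i wi.
have [|/(_ i wi) ext _] := theta_chi tX.
  by move=> j wj; apply: extW0_trace => //; apply/(extW0_nohom cpo tX (tV j)); apply: nX.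
apply/(extW0_nohom cpo tX (tU i)) => N hN; have [M hM wM] := ext N hN.
have hE : homd (U i) X 1 (N - M *m cd (U i)).
  by apply: homdB => //; apply: homd_mul_cd => //; case: (tU i).
have [|M' hM' [_ iM']] := trace_lift cpo tX (tU i) _ hE wM.
  by move=> _ [j wj ->]; split=> //; apply: nU.
exists (M + M'); first exact: homdD.
by rewrite mulmxDl opprD addrA.
Qed.

(** Here [theta_chi] is applied to V_j itself: it has no map to the quotient of H^0(V_j) by the
    trace of the U's, so its identity takes values in the trace, and [trace_lift] handles every map
    X -> V_j[1]. *)
Lemma theta_right X : two_term X -> (forall i, 0 < w i -> nohom X (shift (U i))) ->
  forall j, 0 < w' j -> nohom X (shift (V j)).
Proof.
move=> tX nX j wj; have tY := tV j.
have sW := submod_trace e1 e2 (V j) act.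
have [|_ /(_ j wj) hom] := theta_chi tY.
  by move=> k wk; apply: extW0_trace => //; apply/(extW0_nohom cpo tY (tV k)); apply: nV.
have hi := @homd_idm _ _ _ cpo (V j).
have wi : inW (traceW e1 e2 act) (idm (V j)).
  apply: hom => // k; apply: traceW_im; exists (delta_mx k 0) => i _.
  by rewrite (idmMl cpo tY.1.1) colE.
apply/(extW0_nohom cpo tY tX) => N hN.
have wN : inW (traceW e1 e2 act) N by rewrite -(idmMl cpo hN); apply: inW_mul.
have [|M hM [_ iM]] := trace_lift cpo tY tX _ hN wN; last by exists M.
by move=> _ [i wi' ->]; split=> //; apply: nX.
Qed.
End Same.
End Theta.

(** * Silting pairs *)

Definition stalk (A : nzRingType) (l : bool) (d : int) : cpx A := Cpx 1 (fun _ => l) (fun _ => d) 0.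
Arguments stalk {A} l d.

Section Pairs.
Variables (K : fieldType) (A : falgType K) (e1 e2 : A) (R : realType).
Hypotheses (cpo : complete_prim_orth e1 e2) (bas : basic2 e1 e2).
Local Notation cpx := (cpx A).
Local Notation eid := (eid e1 e2).
Local Notation is_cpx := (is_cpx e1 e2).
Local Notation chain_map := (chain_map e1 e2).
Local Notation homotopic := (homotopic e1 e2).
Local Notation idm := (idm e1 e2).
Local Notation isoK := (isoK e1 e2).
Local Notation nohom := (nohom e1 e2).
Local Notation retract := (retract e1 e2).
Local Notation two_term := (two_term e1 e2).
Local Notation silting_pair := (basic_two_silting e1 e2).
Local Notation gvec := (gvec R).

Lemma eid_neq0 l : eid l <> 0.
Proof. by case: l; case: cpo => [[_ [h _]] [[_ [h' _]] _]]. Qed.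

Lemma eid_sum l : eid l + eid (~~ l) = 1.
Proof. by case: l; case: cpo => _ [_ [_ [_ h]]]; rewrite /= ?h // addrC. Qed.

(** If x y = e_l, then y x is an idempotent of the other corner. Were it 0, e_l would vanish; were
    it the unit, P_1 and P_2 would be isomorphic. *)
Lemma corner_not_iso l x y : x = eid l * x * eid (~~ l) -> y = eid (~~ l) * y * eid l -> x * y <> eid l.
Proof.
move=> ex ey xy.
have yl : y * eid l = y by rewrite ey -!mulrA eidK.
have xl : eid l * x = x by rewrite ex !mulrA eidK.
have id : y * x * (y * x) = y * x by rewrite mulrA -[y * x * y]mulrA xy yl.
have co : y * x = eid (~~ l) * (y * x) * eid (~~ l).
  have yl' : eid (~~ l) * y = y by rewrite ey !mulrA eidK.
  have xl' : x * eid (~~ l) = x by rewrite ex -!mulrA eidK.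
  by rewrite mulrA yl' -mulrA xl'.
have [z|yx] := corner_idem cpo co id.
  by apply: (eid_neq0 (l := l)); rewrite -(eidK cpo) -{1}xy -mulrA -xy [y * _]mulrA z mul0r mulr0.
by apply: bas; case: l ex ey xy yl xl co yx {id} => /= ex ey xy yl xl co yx; [exists y, x|exists x, y].
Qed.

(* Vectors with non-invertible component in the local ring e_l A e_l; they form a submodule because A is basic. *)
Definition radW l (v : 'cV[A]_1) := forall b, eid l * v 0 0 * eid l * b * eid l <> eid l.

Lemma submod_rad l : submod (radW l).
Proof.
have ee := eidK cpo l.
have key p q : p = eid l * p * eid l -> p + q = eid l ->
   (exists c, p * c * eid l = eid l) \/ (exists c, q * c * eid l = eid l).
  move=> ep pq; have [[c ec [pc _]]|[c ec [qc _]]] := corner_local cpo ep; [left|right]; exists c.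
    by rewrite pc ee.
  by rewrite -pq addrC addKr in qc; rewrite qc pq.
split.
- by move=> b; rewrite mxE !(mulr0, mul0r) => /esym /eid_neq0.
- move=> u v hu hv b; rewrite mxE mulrDr !mulrDl => e.
  have [|[c ec]|[c ec]] := key _ _ _ e; first by rewrite !mulrA ee -!mulrA ee.
    by apply: (hu (b * eid l * c)); rewrite !mulrA.
  by apply: (hv (b * eid l * c)); rewrite !mulrA.
move=> v a hv b; rewrite mxE big_ord1 mxE mulr1n => e.
pose p := eid l * v 0 0 * eid l * (a * eid l * b) * eid l.
pose x := eid l * v 0 0 * eid (~~ l); pose y := eid (~~ l) * (a * eid l * b) * eid l.
have pq : p + x * y = eid l.
  rewrite -[RHS]e -[in RHS](mulr1 (v 0 0)) -(eid_sum l) mulrDr mulrDl mulrDr !mulrDl /p /x /y.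
  by congr (_ + _); rewrite !mulrA // -[_ * eid (~~ l) * eid (~~ l)]mulrA eidK.
have [|[c ec]|[c ec]] := key _ _ _ pq; first by rewrite /p !mulrA ee -!mulrA ee.
  by apply: (hv (a * eid l * b * eid l * c)); rewrite -[RHS]ec /p !mulrA.
apply: (@corner_not_iso l x (y * c * eid l)).
- by rewrite /x !mulrA ee -!mulrA eidK.
- by rewrite /y !mulrA eidK // -!mulrA ee.
by rewrite -[RHS]ec !mulrA.
Qed.

Lemma two_term_stalk l d : d = 0 \/ d = -1 -> two_term (stalk l d).
Proof.
by move=> hd; split=> //; split; [apply: homd0|rewrite mulmx0].
Qed.

(** The Euler characteristic with values in the simple top of e_l A, that is with X = e_l A and W =
    [radW l], is a nonzero multiple of the coordinate of index l, and it is invariant by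
    [chi_isoK]. *)
Lemma gvec_isoK U V : two_term U -> two_term V -> isoK U V -> gvec U = gvec V.
Proof.
move=> tU tV iso.
have main l : gvec U 0 (if l then 1 else 0) = gvec V 0 (if l then 1 else 0).
  have tX := two_term_stalk l (or_introl (erefl 0 : 0 = 0)).
  have cW : containsX1 (X := stalk l 0) (radW l).
    by move=> v hv b; rewrite hv // !(mulr0, mul0r) => /esym /eid_neq0.
  have sW := submod_rad l.
  have e := chi_isoK cpo (X := stalk l 0) (fun _ => erefl) tU tV sW iso.
  have sF := submod_full A 1.
  have n0 : ncol e1 e2 (X := stalk l 0) (~~ l) 0 (radW l) = 0.
    apply/eqP; rewrite subr_eq0; apply/eqP; congr Posz; apply: mdim_ext => v.
    split=> -[c _]; split=> // b; have [-> _] := c 0.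
    rewrite -!mulrA [eid (~~ l) * (eid l * _)]mulrA (eid_orth cpo); last by case: (l).
    by rewrite !(mulr0, mul0r) => /esym /eid_neq0.
  have n1 : ncol e1 e2 (X := stalk l 0) l 0 (radW l) != 0.
    apply/negP; rewrite subr_eq0 => /eqP [] ed.
    have : colof e1 e2 (X := stalk l 0) l 0 (eid l)%:M /\ radW l (eid l)%:M.
      have sub M : colof e1 e2 (X := stalk l 0) l 0 M /\ radW l M ->
        colof e1 e2 (X := stalk l 0) l 0 M /\ @fullW K A 1 M by case.
      apply: (mdim_eq (@ksub_colof K A e1 e2 (stalk l 0) l 0 _ sW)
        (@ksub_colof K A e1 e2 (stalk l 0) l 0 _ sF) sub (esym ed)).
      by split=> // i; rewrite !ord1 mxE mulr1n !eidK.
    by move=> [_ /(_ 1)]; rewrite mxE mulr1n mulr1 !eidK.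
  have := congr1 (fun z : int => z%:~R : R) e; rewrite !(chi_gvec R cW) //.
  move: n0 n1; clear; case: l => /= -> nz; rewrite !mulr0 ?addr0 ?add0r;
    by apply: mulIf; rewrite intr_eq0.
apply/rowP=> j; case: j => [[|[|//]] hj].
  by have := main false; congr (_ = _); congr (_ _ _); apply/val_inj.
by have := main true; congr (_ = _); congr (_ _ _); apply/val_inj.
Qed.

Lemma nohom_degrees X Y : (forall i j, cdeg Y i <> cdeg X j) -> nohom X Y.
Proof.
move=> h F [hF _]; exists 0; split; first exact: homd0.
rewrite mul0mx mulmx0 addr0 subr0; apply/matrixP=> i j; rewrite mxE; apply/eqP.
by apply: contraT => /eqP/(proj2 (hF i j)); rewrite addr0 => /h.
Qed.

Lemma cdeg_shiftn_le n (Y : cpx) c : (forall i, cdeg Y i <= c) ->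
  forall i, cdeg (shiftn n Y) i <= c - n%:Z.
Proof.
move=> h; elim: n => [|n IH] /= i; first by rewrite subr0; apply: h.
by have := IH i; lia.
Qed.

Lemma two_term_nohom X Y : two_term X -> two_term Y -> nohom X (shift Y) ->
  forall n, (0 < n)%N -> nohom X (shiftn n Y).
Proof.
move=> [_ tX] [_ tY] h [//|[//|n]] _; apply: nohom_degrees => i j.
have h0 : forall i, cdeg Y i <= 0 by move=> k; case: (tY k) => ->.
by have := cdeg_shiftn_le h0 (n := n.+2) i; case: (tX j) => ->; lia.
Qed.

Lemma two_term_dsum X Y : two_term X -> two_term Y -> two_term (dsum X Y).
Proof.
move=> [cX tX] [cY tY]; split; first exact: is_cpx_dsum.
by move=> i /=; rewrite /sumdeg; case: split => k; [apply: tX|apply: tY].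
Qed.

Lemma nohom_shift_dsum_r X C D : nohom X (shift C) -> nohom X (shift D) -> nohom X (shift (dsum C D)).
Proof.
move=> /nohom_adj hC /nohom_adj hD; apply/nohom_adj; exact: nohom_dsum_r.
Qed.

Section OnePair.
Variables T1 T2 : cpx.
Hypothesis sT : silting_pair T1 T2.
Let T := dsum T1 T2.

Lemma pair_two_term : [/\ two_term T1, two_term T2 & two_term T].
Proof. by case: sT => [t1 [t2 _]]; split=> //; apply: two_term_dsum. Qed.

Lemma pair_ext n : (0 < n)%N -> nohom T (shiftn n T).
Proof. by move=> n0 F cF; case: sT => _ [_ [_ [_ [_ [_ [h _]]]]]]; apply: h. Qed.

Lemma pair_retract : retract T1 T /\ retract T2 T.
Proof.
have [t1 t2 _] := pair_two_term.
by split; [apply: retract_dsum_l; [|case: t1|case: t2]|apply: retract_dsum_r; [|case: t1|case: t2]].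
Qed.

Lemma nohom_shift_retract X Y Y' : retract Y Y' -> nohom X (shift Y') -> nohom X (shift Y).
Proof. by move=> r /nohom_adj h; apply/nohom_adj; apply: nohom_retract_r r h. Qed.

Lemma pair_nohom X Y : retract X T -> retract Y T -> nohom X (shift Y).
Proof.
move=> rX rY; apply: nohom_shift_retract rY _; apply: nohom_retract_l rX _ => //.
exact: (pair_ext (n := 1)).
Qed.

Lemma pair_gen X : is_cpx X -> thick e1 e2 (fun Y => Y = T) X.
Proof. by case: sT => _ [_ [_ [_ [_ [_ [_ h]]]]]]; apply: h. Qed.

Lemma pair_add X : two_term X -> nohom X (shift T1) -> nohom X (shift T2) ->
  nohom T1 (shift X) -> nohom T2 (shift X) -> exists n, retract X (cpow T n).
Proof.
move=> tX h1 h2 h3 h4; have [t1 t2 tT] := pair_two_term.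
apply: retract_cpow => //; [by case: tT|by case: tX|by apply: pair_gen; case: tX|exact: pair_ext| |].
- by apply: two_term_nohom => //; apply: nohom_shift_dsum_r.
by apply: two_term_nohom => //; apply: nohom_dsum_l.
Qed.

Lemma pair_local X n : is_cpx X -> trivial_idem e1 e2 X -> ~ null e1 e2 X -> retract X (cpow T n) ->
  isoK X T1 \/ isoK X T2.
Proof.
move=> cX tX nX r; have [[c1 _] [c2 _] _] := pair_two_term.
case: (sT) => _ [_ [i1 [i2 _]]].
have [r'|r'] := retract_cpow_cases cpo cX c1 c2 tX nX r; [left|right];
  by apply: retract_isoK => //; apply: indecomposable_trivial_idem.
Qed.
End OnePair.

Lemma indecomposable_not_null X : indecomposable e1 e2 X -> ~ null e1 e2 X.
Proof. by move=> [cX [nX _]] /(null_isoK cX). Qed.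

(** In [theta_left] and [theta_right] the test object X may be any of the two U's, whether its
    weight is positive or 0. So an active V_i has no extensions with U1 and U2 in either direction;
    it lies in add U, and being local it is one of them. *)
Lemma noncrossing U1 U2 V1 V2 (a b c d : R) : silting_pair U1 U2 -> silting_pair V1 V2 ->
  0 <= a -> 0 <= b -> 0 <= c -> 0 <= d ->
  a *: gvec U1 + b *: gvec U2 = c *: gvec V1 + d *: gvec V2 ->
  (0 < c -> isoK V1 U1 \/ isoK V1 U2) /\ (0 < d -> isoK V2 U1 \/ isoK V2 U2).
Proof.
move=> sU sV a0 b0 c0 d0 e.
have [u1 u2 _] := pair_two_term sU; have [v1 v2 _] := pair_two_term sV.
have [rU1 rU2] := pair_retract sU; have [rV1 rV2] := pair_retract sV.
pose U x := if x then U1 else U2; pose V x := if x then V1 else V2.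
pose w x := if x then a else b; pose w' x := if x then c else d.
have tU x : two_term (U x) by case: x.
have tV x : two_term (V x) by case: x.
have w0 x : 0 <= w x by case: x.
have w0' x : 0 <= w' x by case: x.
have eqg : \sum_x w x *: gvec (U x) = \sum_x w' x *: gvec (V x) by rewrite !big_bool.
have nU i j : nohom (U i) (shift (U j)) by apply: (pair_nohom sU); [case: i|case: j].
have nV i j : nohom (V i) (shift (V j)) by apply: (pair_nohom sV); [case: i|case: j].
have left' i k : 0 < w' i -> nohom (V i) (shift (U k)).
  move=> wi; apply: (@theta_left _ _ _ _ R cpo V U w' w) => //.
have right' i k : 0 < w' i -> nohom (U k) (shift (V i)).
  by move=> wi; apply: (@theta_right _ _ _ _ R cpo U V w w').
have main i : 0 < w' i -> isoK (V i) U1 \/ isoK (V i) U2.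
  move=> wi; have [||||n r] := pair_add sU (tV i).
  - exact: (left' i true).
  - exact: (left' i false).
  - exact: (right' i true).
  - exact: (right' i false).
  have ind : indecomposable e1 e2 (V i) by case: (sV) => _ [_ [? [? _]]]; case: (i).
  apply: (pair_local sU) r; first by case: (tV i).
  - exact: indecomposable_trivial_idem.
  exact: indecomposable_not_null.
by split; [apply: (main true)|apply: (main false)].
Qed.

(** The weight [bad] counts summands outside degrees 0 and -1; it is 0 on X, hence on both
    pieces. *)
Lemma two_term_wt (X Y Z : cpx) : (forall (V : nmodType) (w : bool -> int -> V), wt w X = wt w Y + wt w Z) ->
  (forall i, cdeg X i = 0 \/ cdeg X i = -1) ->
  (forall i, cdeg Y i = 0 \/ cdeg Y i = -1) /\ (forall i, cdeg Z i = 0 \/ cdeg Z i = -1).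
Proof.
move=> h tX; pose bad (_ : bool) (d : int) : nat := (d != 0) && (d != -1).
have z : (wt bad X = 0)%N by rewrite /wt big1 // => i _; rewrite /bad; case: (tX i) => ->.
move: (h nat bad); rewrite z => /esym/eqP; rewrite addn_eq0 => /andP [zY zZ].
have aux C : wt bad C == 0%N -> forall i, cdeg C i = 0 \/ cdeg C i = -1.
  rewrite /wt => hC i; have := hC; rewrite (bigD1 i) //= addn_eq0 => /andP [+ _].
  rewrite eqb0 negb_and !negbK => /orP [/eqP ->|/eqP ->]; [by left|by right].
by split; apply: aux.
Qed.

Lemma csz_wt (X : cpx) : (wt (fun _ _ => 1%N) X = csz X)%N.
Proof. by rewrite /wt sum1_card card_ord. Qed.

Lemma gvec_zero : gvec (zero_cpx (A := A)) = 0.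
Proof. by rewrite /Defs.gvec big_ord0. Qed.

(** Induction on size: X is null, or local and then isomorphic to T1 or T2, or a strict idempotent
    splits it into two smaller retracts of the same power of T. *)
Lemma gvec_span T1 T2 X n : silting_pair T1 T2 -> two_term X -> retract X (cpow (dsum T1 T2) n) ->
  exists p q : int, gvec X = p%:~R *: gvec T1 + q%:~R *: gvec T2.
Proof.
move=> sT; have [N le] := ubnP (csz X); elim: N X le => // N IH X le tX r.
have [t1 t2 tT] := pair_two_term sT; have [cX _] := tX.
have [nX|nX] := pselect (null e1 e2 X).
  exists 0, 0; rewrite !scale0r addr0 -gvec_zero; apply: gvec_isoK => //; last exact/(null_isoK cX).
  by split; [apply: is_cpx_zero|case].
have [tr|ntr] := pselect (trivial_idem e1 e2 X).
  have [iso|iso] := pair_local sT cX tr nX r; rewrite (gvec_isoK _ _ iso) //.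
    by exists 1, 0; rewrite scale1r scale0r addr0.
  by exists 0, 1; rewrite scale1r scale0r add0r.
have [eps [ceps ee n0 n1]] : exists eps, [/\ chain_map X X eps, eps *m eps = eps,
    ~ homotopic X X eps 0 & ~ homotopic X X eps (idm X)].
  apply: contrapT => nex; apply: ntr => eps ceps ee; apply: contrapT => no; apply: nex.
  by exists eps; split=> // h; apply: no; [left|right].
have [D1 [D2 [F1 [G1 [F2 [G2 [[c1 c2 iso] [[f1 g1 f2 g2] [[k1 k2 k3 k4] hw]]]]]]]]] :=
  chain_idempotents_split cpo cX ceps ee.
have [tD1 tD2] := two_term_wt hw (proj2 tX).
have sz : (csz X = csz D1 + csz D2)%N by rewrite -!csz_wt; apply: hw.
have p1 : (0 < csz D1)%N.
  rewrite lt0n; apply/eqP => z; apply: n0; rewrite -k1.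
  suff -> : G1 *m F1 = 0 by apply: homotopic_refl.
  by apply/matrixP=> i j; rewrite !mxE big1 // => k; have := ltn_ord k; rewrite {2}z.
have p2 : (0 < csz D2)%N.
  rewrite lt0n; apply/eqP => z; apply: n1; rewrite -[eps](subKr (idm X)) -k3.
  suff -> : G2 *m F2 = 0 by rewrite subr0; apply: homotopic_refl.
  by apply/matrixP=> i j; rewrite !mxE big1 // => k; have := ltn_ord k; rewrite {2}z.
have r1 : retract D1 X by exists G1, F1; split=> //; split=> //; rewrite k2; apply: homotopic_refl.
have r2 : retract D2 X by exists G2, F2; split=> //; split=> //; rewrite k4; apply: homotopic_refl.
have lt1 : (csz D1 < N)%N by move: le p2; rewrite sz; lia.
have lt2 : (csz D2 < N)%N by move: le p1; rewrite sz; lia.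
have [a1 [b1 e1']] := IH D1 lt1 (conj c1 tD1) (retract_trans cpo r1 r).
have [a2 [b2 e2']] := IH D2 lt2 (conj c2 tD2) (retract_trans cpo r2 r).
exists (a1 + a2), (b1 + b2).
have -> : gvec X = gvec D1 + gvec D2 by exact: (hw _ (fun b d => (-1) ^ d *: vP R b)).
by rewrite e1' e2' !rmorphD /= !scalerDl addrACA.
Qed.

Lemma gvec_dsum (C D : cpx) : gvec (dsum C D) = gvec C + gvec D.
Proof. exact: (wt_gsum (fun b d => (-1) ^ d *: vP R b)). Qed.

Lemma gvec_cpow (C : cpx) n : gvec (cpow C n) = n%:R *: gvec C.
Proof.
elim: n => [|n IH]; first by rewrite gvec_zero scale0r.
by rewrite gvec_dsum IH -{1}[gvec C]scale1r -scalerDl nat1r.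
Qed.

Lemma gvec_stalk l d : d = 0 \/ d = -1 -> gvec (stalk l d : cpx) = (-1) ^ d *: vP R l.
Proof. by move=> _; rewrite /Defs.gvec big_ord1. Qed.

(** The cocone X of an approximation T^n -> P_l[1] fits in a triangle P_l -> X -> T^n. It has no
    extensions with T on either side, so it lies in add T, and [P_l] = [X] - n [T]. *)
Lemma silting_span T1 T2 l : silting_pair T1 T2 ->
  exists p q : int, vP R l = p%:~R *: gvec T1 + q%:~R *: gvec T2.
Proof.
move=> sT; have [t1 t2 tT] := pair_two_term sT; pose T := dsum T1 T2; have cT : is_cpx T by case: tT.
pose P : cpx := stalk l 0; have tP : two_term P by apply: two_term_stalk; left.
have [n [F [cF fac]]] := approximation cpo (shift P) cT.
have cTn := is_cpx_cpow n cT.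
have tTn : forall i, cdeg (cpow T n) i = 0 \/ cdeg (cpow T n) i = -1.
  elim: (n) => [|m IH]; first by case.
  by move=> i /=; rewrite /sumdeg; case: split => k; [apply: (proj2 tT)|apply: IH].
pose X := unshift (cone (cpow T n) (shift P) F).
have cX : is_cpx X.
  by apply: is_cpx_unshift; apply: is_cpx_cone => //; apply: is_cpx_shift; case: tP.
have tX : two_term X.
  split=> // i /=; rewrite /sumdeg; case: split => k; rewrite ?subrK //.
  by left.
have TT := pair_ext sT.
have nTX : nohom T (shift X).
  apply/nohom_unshiftK; apply: nohom_cone_approx fac _ => //.
  exact: (@nohom_shiftn_cpow _ _ _ T T 1 n (TT 1%N isT)).
have nXT : nohom X (shift T).
  apply: (proj1 (@nohom_adj _ e1 e2 (cone (cpow T n) (shift P) F) (shift T))).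
  apply: nohom_cone_l => //.
    by apply/nohom_shift2/nohom_cpow_l; apply: (TT 1%N).
  apply/nohom_shift2/nohom_degrees => i j; rewrite [cdeg (shift T) i]/(cdeg (dsum T1 T2) i - 1).
  by case: (proj2 tT i) => ->.
have [||||m r] := pair_add sT tX.
- by apply: nohom_shift_retract nXT; case: (pair_retract sT).
- by apply: nohom_shift_retract nXT; case: (pair_retract sT).
- by apply: nohom_retract_l nTX => //; case: (pair_retract sT).
- by apply: nohom_retract_l nTX => //; case: (pair_retract sT).
have [p [q e]] := gvec_span sT tX r.
have : gvec X = n%:R *: (gvec T1 + gvec T2) + vP R l.
  rewrite -gvec_dsum -gvec_cpow; pose f b (d : int) := (-1) ^ d *: vP R b.
  rewrite [gvec X](_ : _ = wt f (cpow T n) + wt f P).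
    congr (_ + _); rewrite /wt big_ord1 /f /= expr0z scale1r //.
  rewrite -(@wt_gsum A _ f (cpow T n) P 0) /Defs.gvec /wt; apply: eq_bigr => i _ /=.
  by rewrite /sumdeg; case: split => k; rewrite /= ?subrK.
rewrite e => e'; exists (p - n%:Z), (q - n%:Z).
have -> : vP R l = p%:~R *: gvec T1 + q%:~R *: gvec T2 - n%:R *: (gvec T1 + gvec T2).
  by rewrite e' addrC addKr.
by rewrite !rmorphB /= !scalerBl scalerDr opprD addrACA.
Qed.

Lemma gvec_int (X : cpx) : two_term X -> exists a b : int, gvec X = a%:~R *: vP1 R + b%:~R *: vP2 R.
Proof.
move=> [_ tX]; rewrite /Defs.gvec.
apply: (big_ind (fun v => exists a b : int, v = a%:~R *: vP1 R + b%:~R *: vP2 R)).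
- by exists 0, 0; rewrite !scale0r addr0.
- move=> u v [a [b ->]] [c [d ->]]; exists (a + c), (b + d).
  by rewrite !rmorphD /= !scalerDl addrACA.
move=> i _; have [s ->] : exists s : int, (-1) ^ cdeg X i = s%:~R :> R.
  case: (tX i) => ->; first by exists 1.
  by exists (-1); rewrite exprN1 invrN1 rmorphN1.
by case: (clab X i); [exists 0, s|exists s, 0]; rewrite scale0r ?add0r ?addr0.
Qed.

Lemma vP_coord (a b : R) : (a *: vP1 R + b *: vP2 R) 0 0 = a /\ (a *: vP1 R + b *: vP2 R) 0 1 = b.
Proof. by rewrite !mxE /= !mulr0 !mulr1 addr0 add0r. Qed.

Lemma vP_inj (a b c d : R) : a *: vP1 R + b *: vP2 R = c *: vP1 R + d *: vP2 R -> a = c /\ b = d.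
Proof.
move=> e; have [h1 h2] := vP_coord a b; have [h3 h4] := vP_coord c d.
by split; [rewrite -h1 e h3|rewrite -h2 e h4].
Qed.

Lemma vP_comb (p q a b c d : R) :
  p *: (a *: vP1 R + b *: vP2 R) + q *: (c *: vP1 R + d *: vP2 R) =
  (p * a + q * c) *: vP1 R + (p * b + q * d) *: vP2 R.
Proof. by rewrite !scalerDr !scalerA addrACA -!scalerDl. Qed.

(** Both basis vectors are integral combinations of the two g-vectors, so the determinant divides
    1. *)
Lemma silting_unimodular T1 T2 : silting_pair T1 T2 -> exists a b c d : int,
  [/\ gvec T1 = a%:~R *: vP1 R + b%:~R *: vP2 R, gvec T2 = c%:~R *: vP1 R + d%:~R *: vP2 R &
      a * d - b * c = 1 \/ a * d - b * c = -1].
Proof.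
move=> sT; have [t1 t2 _] := pair_two_term sT.
have [a [b e1']] := gvec_int t1; have [c [d e2']] := gvec_int t2.
exists a, b, c, d; split=> //.
have [p [q]] := silting_span false sT; have [p' [q']] := silting_span true sT.
rewrite e1' e2' !vP_comb -!rmorphM -!rmorphD /= => h2 h1.
have [h11 h12] : (1 = (p * a + q * c)%:~R :> R) /\ (0 = (p * b + q * d)%:~R :> R).
  by apply: vP_inj; rewrite -h1 scale1r scale0r addr0.
have [h21 h22] : (0 = (p' * a + q' * c)%:~R :> R) /\ (1 = (p' * b + q' * d)%:~R :> R).
  by apply: vP_inj; rewrite -h2 scale1r scale0r add0r.
move: h11 h12 h21 h22 => /eqP + /eqP + /eqP + /eqP.
rewrite -[1]/(1%:~R) -[0]/(0%:~R) !eqr_int => /eqP h11 /eqP h12 /eqP h21 /eqP h22.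
have e : (a * d - b * c) * (p * q' - q * p') = 1.
  transitivity ((p * a + q * c) * (p' * b + q' * d) - (p * b + q * d) * (p' * a + q' * c)); first by ring.
  by rewrite -h11 -h12 -h21 -h22; ring.
have := congr1 absz e; rewrite abszM => /eqP; rewrite muln_eq1 => /andP [/eqP h _].
by move: h; lia.
Qed.
End Pairs.

(** * Rotation of triangles and generation *)

Section Generation.
Variables (K : fieldType) (A : falgType K) (e1 e2 : A).
Hypotheses (cpo : complete_prim_orth e1 e2).
Local Notation cpx := (cpx A).
Local Notation eid := (eid e1 e2).
Local Notation homd := (homd e1 e2).
Local Notation is_cpx := (is_cpx e1 e2).
Local Notation chain_map := (chain_map e1 e2).
Local Notation idm := (idm e1 e2).
Local Notation isoK := (isoK e1 e2).
Local Notation thick := (thick e1 e2).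

Lemma reindex_isoK (C D : cpx) (s : 'I_(csz C) -> 'I_(csz D)) : is_cpx C -> bijective s ->
  (forall i, clab D (s i) = clab C i) -> (forall i, cdeg D (s i) = cdeg C i) ->
  (forall i j, cd D (s i) (s j) = cd C i j) -> isoK C D.
Proof.
move=> [hC _] [t st ts] hl hd hc.
pose F : 'M[A]_(csz D, csz C) := \matrix_(i, j) (if i == s j then eid (clab D i) else 0).
pose G : 'M[A]_(csz C, csz D) := \matrix_(i, j) (if s i == j then eid (clab D j) else 0).
have hF : homd C D 0 F.
  move=> i j; rewrite mxE; case: eqP => [->|_]; last by rewrite mulr0 mul0r.
  by rewrite hl hd addr0 !eidK.
have hG : homd D C 0 G.
  move=> i j; rewrite mxE; case: eqP => [<-|_]; last by rewrite mulr0 mul0r.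
  by rewrite hl hd addr0 !eidK.
have FE n (M : 'M_(csz C, n)) i j : (F *m M) i j = eid (clab D i) * M (t i) j.
  rewrite mxE (bigD1 (t i)) //= big1 ?addr0; first by rewrite mxE ts eqxx.
  by move=> k nk; rewrite mxE; case: eqP => [e|_]; [move: nk; rewrite e st eqxx|rewrite mul0r].
have FE' n (M : 'M_(n, csz D)) i j : (M *m F) i j = M i (s j) * eid (clab D (s j)).
  rewrite mxE (bigD1 (s j)) //= big1 ?addr0; first by rewrite mxE eqxx.
  by move=> k /negPf nk; rewrite mxE nk mulr0.
have GE n (M : 'M_(csz D, n)) i j : (G *m M) i j = eid (clab C i) * M (s i) j.
  rewrite mxE (bigD1 (s i)) //= big1 ?addr0; first by rewrite mxE eqxx hl.
  by move=> k /negPf nk; rewrite mxE eq_sym nk mul0r.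
have GE' n (M : 'M_(n, csz C)) i j : (M *m G) i j = M i (t j) * eid (clab D j).
  rewrite mxE (bigD1 (t j)) //= big1 ?addr0; first by rewrite mxE ts eqxx.
  by move=> k nk; rewrite mxE; case: eqP => [e|_]; [move: nk; rewrite -e st eqxx|rewrite mulr0].
have hlt i : clab C (t i) = clab D i by rewrite -hl ts.
have GF : G *m F = idm C.
  apply/matrixP=> i j; rewrite GE !mxE; case: eqP => [/(can_inj st) ->|n].
    by rewrite eqxx hl eidK.
  by rewrite mulr0; case: eqP => // e; case: n; rewrite e.
have FG : F *m G = idm D.
  apply/matrixP=> i j; rewrite FE !mxE ts; case: eqP => [->|n]; first by rewrite eidK.
  by rewrite mulr0.
exists F, G; split; first split=> //.
  apply/matrixP=> i j; rewrite FE FE' (_ : cd D i (s j) = cd C (t i) j); last by rewrite -hc ts.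
  by rewrite hl (homd_eidr cpo hC) -hlt (homd_eidl cpo hC).
split; first split=> //.
  apply/matrixP=> i j; rewrite GE GE' (_ : cd D (s i) j = cd C i (t j)); last by rewrite -hc ts.
  by rewrite (homd_eidl cpo hC) -hlt (homd_eidr cpo hC).
by rewrite GF FG; split; apply: homotopic_refl.
Qed.

Lemma cpx_eq n (l l' : 'I_n -> bool) (d d' : 'I_n -> int) (M M' : 'M[A]_n) :
  l =1 l' -> d =1 d' -> M = M' -> Cpx n l d M = Cpx n l' d' M'.
Proof. by move=> /funext -> /funext -> ->. Qed.

Lemma unshiftK (X : cpx) : unshift (shift X) = X.
Proof. by case: X => n l d M; apply: cpx_eq => //= [i|]; rewrite ?subrK ?opprK. Qed.

Lemma thick_shift_inv S X : thick S (shift X) -> thick S X.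
Proof. by move=> h; rewrite -[X]unshiftK; apply: thick_unshift. Qed.

Section Rotate.
Variables (C D : cpx) (F : 'M[A]_(csz D, csz C)).
Hypotheses (cC : is_cpx C) (cD : is_cpx D) (cF : chain_map C D F).
Let iC := chain_map_idm cpo cC.
Let iD := chain_map_idm cpo cD.

Lemma cone_incl_chain : chain_map D (cone C D F) (col_mx 0 (idm D)).
Proof.
apply/cone_col_chain; split; first exact: chain_map0.
by rewrite mulmx0 add0r; case: iD.
Qed.

Lemma cone_proj_chain : chain_map (cone C D F) (shift C) (row_mx (idm C) 0).
Proof.
split.
  apply/(@homd_row _ _ _ (shift C) D); split; last exact: homd0.
  by apply/homd_shift_l/homd_shift_r; rewrite subrK; case: iC.
rewrite /= mul_mx_row mul_row_block !mulmx0 !mul0mx !addr0; congr row_mx.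
by rewrite mulNmx mulmxN; case: iC => _ ->.
Qed.

(** Rotation of the triangle: C[1] is homotopy equivalent to the cone of the inclusion of D into the
    cone of [F]. *)
Lemma thick_cone_source S : thick S D -> thick S (cone C D F) -> thick S C.
Proof.
have [hF dF] := cF; have [hD _] := cD; have [hC _] := cC.
move=> tD tK; apply: thick_shift_inv.
set I : 'M[A]_(csz C + csz D, csz D) := col_mx 0 (idm D).
have tI : thick S (cone D (cone C D F) I) by apply: thick_cone => //; apply: cone_incl_chain.
apply: thick_iso tI (is_cpx_shift cC) _.
pose M : 'M[A]_(csz C, csz C + csz D) := row_mx (idm C) 0.
pose M' : 'M[A]_(csz C + csz D, csz C) := col_mx (idm C) 0.
pose P : 'M[A]_(csz C, csz D + (csz C + csz D)) := row_mx 0 M.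
pose Q : 'M[A]_(csz D + (csz C + csz D), csz C) := col_mx (- F) M'.
have cI : cd (cone D (cone C D F) I) = block_mx (- cd D) 0 I (cd (cone C D F)) by [].
have hi := @homd_idm _ _ _ cpo.
have hP : homd (cone D (cone C D F) I) (shift C) 0 P.
  apply/(@homd_row _ _ _ (shift D) (cone C D F)); split; first exact: homd0.
  apply/(@homd_row _ _ _ (shift C) D); split; last exact: homd0.
  by apply/homd_shift_l/homd_shift_r; rewrite subrK; apply: hi.
have hQ : homd (shift C) (cone D (cone C D F) I) 0 Q.
  apply/(@homd_col _ _ _ (shift D) (cone C D F)); split.
    by apply/homd_shift_l/homd_shift_r; rewrite subrK; apply: homdN.
  apply/(@homd_col _ _ _ (shift C) D); split; last exact: homd0.
  by apply/homd_shift_l/homd_shift_r; rewrite subrK; apply: hi.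
exists P, Q; split; first split=> //.
  have MK : M *m cd (cone C D F) = row_mx (- cd C) 0.
    by rewrite /= mul_row_block !mulmx0 !mul0mx !addr0 mulmxN (idmMl cpo hC).
  have MI : M *m I = 0 by rewrite mul_row_col mulmx0 mul0mx addr0.
  rewrite cI mul_row_block !mul0mx !add0r MK MI mul_mx_row mulmx0 /= mul_mx_row mulmx0.
  by rewrite mulNmx (idmMr cpo hC).
split; first split=> //.
  have KM : cd (cone C D F) *m M' = col_mx (- cd C) F.
    by rewrite /= mul_block_col !mulmx0 !addr0 mulNmx (idmMr cpo hC) (idmMr cpo hF).
  have IF : I *m - F = col_mx 0 (- F) by rewrite mul_col_mx mul0mx (idmMl cpo (homdN hF)).
  rewrite cI mul_block_col mul0mx addr0 KM IF add_col_mx add0r addNr /= /Q !mul_col_mx mul0mx.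
  by rewrite !mulmxN !mulNmx !opprK dF (idmMl cpo hC).
split; last first.
  rewrite /P /Q mul_row_col mul0mx add0r mul_row_col mul0mx addr0 idmK //.
  exact: homotopic_refl.
apply: homotopic_sym.
pose N : 'M[A]_(csz D, csz C + csz D) := row_mx 0 (idm D).
pose H : 'M[A]_(csz D + (csz C + csz D)) := block_mx 0 N 0 0.
have iK : idm (cone C D F) = block_mx (idm C) 0 0 (idm D) by apply: idm_dsum.
have iKK : idm (cone D (cone C D F) I) = block_mx (idm D) 0 0 (idm (cone C D F)) by apply: idm_dsum.
exists H; split.
  apply: (@homd_block _ _ _ (shift D) (cone C D F) _ (shift D) (cone C D F)); try exact: homd0.
  apply/(@homd_row _ _ _ (shift C) D); split; first exact: homd0.
  by apply/homd_shift_r; rewrite addNr; apply: hi.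
have NI : N *m I = idm D by rewrite mul_row_col mul0mx add0r idmK.
have NK : N *m cd (cone C D F) = row_mx F (cd D).
  by rewrite /= mul_row_block !mul0mx !add0r (idmMl cpo hF) (idmMl cpo hD).
have IN : I *m N = block_mx 0 0 0 (idm D).
  by rewrite mul_col_row !mulmx0 !mul0mx idmK.
have dN : - cd D *m N = row_mx 0 (- cd D).
  by rewrite mul_mx_row mulmx0 mulNmx (idmMr cpo hD).
have QP : Q *m P = block_mx 0 (row_mx (- F) 0) 0 (block_mx (idm C) 0 0 0).
  rewrite mul_col_row !mulmx0 mul_mx_row mulNmx (idmMr cpo hF) mulmx0 mul_col_row.
  by rewrite !mulmx0 !mul0mx idmK.
have -> : H *m cd (cone D (cone C D F) I) = block_mx (idm D) (row_mx F (cd D)) 0 0.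
  by rewrite cI mulmx_block !mul0mx !add0r NI NK ?addr0.
have -> : cd (cone D (cone C D F) I) *m H = block_mx 0 (row_mx 0 (- cd D)) 0 (block_mx 0 0 0 (idm D)).
  rewrite cI mulmx_block !(mulmx0, mul0mx, addr0, add0r).
  by rewrite dN IN.
rewrite iKK QP iK opp_block_mx !add_block_mx opp_row_mx opp_block_mx !oppr0 !addr0 opprK add_row_mx.
by rewrite addr0 subrr !add0r add_block_mx subrr !addr0.
Qed.

(** The other rotation: D[1] is homotopy equivalent to the cone of the projection from the cone of
    [F] to C[1]. *)
Lemma thick_cone_target S : thick S C -> thick S (cone C D F) -> thick S D.
Proof.
have [hF dF] := cF; have [hD _] := cD; have [hC _] := cC.
move=> tC tK; apply: thick_shift_inv.
set J : 'M[A]_(csz C, csz C + csz D) := row_mx (idm C) 0.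
have tJ : thick S (cone (cone C D F) (shift C) J).
  by apply: thick_cone => //; [apply: thick_shift|apply: cone_proj_chain].
apply: thick_iso tJ (is_cpx_shift cD) _.
pose P : 'M[A]_(csz D, csz C + csz D + csz C) := row_mx (row_mx 0 (idm D)) F.
pose Q : 'M[A]_(csz C + csz D + csz C, csz D) := col_mx (col_mx 0 (idm D)) 0.
have hi := @homd_idm _ _ _ cpo.
have hs X Y M : homd X Y 0 M -> homd (shift X) (shift Y) 0 M.
  by move=> h; apply/homd_shift_l/homd_shift_r; rewrite subrK.
have hP : homd (cone (cone C D F) (shift C) J) (shift D) 0 P.
  apply/(@homd_row _ _ _ (shift (cone C D F)) (shift C)); split; last exact: hs.
  by apply: hs; apply/(@homd_row _ _ _ (shift C) D); split; [apply: homd0|apply: hi].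
have hQ : homd (shift D) (cone (cone C D F) (shift C) J) 0 Q.
  apply/(@homd_col _ _ _ (shift (cone C D F)) (shift C)); split; last exact: homd0.
  by apply: hs; apply/(@homd_col _ _ _ (shift C) D); split; [apply: homd0|apply: hi].
have cJ : cd (cone (cone C D F) (shift C) J) = block_mx (- cd (cone C D F)) 0 J (- cd C) by [].
pose N : 'M[A]_(csz D, csz C + csz D) := row_mx 0 (idm D).
pose N' : 'M[A]_(csz C + csz D, csz D) := col_mx 0 (idm D).
have NK : N *m cd (cone C D F) = row_mx F (cd D).
  by rewrite /= mul_row_block !mul0mx !add0r (idmMl cpo hF) (idmMl cpo hD).
have FJ : F *m J = row_mx F 0 by rewrite mul_mx_row mulmx0 (idmMr cpo hF).
have KN : cd (cone C D F) *m N' = col_mx 0 (cd D).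
  by rewrite /= mul_block_col !mulmx0 !mul0mx !add0r (idmMr cpo hD).
have JN : J *m N' = 0 by rewrite mul_row_col mulmx0 mul0mx addr0.
exists P, Q; split; first split=> //.
  rewrite cJ mul_row_block mulmxN NK FJ mulmx0 add0r /= /P mul_mx_row mul_mx_row mulmx0.
  by rewrite opp_row_mx add_row_mx addNr addr0 mulNmx (idmMr cpo hD) mulNmx mulmxN dF.
split; first split=> //.
  rewrite cJ mul_block_col mulNmx KN JN mulmx0 !addr0 /= /Q mul_col_mx mul_col_mx !mul0mx.
  by rewrite mulmxN (idmMl cpo hD) opp_col_mx oppr0 mulmx0 addr0.
split; last first.
  rewrite /P /Q mul_row_col mulmx0 addr0 mul_row_col mulmx0 add0r idmK //.
  exact: homotopic_refl.
apply: homotopic_sym.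
pose B : 'M[A]_(csz C + csz D, csz C) := col_mx (idm C) 0.
pose H : 'M[A]_(csz C + csz D + csz C) := block_mx 0 B 0 0.
have iK : idm (cone C D F) = block_mx (idm C) 0 0 (idm D) by apply: idm_dsum.
have iKK : idm (cone (cone C D F) (shift C) J) = block_mx (idm (cone C D F)) 0 0 (idm C) by apply: idm_dsum.
exists H; split.
  apply: (@homd_block _ _ _ (shift (cone C D F)) (shift C) _ (shift (cone C D F)) (shift C)); try exact: homd0.
  apply/homd_shift_r; rewrite addNr.
  by apply/(@homd_col _ _ _ (shift C) D); split; [apply: hs; apply: hi|apply: homd0].
have BJ : B *m J = block_mx (idm C) 0 0 0 by rewrite mul_col_row !mulmx0 !mul0mx idmK.
have JB : J *m B = idm C by rewrite mul_row_col mulmx0 addr0 idmK.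
have KB : cd (cone C D F) *m B = col_mx (- cd C) F.
  by rewrite /= mul_block_col !mulmx0 !addr0 mulNmx (idmMr cpo hC) (idmMr cpo hF).
have Bd : B *m - cd C = col_mx (- cd C) 0.
  by rewrite mul_col_mx mul0mx mulmxN (idmMl cpo hC).
have QP : Q *m P = block_mx (block_mx 0 0 0 (idm D)) (col_mx 0 F) 0 0.
  rewrite mul_col_row mul0mx mul_col_row !mulmx0 !mul0mx idmK // mul_col_mx mul0mx (idmMl cpo hF).
  by [].
rewrite cJ !mulmx_block !(mul0mx, mulmx0, addr0, add0r) BJ JB mulNmx KB Bd.
rewrite iKK QP iK opp_block_mx !add_block_mx !oppr0 !addr0 !add0r opp_block_mx opp_col_mx oppr0 add_block_mx.
by rewrite !subr0 subrr opp_col_mx add_col_mx subrr sub0r addr0.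
Qed.
End Rotate.

Lemma thick_stalk S l d : thick S (stalk l 0) -> thick S (stalk l d).
Proof.
have sh d' : shift (stalk l d' : cpx) = stalk l (d' - 1) by apply: cpx_eq => //=; rewrite oppr0.
have ush d' : unshift (stalk l d' : cpx) = stalk l (d' + 1) by apply: cpx_eq => //=; rewrite oppr0.
move=> h; case: d => n.
  by elim: n => // n IH; rewrite -addn1 PoszD -ush; apply: thick_unshift.
elim: n => [|n IH]; first by have := thick_shift _ _ _ _ h; rewrite sh.
by have := thick_shift _ _ _ _ IH; rewrite sh; congr (thick S (stalk l _)); lia.
Qed.

(** The differential raises degrees, so a summand of maximal degree is a subcomplex, and the complex
    is the cone of a map to this stalk from the other summands, shifted back. *)
Lemma thick_all S : thick S (stalk false 0) -> thick S (stalk true 0) ->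
  forall X, is_cpx X -> thick S X.
Proof.
move=> tf tt.
have ts l d : thick S (stalk l d) by apply: thick_stalk; case: l.
have cs l d : is_cpx (stalk l d) by split; [apply: homd0|rewrite mulmx0].
move=> [n lab deg M]; elim: n lab deg M => [|n IH] lab deg M cX.
  (* The empty complex is reached as a direct summand of a stalk. *)
  apply: (thick_summand _ _ _ _ _ (ts false 0)) => //; exists (stalk false 0); split=> //.
  apply: (@reindex_isoK (dsum (Cpx 0 lab deg M) (stalk false 0)) (stalk false 0) (fun i => i)) => //.
  - exact: is_cpx_dsum.
  - by exists id.
  - by move=> i; rewrite /= /sumlab; case: splitP => [[]|].
  - by move=> i; rewrite /= /sumdeg; case: splitP => [[]|].
  by move=> i j; rewrite /= !mxE; case: splitP => [[]//|k _]; rewrite !mxE; case: splitP => [[]//|k' _]; rewrite !mxE.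
pose i := [arg max_(i > ord0) deg i]%O.
have im j : deg j <= deg i by rewrite /i; case: Order.TotalTheory.arg_maxP => // k _ /(_ j isT).
have [hX dd] := cX; rewrite /= in dd.
pose X' := Cpx n (lab \o lift i) (deg \o lift i) (\matrix_(a, b) M (lift i a) (lift i b)).
pose P : cpx := stalk (lab i) (deg i).
pose F : 'M[A]_(1, n) := \matrix_(a, b) M i (lift i b).
have zc j : M j i = 0.
  apply/eqP; apply: contraT => /eqP/(proj2 (hX j i)) /= e; have := im j; rewrite e; lia.
have cX' : is_cpx X'.
  split; first by move=> a b; rewrite mxE; apply: (hX (lift i a) (lift i b)).
  apply/matrixP=> a b; have /matrixP/(_ (lift i a) (lift i b)) := dd.
  rewrite !mxE (bigD1_ord i) //= zc mul0r add0r => e; rewrite -[RHS]e; apply: eq_bigr => k _.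
  by rewrite !mxE.
have cF : chain_map (unshift X') P F.
  split.
    apply/homd_unshift_l => a b; rewrite mxE; have := hX i (lift i b).
    by rewrite /= add0r.
  apply/matrixP=> a b; rewrite /= mul0mx mulmxN !mxE.
  have /matrixP/(_ i (lift i b)) := dd; rewrite !mxE (bigD1_ord i) //= zc mul0r add0r => e.
  apply/esym/eqP; rewrite oppr_eq0 -[X in _ == X]e; apply/eqP/eq_bigr => k _.
  by rewrite !mxE.
have tK : thick S (cone (unshift X') P F).
  by apply: thick_cone => //; [apply: thick_unshift; apply: IH|apply: ts].
apply: thick_iso tK cX _.
pose s (k : 'I_(n + 1)) : 'I_n.+1 := match split k with inl a => lift i a | inr _ => i end.
pose t (j : 'I_n.+1) : 'I_(n + 1) := if unlift i j is Some a then lshift 1 a else rshift n 0.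
have sl a : s (lshift 1 a) = lift i a by rewrite /s (unsplitK (inl a)).
have sr a : s (rshift n a) = i by rewrite /s (unsplitK (inr a)).
apply: (@reindex_isoK (cone (unshift X') P F) (Cpx n.+1 lab deg M) s).
- by apply: is_cpx_cone => //; [apply: is_cpx_unshift|apply: cs].
- exists t => [k|j].
    rewrite -[k]splitK /s; case: (split k) => a /=; rewrite ?(unsplitK (inl a)) ?(unsplitK (inr a)) /t.
      by rewrite liftK.
    by rewrite unlift_none ord1.
  by rewrite /t; case: unliftP => [a ->|->]; rewrite ?sl ?sr.
- by move=> k; rewrite /= /sumlab -[k]splitK; case: (split k) => a /=;
    rewrite ?sl ?sr ?(unsplitK (inl a)) ?(unsplitK (inr a)).
- by move=> k; rewrite /= /sumdeg -[k]splitK; case: (split k) => a /=;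
    rewrite ?sl ?sr ?(unsplitK (inl a)) ?(unsplitK (inr a)) ?addrK.
move=> j k; rewrite -[j]splitK -[k]splitK; case: (split j) (split k) => a [b|b] /=;
  rewrite ?sl ?sr ?block_mxEul ?block_mxEur ?block_mxEdl ?block_mxEdr ?opprK !mxE ?zc //.
Qed.

Definition pw l n : cpx := Cpx n (fun _ => l) (fun _ => 0) 0.

Lemma is_cpx_pw l n : is_cpx (pw l n).
Proof. by split; [apply: homd0|rewrite mulmx0]. Qed.

Lemma thick_dsum S X Y : thick S X -> thick S Y -> thick S (dsum X Y).
Proof.
move=> tX tY.
have -> : dsum X Y = cone (unshift X) Y 0.
  apply: cpx_eq => //=; last by rewrite opprK.
  by move=> i; rewrite /sumdeg; case: split => // k; rewrite addrK.
by apply: thick_cone => //; [apply: thick_unshift|apply: chain_map0].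
Qed.

Lemma thick_summand_l S X Y : is_cpx X -> is_cpx Y -> thick S (dsum X Y) -> thick S X.
Proof.
move=> cX cY h; apply: thick_summand (h) (cX) _; exists Y; split=> //.
exact: (isoK_refl cpo (is_cpx_dsum cX cY)).
Qed.

Lemma dsum_swap X Y : is_cpx X -> is_cpx Y -> isoK (dsum X Y) (dsum Y X).
Proof.
move=> cX cY.
have sw C D : is_cpx C -> is_cpx D ->
    chain_map (dsum C D) (dsum D C) (block_mx 0 (idm D) (idm C) 0).
  move=> cC cD; have iC := chain_map_idm cpo cC; have iD := chain_map_idm cpo cD.
  by apply/chain_map_col; split; apply/chain_map_row; split=> //; apply: chain_map0.
exists (block_mx 0 (idm Y) (idm X) 0), (block_mx 0 (idm X) (idm Y) 0).
split; first exact: sw; split; first exact: sw.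
rewrite !mulmx_block !mulmx0 !mul0mx !addr0 !add0r !idmK // -!idm_dsum.
by split; apply: homotopic_refl.
Qed.

Lemma thick_summand_r S X Y : is_cpx X -> is_cpx Y -> thick S (dsum X Y) -> thick S Y.
Proof.
move=> cX cY h; apply: (@thick_summand_l S Y X) => //; apply: thick_iso h _ _.
  exact: is_cpx_dsum.
exact: dsum_swap.
Qed.

Lemma thick_pw0 S l l' : thick S (stalk l 0) -> thick S (pw l' 0).
Proof.
move=> h; apply: (@thick_summand_l S _ (stalk l 0)); [exact: is_cpx_pw|exact: (is_cpx_pw l 1)|].
have -> // : dsum (pw l' 0) (stalk l 0) = stalk l 0.
apply: cpx_eq => [i|i|]; rewrite /sumlab /sumdeg; try by case: splitP => [[]|].
by apply/matrixP=> i j; rewrite !mxE; case: splitP => [[]//|k _]; rewrite !mxE;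
  case: splitP => [[]//|k' _]; rewrite !mxE.
Qed.

Lemma thick_pw S l n : thick S (stalk l 0) -> thick S (pw l n).
Proof.
move=> h; elim: n => [|n IH]; first exact: thick_pw0 h.
have -> : pw l n.+1 = dsum (stalk l 0) (pw l n); last exact: thick_dsum.
apply: cpx_eq => [i|i|]; rewrite /sumlab /sumdeg; try by case: split.
by apply/matrixP=> i j; rewrite !mxE; case: split => a; rewrite !mxE; case: split => b; rewrite !mxE.
Qed.
End Generation.

(** * Two-term complexes concentrated in one quadrant *)

Section Explicit.
Variables (K : fieldType) (A : falgType K) (e1 e2 : A) (R : realType).
Hypotheses (cpo : complete_prim_orth e1 e2) (bas : basic2 e1 e2).
Local Notation eid := (eid e1 e2).
Local Notation homd := (homd e1 e2).
Local Notation is_cpx := (is_cpx e1 e2).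
Local Notation chain_map := (chain_map e1 e2).
Local Notation idm := (idm e1 e2).
Local Notation nohom := (nohom e1 e2).
Local Notation retract := (retract e1 e2).
Local Notation two_term := (two_term e1 e2).
Local Notation thick := (thick e1 e2).
Local Notation silting_pair := (basic_two_silting e1 e2).
Local Notation trivial_idem := (trivial_idem e1 e2).
Local Notation indecomposable := (indecomposable e1 e2).
Local Notation gvec := (gvec R).
Local Notation pw := (@pw K A).

Definition mxin l l' p q (M : 'M[A]_(p, q)) := forall i j, M i j = eid l * M i j * eid l'.

Lemma homd_pw0 l l' p q (M : 'M[A]_(p, q)) : homd (pw l' q) (pw l p) 0 M <-> mxin l l' M.
Proof. by split=> h i j; [case: (h i j)|split; [apply: h|]]. Qed.

Lemma homd_pwN l l' p q s (M : 'M[A]_(p, q)) : s != 0 -> homd (pw l' q) (pw l p) s M -> M = 0.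
Proof.
move=> /eqP s0 h; apply/matrixP=> i j; rewrite mxE; apply/eqP; apply: contraT => /eqP.
by move/(proj2 (h i j)) => /= e; case: s0; rewrite e add0r.
Qed.

(* The two-term complex P_l'^q -> P_l^p given by [f], with l' = ~~ l. *)
Definition tt l p q (f : 'M[A]_(p, q)) := cone (pw (~~ l) q) (pw l p) f.
Arguments tt l {p q} f.

Lemma tt_chain l p q (f : 'M[A]_(p, q)) : mxin l (~~ l) f -> chain_map (pw (~~ l) q) (pw l p) f.
Proof. by move=> hf; split; [apply/homd_pw0|rewrite mul0mx mulmx0]. Qed.

Lemma two_term_tt l p q (f : 'M[A]_(p, q)) : mxin l (~~ l) f -> two_term (tt l f).
Proof.
move=> hf; split; first by apply: is_cpx_cone; [apply: is_cpx_pw|apply: is_cpx_pw|apply: tt_chain].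
by move=> i; rewrite /= /sumdeg; case: split => k; [right|left].
Qed.

Lemma gvec_tt l p q (f : 'M[A]_(p, q)) : gvec (tt l f) = p%:R *: vP R l - q%:R *: vP R (~~ l).
Proof.
rewrite [LHS](@wt_gsum A _ (fun b d => (-1) ^ d *: vP R b) (shift (pw (~~ l) q)) (pw l p)) /wt /=.
rewrite !sumr_const !card_ord sub0r exprN1 invrN1 expr0z scale1r scaleN1r.
by rewrite -!scaler_nat scalerN addrC.
Qed.

(** For reasons of degree a map to the shift has one nonzero block, from degree -1 of [tt l f] to
    degree 0 of [tt l g], and a homotopy is a pair of diagonal blocks. *)
Lemma nohom_ttP l p q p' q' (f : 'M[A]_(p, q)) (g : 'M[A]_(p', q')) : mxin l (~~ l) f -> mxin l (~~ l) g ->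
  nohom (tt l f) (shift (tt l g)) <->
  (forall M : 'M[A]_(p', q), mxin l (~~ l) M -> exists H0 H1,
     [/\ mxin l l H0, mxin (~~ l) (~~ l) H1 & M = H0 *m f + g *m H1]).
Proof.
move=> hf hg.
have blk (M : 'M[A]_(q' + p', q + p)) : M = block_mx (ulsubmx M) (ursubmx M) (dlsubmx M) (drsubmx M).
  by rewrite submxK.
have ccf : cd (tt l f) = block_mx 0 0 f 0 by rewrite /= oppr0.
have ccg : cd (shift (tt l g)) = block_mx 0 0 (- g) 0 by rewrite /= opp_block_mx !oppr0.
have hb s (M : 'M[A]_(q' + p', q + p)) : homd (tt l f) (shift (tt l g)) s M <->
   [/\ homd (pw (~~ l) q) (pw (~~ l) q') (s + 1) (ulsubmx M), homd (pw l p) (pw (~~ l) q') (s + 1 + 1) (ursubmx M),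
       homd (pw (~~ l) q) (pw l p') s (dlsubmx M) & homd (pw l p) (pw l p') (s + 1) (drsubmx M)].
  split.
    move/homd_shift_r; rewrite {1}(blk M) => /(@homd_col _ _ _ (shift (pw (~~ l) q')) (pw l p')) [].
    move=> /(@homd_row _ _ _ (shift (pw (~~ l) q)) (pw l p)) [/homd_shift_r/homd_shift_l h1 /homd_shift_r h2].
    move=> /(@homd_row _ _ _ (shift (pw (~~ l) q)) (pw l p)) [/homd_shift_l h3 h4].
    by split=> //; [move: h1; rewrite addrK|move: h3; rewrite addrK].
  move=> [h1 h2 h3 h4]; apply/homd_shift_r; rewrite (blk M).
  apply/(@homd_col _ _ _ (shift (pw (~~ l) q')) (pw l p')); split.
    apply/(@homd_row _ _ _ (shift (pw (~~ l) q)) (pw l p)); split; last exact/homd_shift_r.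
    by apply/homd_shift_r/homd_shift_l; rewrite addrK.
  apply/(@homd_row _ _ _ (shift (pw (~~ l) q)) (pw l p)); split=> //.
  by apply/homd_shift_l; rewrite addrK.
split=> [nh M hM|ext Phi [/hb [h1 h2 h3 h4] _]].
  have [|H [/hb [h1 h2 h3 h4]]] := nh (block_mx 0 0 M 0).
    split.
      apply/hb; rewrite block_mxKul block_mxKur block_mxKdl block_mxKdr; split; try exact: homd0.
      exact/homd_pw0.
    by rewrite ccf ccg !mulmx_block !(mul0mx, mulmx0, addr0).
  rewrite addNr in h1 h4.
  rewrite subr0 ccf ccg {1 2}(blk H) !mulmx_block !(mul0mx, mulmx0, addr0, add0r) add_block_mx.
  move=> /eq_block_mx [_ _ -> _].
  exists (drsubmx H), (- ulsubmx H); split; [exact/homd_pw0|exact/homd_pw0/homdN|].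
  by rewrite mulmxN mulNmx.
move/homd_pw0: h3 => h3; have [H0 [H1 [i0 i1 e]]] := ext _ h3.
have z1 : ulsubmx Phi = 0 by apply: homd_pwN h1.
have z2 : ursubmx Phi = 0 by apply: homd_pwN h2.
have z4 : drsubmx Phi = 0 by apply: homd_pwN h4.
exists (block_mx (- H1) 0 0 H0); split.
  apply/hb; rewrite block_mxKul block_mxKur block_mxKdl block_mxKdr addNr.
  split; try exact: homd0; last exact/homd_pw0.
  by apply: homdN; apply/homd_pw0.
rewrite subr0 (blk Phi) z1 z2 z4 e ccf ccg !mulmx_block !(mul0mx, mulmx0, addr0, add0r) add_block_mx.
by rewrite mulNmx mulmxN opprK !addr0.
Qed.

Lemma tt_stalk0 l (f : 'M[A]_(1, 0)) : tt l f = stalk l 0.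
Proof.
apply: cpx_eq => [i|i|]; rewrite /sumlab /sumdeg; try by case: splitP => [[]|].
by apply/matrixP=> i j; rewrite !mxE; case: splitP => [[]//|k _]; rewrite !mxE;
  case: splitP => [[]//|k' _]; rewrite !mxE.
Qed.

Lemma tt_stalk1 l (f : 'M[A]_(0, 1)) : tt l f = stalk (~~ l) (-1).
Proof.
apply: (@cpx_eq K A 1) => [i|i|]; rewrite /sumlab /sumdeg; try by case: splitP => [|[]].
by apply/matrixP=> i j; rewrite !mxE; case: splitP => [k _|[]//]; rewrite !mxE;
  case: splitP => [k' _|[]//]; rewrite !mxE oppr0.
Qed.

(** An idempotent one of whose pieces is empty is 0 or the identity, so only splittings into two
    nonempty pieces have to be excluded. *)
Lemma trivial_idem_size X : is_cpx X ->
  (forall D1 D2, is_cpx D1 -> is_cpx D2 -> retract D1 X -> retract D2 X ->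
     (forall (V : nmodType) (w : bool -> int -> V), wt w X = wt w D1 + wt w D2) ->
     (0 < csz D1)%N -> (0 < csz D2)%N -> False) ->
  trivial_idem X.
Proof.
move=> cX h eps ceps ee.
have [D1 [D2 [F1 [G1 [F2 [G2 [[c1 c2 iso] [[f1 g1 f2 g2] [[k1 k2 k3 k4] hw]]]]]]]]] :=
  chain_idempotents_split cpo cX ceps ee.
have r1 : retract D1 X by exists G1, F1; split=> //; split=> //; rewrite k2; apply: homotopic_refl.
have r2 : retract D2 X by exists G2, F2; split=> //; split=> //; rewrite k4; apply: homotopic_refl.
have [z|p1] := posnP (csz D1).
  left; rewrite -k1; suff -> : G1 *m F1 = 0 by apply: homotopic_refl.
  by apply/matrixP=> i j; rewrite !mxE big1 // => k; have := ltn_ord k; rewrite {2}z.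
have [z|p2] := posnP (csz D2); last by case: (h _ _ c1 c2 r1 r2 hw p1 p2).
right; rewrite -[eps](subKr (idm X)) -k3.
suff -> : G2 *m F2 = 0 by rewrite subr0; apply: homotopic_refl.
by apply/matrixP=> i j; rewrite !mxE big1 // => k; have := ltn_ord k; rewrite {2}z.
Qed.

Lemma gvec_indecomposable X : two_term X -> gvec X <> 0 -> trivial_idem X -> indecomposable X.
Proof.
move=> tX gX tr; have [cX _] := tX; apply: trivial_idem_indecomposable => //.
move/(null_isoK cX) => iso; apply: gX; rewrite -(gvec_zero A R); apply: gvec_isoK iso => //.
by split; [apply: is_cpx_zero|case].
Qed.

Lemma trivial_idem_stalk l d : trivial_idem (stalk l d).
Proof.
apply: trivial_idem_size; first by split; [apply: homd0|rewrite mulmx0].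
move=> D1 D2 _ _ _ _ hw; have := hw nat (fun _ _ => 1%N); rewrite !csz_wt /=.
by move: (csz D1) (csz D2) => a b e; have : (1 = a + b)%N := e; lia.
Qed.

(** Nonzero g-vectors guarantee that neither complex is null, and distinct ones that the two are not
    isomorphic. *)
Lemma silting_pair_intro X Y : two_term X -> two_term Y -> trivial_idem X -> trivial_idem Y ->
  gvec X <> 0 -> gvec Y <> 0 -> gvec X <> gvec Y ->
  nohom X (shift X) -> nohom X (shift Y) -> nohom Y (shift X) -> nohom Y (shift Y) ->
  (forall S, thick S X -> thick S Y -> thick S (stalk false 0) /\ thick S (stalk true 0)) ->
  silting_pair X Y.
Proof.
move=> tX tY rX rY gX gY gXY XX XY YX YY gen; have [cX _] := tX; have [cY _] := tY.
have cT := is_cpx_dsum cX cY.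
split=> //; split=> //; split; first exact: gvec_indecomposable.
split; first exact: gvec_indecomposable.
split; first by move/(gvec_isoK R cpo bas tX tY).
split=> //; split.
  move=> n F n0 cF; have tT := two_term_dsum tX tY.
  have : nohom (dsum X Y) (shiftn n (dsum X Y)).
    by apply: two_term_nohom => //; apply: nohom_dsum_l; apply: nohom_shift_dsum_r.
  by apply.
move=> Z cZ; set S := (fun _ => _).
have tT : thick S (dsum X Y) by apply: thick_base.
have [h1 h2] := gen S (thick_summand_l cpo cX cY tT) (thick_summand_r cpo cX cY tT).
exact: thick_all.
Qed.
End Explicit.

(** * Generating tuples and their minimality *)

Section ExplicitPairs.
Variables (K : fieldType) (A : falgType K) (e1 e2 : A) (R : realType).
Hypotheses (cpo : complete_prim_orth e1 e2) (bas : basic2 e1 e2).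
Local Notation cpx := (cpx A).
Local Notation eid := (eid e1 e2).
Local Notation is_cpx := (is_cpx e1 e2).
Local Notation nohom := (nohom e1 e2).
Local Notation two_term := (two_term e1 e2).
Local Notation pw := (@pw K A).
Local Notation mxin := (mxin e1 e2).
Local Notation corner l l' y := (y = eid l * y * eid l').

(** In terms of projectives, with l' = ~~ l: f is a left approximation P_l' -> P_l^k by powers of
    P_l, and in [rgen] g is a right approximation P_l'^m -> P_l by powers of P_l'. *)
Definition lgen l k (f : 'cV[A]_k) := mxin l (~~ l) f /\
  forall y, corner l (~~ l) y -> exists2 c : 'rV[A]_k, mxin l l c & y = (c *m f) 0 0.
Definition rgen l m (g : 'rV[A]_m) := mxin l (~~ l) g /\
  forall y, corner l (~~ l) y -> exists2 c : 'cV[A]_m, mxin (~~ l) (~~ l) c & y = (g *m c) 0 0.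
Definition lmin l k (f : 'cV[A]_k) := lgen l f /\ forall k' (f' : 'cV[A]_k'), lgen l f' -> (k <= k')%N.
Definition rmin l m (g : 'rV[A]_m) := rgen l g /\ forall m' (g' : 'rV[A]_m'), rgen l g' -> (m <= m')%N.

Lemma nohom_stalk0 l Y : two_term Y -> nohom (stalk l 0) (shift Y).
Proof. by move=> [_ tY]; apply: nohom_degrees => i j /=; case: (tY i) => ->. Qed.

Lemma nohom_stalk1 l X : two_term X -> nohom X (shift (stalk l (-1))).
Proof. by move=> [_ tX]; apply: nohom_degrees => i j /=; case: (tX j) => ->. Qed.

Lemma mxin0 l l' p q : mxin l l' (0 : 'M[A]_(p, q)).
Proof. by move=> i j; rewrite mxE mulr0 mul0r. Qed.

Lemma exists_lgen l : exists k (f : 'cV[A]_k), lgen l f.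
Proof.
pose b := vbasis {:A}.
exists (\dim {:A}), (\col_i (eid l * b`_i * eid (~~ l))); split.
  by move=> i j; rewrite mxE !mulrA eidK // -!mulrA eidK.
move=> y ey; exists (\row_i (coord b i y *: eid l)).
  by move=> i j; rewrite mxE -scalerAr -scalerAl !eidK.
rewrite mxE {1}ey {1}(coord_vbasis (memvf y)) mulr_sumr mulr_suml; apply: eq_bigr => i _.
by rewrite !mxE -scalerAl !mulrA eidK // -scalerAr scalerAl.
Qed.

Lemma exists_rgen l : exists m (g : 'rV[A]_m), rgen l g.
Proof.
pose b := vbasis {:A}.
exists (\dim {:A}), (\row_i (eid l * b`_i * eid (~~ l))); split.
  by move=> i j; rewrite mxE !mulrA eidK // -!mulrA eidK.
move=> y ey; exists (\col_i (coord b i y *: eid (~~ l))).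
  by move=> i j; rewrite mxE -scalerAr -scalerAl !eidK.
rewrite mxE {1}ey {1}(coord_vbasis (memvf y)) mulr_sumr mulr_suml; apply: eq_bigr => i _.
by rewrite !mxE -[eid l * (_ *: _)]scalerAr -scalerAl -[RHS]scalerAr -!mulrA eidK.
Qed.

Lemma exists_lmin l k (f : 'cV[A]_k) : lgen l f -> exists2 k', (k' <= k)%N & exists f' : 'cV[A]_k', lmin l f'.
Proof.
move=> hf; have ex : exists k, `[<exists f : 'cV[A]_k, lgen l f>] by exists k; apply/asboolP; exists f.
case: (ex_minnP ex) => k' /asboolP [f' hf'] mn; exists k'.
  by apply: mn; apply/asboolP; exists f.
by exists f'; split=> // k'' f'' h; apply: mn; apply/asboolP; exists f''.
Qed.

Lemma exists_rmin l m (g : 'rV[A]_m) : rgen l g -> exists2 m', (m' <= m)%N & exists g' : 'rV[A]_m', rmin l g'.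
Proof.
move=> hf; have ex : exists m, `[<exists g : 'rV[A]_m, rgen l g>] by exists m; apply/asboolP; exists g.
case: (ex_minnP ex) => m' /asboolP [g' hg'] mn; exists m'.
  by apply: mn; apply/asboolP; exists g.
by exists g'; split=> // m'' g'' h; apply: mn; apply/asboolP; exists g''.
Qed.

(** Every entry of the map to be killed factors through [f], so [H1 = 0] is enough in
    [nohom_ttP]. *)
Lemma lgen_nohom l k (f : 'cV[A]_k) p q (g : 'M[A]_(p, q)) : lgen l f -> mxin l (~~ l) g ->
  nohom (tt l f) (shift (tt l g)).
Proof.
move=> [hf gf] hg; apply/nohom_ttP => // M hM.
have /choice [c hc] : forall i : 'I_p, exists c : 'rV[A]_k, mxin l l c /\ M i 0 = (c *m f) 0 0.
  by move=> i; have [c ? ?] := gf (M i 0) (hM i 0); exists c.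
exists (\matrix_(i, j) c i 0 j), 0; split.
- by move=> i j; rewrite mxE; apply: (proj1 (hc i)).
- exact: mxin0.
apply/matrixP=> i j; rewrite ord1 mulmx0 addr0 (proj2 (hc i)) !mxE; apply: eq_bigr => a _.
by rewrite mxE.
Qed.

Lemma rgen_nohom l m (g : 'rV[A]_m) p q (f : 'M[A]_(p, q)) : rgen l g -> mxin l (~~ l) f ->
  nohom (tt l f) (shift (tt l g)).
Proof.
move=> [hg gg] hf; apply/nohom_ttP => // M hM.
have /choice [c hc] : forall j : 'I_q, exists c : 'cV[A]_m, mxin (~~ l) (~~ l) c /\ M 0 j = (g *m c) 0 0.
  by move=> j; have [c ? ?] := gg (M 0 j) (hM 0 j); exists c.
exists 0, (\matrix_(i, j) c j i 0); split.
- exact: mxin0.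
- by move=> i j; rewrite mxE; apply: (proj1 (hc j)).
apply/matrixP=> i j; rewrite ord1 mul0mx add0r (proj2 (hc j)) !mxE; apply: eq_bigr => a _.
by rewrite mxE.
Qed.

(** The label determines the degree, as it does in [tt]. The property passes to the pieces of a
    splitting, whose differentials can therefore be read as tuples of generators. *)
Definition qtype l (D : cpx) := forall i, (clab D i = l /\ cdeg D i = 0) \/ (clab D i = ~~ l /\ cdeg D i = -1).

Definition cnt l (D : cpx) := wt (fun b d => ((b == l) : nat)) D.

Lemma qtype_split l (X D1 D2 : cpx) : (forall (V : nmodType) (w : bool -> int -> V), wt w X = wt w D1 + wt w D2) ->
  qtype l X -> qtype l D1 /\ qtype l D2.
Proof.
move=> hw qX.
pose bad (b : bool) (d : int) : nat := ~~ ((b == l) && (d == 0) || (b == ~~ l) && (d == -1)).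
have z : (wt bad X = 0)%N.
  by rewrite /wt big1 // => i _; rewrite /bad; case: (qX i) => -[-> ->]; rewrite !eqxx /= ?orbT.
move: (hw nat bad); rewrite z => /esym/eqP; rewrite addn_eq0 => /andP [z1 z2].
have aux C : wt bad C == 0%N -> qtype l C.
  rewrite /wt => hC i; have := hC; rewrite (bigD1 i) //= addn_eq0 => /andP [+ _].
  by rewrite eqb0 negbK => /orP [/andP [/eqP ? /eqP ?]|/andP [/eqP ? /eqP ?]]; [left|right].
by split; apply: aux.
Qed.

Lemma qtype_tt l p q (f : 'M[A]_(p, q)) : qtype l (tt l f).
Proof. by move=> i; rewrite /= /sumlab /sumdeg; case: split => k; [right|left]. Qed.

Lemma cnt_tt l p q (f : 'M[A]_(p, q)) : cnt l (tt l f) = p /\ cnt (~~ l) (tt l f) = q.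
Proof.
rewrite /cnt !(@wt_gsum A _ _ (shift (pw (~~ l) q)) (pw l p)) /wt /= !eqxx.
have -> : (~~ l == l) = false by case: l.
have -> : (l == ~~ l) = false by case: l.
by rewrite !sum1_card !card_ord !big1 ?add0r ?addr0.
Qed.

Lemma cnt_csz l (D : cpx) : (cnt l D + cnt (~~ l) D = csz D)%N.
Proof.
rewrite -csz_wt /cnt /wt -big_split /=; apply: eq_bigr => i _.
by case: (clab D i) l => [] [].
Qed.

Lemma cnt1 l (D : cpx) : cnt l D = 1%N -> exists j, clab D j = l /\ forall i, i != j -> clab D i = ~~ l.
Proof.
rewrite /cnt /wt => h.
have [j /eqP hj|no] := pickP (fun j => clab D j == l); last first.
  by move: h; rewrite big1 // => i _; rewrite no.
exists j; split=> // i nij; move: h; rewrite (bigD1 j) //= hj eqxx (bigD1 i) //=.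
by case: (clab D i) l {hj} => [] [] //=; lia.
Qed.

(** The vanishing makes every map P_l' -> P_l factor through the differential out of the only
    summand in degree -1, so the n entries of that column generate on the left. *)
Lemma left_piece l (D : cpx) n : is_cpx D -> qtype l D -> cnt (~~ l) D = 1%N -> csz D = n.+1 ->
  nohom D (shift (stalk l 0)) -> exists f : 'cV[A]_n, lgen l f.
Proof.
move=> cD qD /cnt1 [j [lj hj]] sz nh; have [hD _] := cD.
case: D cD qD sz nh hD j lj hj => n' lab deg M /= cD qD sz; move: sz lab deg M cD qD => -> lab deg M cD qD nh hD j lj hj.
have dj : deg j = -1 by case: (qD j) => -[/= h ->] //; move: h; rewrite lj; case: (l).
have la a : lab (lift j a) = l by rewrite hj ?negbK // eq_sym neq_lift.
exists (\col_a M (lift j a) j); split.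
  by move=> a b; rewrite mxE; have [h _] := hD (lift j a) j; rewrite /= la lj in h.
move=> y ey.
pose P : 'M[A]_(1, n.+1) := \matrix_(i, k) (if k == j then y else 0).
have [|H [hH]] := nh P.
  split.
    apply/homd_shift_r => i k; rewrite mxE; case: eqP => [->|_]; last by rewrite mulr0 mul0r.
    by rewrite /= lj dj.
  rewrite /= oppr0 mul0mx; apply/matrixP=> i k; rewrite !mxE big1 // => h _; rewrite mxE.
  case: eqP => [->|_]; last by rewrite mul0r.
  have [->|/eqP/(proj2 (hD j k)) /=] := eqVneq (M j k) 0; first by rewrite mulr0.
  by rewrite dj; case: (qD k) => -[_ /= ->].
rewrite subr0 /= oppr0 mul0mx addr0 => /matrixP/(_ 0 j).
rewrite !mxE eqxx (bigD1_ord j) //= (_ : M j j = 0); last first.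
  by apply/eqP; apply: contraT => /eqP/(proj2 (hD j j)) /=; rewrite dj.
rewrite mulr0 add0r => ->; exists (\row_a H 0 (lift j a)).
  by move=> i a; rewrite mxE; have [h _] := hH 0 (lift j a); rewrite /= la in h.
by rewrite mxE; apply: eq_bigr => a _; rewrite !mxE.
Qed.

Lemma right_piece l (D : cpx) n : is_cpx D -> qtype l D -> cnt l D = 1%N -> csz D = n.+1 ->
  nohom (stalk (~~ l) (-1)) (shift D) -> exists g : 'rV[A]_n, rgen l g.
Proof.
move=> cD qD /cnt1 [j [lj hj]] sz nh; have [hD _] := cD.
case: D cD qD sz nh hD j lj hj => n' lab deg M /= cD qD sz; move: sz lab deg M cD qD => -> lab deg M cD qD nh hD j lj hj.
have dj : deg j = 0 by case: (qD j) => -[/= h ->] //; move: h; rewrite lj; case: (l).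
have la a : lab (lift j a) = ~~ l by rewrite hj // eq_sym neq_lift.
exists (\row_a M j (lift j a)); split.
  by move=> a b; rewrite mxE; have [h _] := hD j (lift j b); rewrite /= la lj in h.
move=> y ey.
pose P : 'M[A]_(n.+1, 1) := \matrix_(k, i) (if k == j then y else 0).
have [|H [hH]] := nh P.
  split.
    apply/homd_shift_r => k i; rewrite mxE; case: eqP => [->|_]; last by rewrite mulr0 mul0r.
    by rewrite /= lj dj.
  rewrite /= mulmx0; apply/matrixP=> k i; rewrite mulNmx !mxE big1 ?oppr0 // => h _; rewrite mxE.
  case: eqP => [->|_]; last by rewrite mulr0.
  have [->|/eqP/(proj2 (hD k j)) /=] := eqVneq (M k j) 0; first by rewrite mul0r.
  by rewrite dj; case: (qD k) => -[_ /= ->].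
rewrite subr0 /= mulmx0 add0r mulNmx => /matrixP/(_ j 0).
rewrite !mxE eqxx (bigD1_ord j) //= (_ : M j j = 0); last first.
  by apply/eqP; apply: contraT => /eqP/(proj2 (hD j j)) /=; rewrite dj.
rewrite mul0r add0r => ->; exists (- \col_a H (lift j a) 0).
  move=> a i; rewrite !mxE; have [h _] := hH (lift j a) 0; rewrite /= la in h.
  by rewrite mulrN mulNr -h.
by rewrite mulmxN !mxE; congr (- _); apply: eq_bigr => a _; rewrite !mxE.
Qed.
End ExplicitPairs.

(** * Explicit silting pairs *)

Section Mutations.
Variables (K : fieldType) (A : falgType K) (e1 e2 : A) (R : realType).
Hypotheses (cpo : complete_prim_orth e1 e2) (bas : basic2 e1 e2).
Local Notation cpx := (cpx A).
Local Notation is_cpx := (is_cpx e1 e2).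
Local Notation chain_map := (chain_map e1 e2).
Local Notation isoK := (isoK e1 e2).
Local Notation nohom := (nohom e1 e2).
Local Notation retract := (retract e1 e2).
Local Notation two_term := (two_term e1 e2).
Local Notation thick := (thick e1 e2).
Local Notation silting_pair := (basic_two_silting e1 e2).
Local Notation trivial_idem := (trivial_idem e1 e2).
Local Notation gvec := (gvec R).
Local Notation pw := (@pw K A).
Local Notation mxin := (mxin e1 e2).
Local Notation lmin := (@lmin K A e1 e2).
Local Notation rmin := (@rmin K A e1 e2).

Lemma vP_injl l (a b c d : R) :
  a *: vP R l + b *: vP R (~~ l) = c *: vP R l + d *: vP R (~~ l) -> a = c /\ b = d.
Proof.
case: l => /=; last exact: vP_inj.
by rewrite addrC [c *: _ + _]addrC => /vP_inj [-> ->].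
Qed.

Lemma gvec_stalk0 l : gvec (stalk l 0 : cpx) = 1 *: vP R l + 0 *: vP R (~~ l).
Proof. by rewrite gvec_stalk ?expr0z ?scale0r ?addr0 //; left. Qed.

Lemma gvec_stalk1 l : gvec (stalk (~~ l) (-1) : cpx) = 0 *: vP R l + -1 *: vP R (~~ l).
Proof. by rewrite gvec_stalk ?exprN1 ?invrN1 ?scale0r ?add0r //; right. Qed.

Lemma gvec_ttE l p q (f : 'M[A]_(p, q)) : gvec (tt l f) = p%:R *: vP R l + (- q%:R) *: vP R (~~ l).
Proof. by rewrite gvec_tt scaleNr. Qed.

Lemma vP_neq0 l (a b : R) : (a != 0) || (b != 0) -> a *: vP R l + b *: vP R (~~ l) <> 0.
Proof.
move=> h e; have [a0 b0] : a = 0 /\ b = 0.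
  by apply: (@vP_injl l); rewrite e !scale0r addr0.
by move: h; rewrite a0 b0 eqxx.
Qed.

(** The single summand in degree -1 falls into one piece of a splitting. By [left_piece] the
    differential of that piece consists of left generators, and there are fewer than k of them if
    the other piece is nonempty. *)
Lemma lmin_trivial l k (f : 'cV[A]_k) : lmin l f -> trivial_idem (tt l f).
Proof.
move=> [gf mn]; have hf := proj1 gf; have [cX _] := two_term_tt hf.
have side (D1 D2 : cpx) : is_cpx D1 -> retract D1 (tt l f) ->
    (forall (V : nmodType) (w : bool -> int -> V), wt w (tt l f) = wt w D1 + wt w D2) ->
    (0 < csz D2)%N -> cnt (~~ l) D1 = 1%N -> False.
  move=> c1 r1 hw p2 ct; have [q1 _] := qtype_split hw (@qtype_tt K A l _ _ f).
  have sz : (k.+1 = csz D1 + csz D2)%N by have := hw nat (fun _ _ => 1%N); rewrite !csz_wt.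
  have sz1 := cnt_csz l D1; rewrite ct addn1 in sz1.
  have nh : nohom D1 (shift (stalk l 0)).
    apply: nohom_retract_l r1 _ => //; rewrite -(tt_stalk0 l (0 : 'M[A]_(1, 0))).
    by apply: lgen_nohom => //; apply: mxin0.
  have [f' /mn le] := left_piece c1 q1 ct (esym sz1) nh.
  by move: le sz p2; rewrite -sz1; lia.
apply: trivial_idem_size => // D1 D2 c1 c2 r1 r2 hw p1 p2.
have := hw nat (fun b d => ((b == ~~ l) : nat)) => hc.
have [_ ct] := @cnt_tt K A l _ _ f; rewrite /cnt hc in ct.
have ct' : (cnt (~~ l) D1 + cnt (~~ l) D2 = 1)%N by [].
have [h|h] : cnt (~~ l) D1 = 1%N \/ cnt (~~ l) D2 = 1%N by move: ct'; lia.
  exact: (side D1 D2).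
by apply: (side D2 D1) => // V w; rewrite addrC.
Qed.

Lemma rmin_trivial l m (g : 'rV[A]_m) : rmin l g -> trivial_idem (tt l g).
Proof.
move=> [gg mn]; have hg := proj1 gg; have [cX _] := two_term_tt hg.
have side (D1 D2 : cpx) : is_cpx D1 -> retract D1 (tt l g) ->
    (forall (V : nmodType) (w : bool -> int -> V), wt w (tt l g) = wt w D1 + wt w D2) ->
    (0 < csz D2)%N -> cnt l D1 = 1%N -> False.
  move=> c1 r1 hw p2 ct; have [q1 _] := qtype_split hw (@qtype_tt K A l _ _ g).
  have sz : (m + 1 = csz D1 + csz D2)%N by have := hw nat (fun _ _ => 1%N); rewrite !csz_wt.
  have sz1 := cnt_csz l D1; rewrite ct add1n in sz1.
  have nh : nohom (stalk (~~ l) (-1)) (shift D1).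
    apply: nohom_shift_retract r1 _ => //; rewrite -(tt_stalk1 l (0 : 'M[A]_(0, 1))).
    by apply: rgen_nohom => //; apply: mxin0.
  have [g' /mn le] := right_piece c1 q1 ct (esym sz1) nh.
  by move: le sz p2; rewrite -sz1; lia.
apply: trivial_idem_size => // D1 D2 c1 c2 r1 r2 hw p1 p2.
have := hw nat (fun b d => ((b == l) : nat)) => hc.
have [ct _] := @cnt_tt K A l _ _ g; rewrite /cnt hc in ct.
have ct' : (cnt l D1 + cnt l D2 = 1)%N by [].
have [h|h] : cnt l D1 = 1%N \/ cnt l D2 = 1%N by move: ct'; lia.
  exact: (side D1 D2).
by apply: (side D2 D1) => // V w; rewrite addrC.
Qed.

Lemma thick_both S l : thick S (stalk l 0) -> thick S (stalk (~~ l) 0) ->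
  thick S (stalk false 0) /\ thick S (stalk true 0).
Proof. by case: l. Qed.

Lemma thick_tt_source S l p q (f : 'M[A]_(p, q)) : mxin l (~~ l) f -> thick S (stalk l 0) ->
  thick S (tt l f) -> thick S (pw (~~ l) q).
Proof.
move=> hf t1 t2; apply: thick_cone_source t2 => //.
- exact: is_cpx_pw.
- exact: is_cpx_pw.
- exact: tt_chain.
exact: thick_pw.
Qed.

Lemma thick_tt_target S l p q (f : 'M[A]_(p, q)) : mxin l (~~ l) f -> thick S (stalk (~~ l) 0) ->
  thick S (tt l f) -> thick S (pw l p).
Proof.
move=> hf t1 t2; apply: thick_cone_target t2 => //.
- exact: is_cpx_pw.
- exact: is_cpx_pw.
- exact: tt_chain.
exact: thick_pw.
Qed.

Lemma pair_A l : silting_pair (stalk l 0) (stalk (~~ l) 0).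
Proof.
have t0 b : two_term (stalk b 0) by apply: two_term_stalk; left.
apply: (silting_pair_intro (R := R)) => //; try exact: trivial_idem_stalk; try exact: nohom_stalk0.
- by rewrite gvec_stalk0; apply: vP_neq0; rewrite oner_eq0.
- by rewrite gvec_stalk0; apply: vP_neq0; rewrite oner_eq0.
- rewrite !gvec_stalk0 negbK [RHS]addrC => /vP_injl [/eqP].
  by rewrite oner_eq0.
by move=> S; apply: thick_both.
Qed.

Lemma pair_A1 l : silting_pair (stalk l (-1)) (stalk (~~ l) (-1)).
Proof.
have t0 b : two_term (stalk b (-1)) by apply: two_term_stalk; right.
have g b : gvec (stalk b (-1) : cpx) = -1 *: vP R b + 0 *: vP R (~~ b).
  by have := gvec_stalk1 (~~ b); rewrite negbK addrC.
apply: (silting_pair_intro (R := R)) => //; try exact: trivial_idem_stalk; try exact: nohom_stalk1.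
- by rewrite g; apply: vP_neq0; rewrite oppr_eq0 oner_eq0.
- by rewrite g; apply: vP_neq0; rewrite oppr_eq0 oner_eq0.
- rewrite !g negbK [RHS]addrC => /vP_injl [/eqP].
  by rewrite oppr_eq0 oner_eq0.
have ush b : stalk b 0 = unshift (stalk b (-1) : cpx) by apply: cpx_eq => //=; rewrite oppr0.
by move=> S h h'; apply: (@thick_both _ l); rewrite ush; apply: thick_unshift.
Qed.

(** The left mutation of A at P_l', with l' = ~~ l. *)
Lemma pair_left l k (f : 'cV[A]_k) : lmin l f -> silting_pair (stalk l 0) (tt l f).
Proof.
move=> mf; have [gf _] := mf; have [hf _] := gf.
have t0 : two_term (stalk l 0) by apply: two_term_stalk; left.
have tT := two_term_tt hf.
apply: (silting_pair_intro (R := R)) => //.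
- exact: trivial_idem_stalk.
- exact: lmin_trivial.
- by rewrite gvec_stalk0; apply: vP_neq0; rewrite oner_eq0.
- by rewrite gvec_ttE; apply: vP_neq0; rewrite oppr_eq0 oner_eq0 orbT.
- by rewrite gvec_stalk0 gvec_ttE => /vP_injl [_ /eqP]; rewrite eq_sym oppr_eq0 oner_eq0.
- exact: nohom_stalk0.
- exact: nohom_stalk0.
- rewrite -(tt_stalk0 l (0 : 'M[A]_(1, 0))).
  by apply: lgen_nohom => //; apply: mxin0.
- exact: lgen_nohom.
by move=> S h h'; apply: (@thick_both _ l) => //; apply: thick_tt_source h'.
Qed.

(** The right mutation of A[1] at P_l[1]: the new complex is the cocone of an approximation of
    P_l[1] by powers of P_l'[1], where l' = ~~ l. *)
Lemma pair_right l m (g : 'rV[A]_m) : rmin l g -> silting_pair (tt l g) (stalk (~~ l) (-1)).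
Proof.
move=> mg; have [gg _] := mg; have [hg _] := gg.
have t0 : two_term (stalk (~~ l) (-1)) by apply: two_term_stalk; right.
have tT := two_term_tt hg.
apply: (silting_pair_intro (R := R)) => //.
- exact: rmin_trivial.
- exact: trivial_idem_stalk.
- by rewrite gvec_ttE; apply: vP_neq0; rewrite oner_eq0.
- by rewrite gvec_stalk1; apply: vP_neq0; rewrite oppr_eq0 oner_eq0 orbT.
- by rewrite gvec_stalk1 gvec_ttE => /vP_injl [/eqP]; rewrite oner_eq0.
- exact: rgen_nohom.
- exact: nohom_stalk1.
- rewrite -(tt_stalk1 l (0 : 'M[A]_(0, 1))).
  by apply: rgen_nohom => //; apply: mxin0.
- exact: nohom_stalk1.
have ush b : stalk b 0 = unshift (stalk b (-1) : cpx) by apply: cpx_eq => //=; rewrite oppr0.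
move=> S h h'; have h0 : thick S (stalk (~~ l) 0) by rewrite ush; apply: thick_unshift.
by apply: (@thick_both _ l) => //; apply: thick_tt_target h.
Qed.

Section Assoc.
Variables m n p : nat.
Let s := cast_ord (addnA m n p).

Lemma assoc_l a : s (lshift (n + p) a) = lshift p (lshift n a). Proof. exact/val_inj. Qed.
Lemma assoc_m b : s (rshift m (lshift p b)) = lshift p (rshift m b). Proof. exact/val_inj. Qed.
Lemma assoc_r c : s (rshift m (rshift n c)) = rshift (m + n) c.
Proof. by apply/val_inj; rewrite /= addnA. Qed.
End Assoc.

Lemma split_lsh m n (a : 'I_m) : split (lshift n a) = inl a.
Proof. exact: (unsplitK (inl a)). Qed.

Lemma split_rsh m n (a : 'I_n) : split (rshift m a) = inr a.
Proof. exact: (unsplitK (inr a)). Qed.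

Lemma tt_row_cone l p q1 q (g : 'M[A]_(p, q1)) (f : 'M[A]_(p, q)) : mxin l (~~ l) g -> mxin l (~~ l) f ->
  isoK (cone (pw (~~ l) q1) (tt l f) (col_mx 0 g)) (tt l (row_mx g f)) /\
  chain_map (pw (~~ l) q1) (tt l f) (col_mx 0 g).
Proof.
move=> hg hf; have [cT _] := two_term_tt hf.
have cF : chain_map (pw (~~ l) q1) (tt l f) (col_mx 0 g).
  split; last by rewrite /= oppr0 mul_block_col !(mulmx0, mul0mx, addr0) col_mx0.
  apply/(@homd_col _ _ _ (shift (pw (~~ l) q)) (pw l p)); split; first exact: homd0.
  exact/homd_pw0.
split=> //.
apply: (@reindex_isoK K A e1 e2 cpo (cone (pw (~~ l) q1) (tt l f) (col_mx 0 g)) (tt l (row_mx g f))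
  (cast_ord (addnA q1 q p))).
- by apply: is_cpx_cone => //; apply: is_cpx_pw.
- by exists (cast_ord (esym (addnA q1 q p))); [apply: cast_ordK|apply: cast_ordKV].
- move=> i; rewrite /= /sumlab; case: (split_ordP i) => a ->; last case: (split_ordP a) => b ->;
    by rewrite ?assoc_l ?assoc_m ?assoc_r ?split_lsh ?split_rsh.
- move=> i; rewrite /= /sumdeg; case: (split_ordP i) => a ->; last case: (split_ordP a) => b ->;
    by rewrite ?assoc_l ?assoc_m ?assoc_r ?split_lsh ?split_rsh.
move=> i j; rewrite /= !oppr0.
case: (split_ordP i) => a ->; last case: (split_ordP a) => b ->;
  (case: (split_ordP j) => a' ->; last case: (split_ordP a') => b' ->);
  rewrite ?assoc_l ?assoc_m ?assoc_r ?block_mxEul ?block_mxEur ?block_mxEdl ?block_mxEdr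
    ?row_mxEl ?row_mxEr ?col_mxEu ?col_mxEd ?block_mxEul ?block_mxEur ?block_mxEdl ?block_mxEdr ?mxE ?split_lsh ?split_rsh ?mxE //.
Qed.

Lemma tt_col_cone l p p1 q (f : 'M[A]_(p, q)) (g : 'M[A]_(p1, q)) : mxin l (~~ l) g -> mxin l (~~ l) f ->
  isoK (cone (unshift (tt l f)) (pw l p1) (row_mx g 0)) (tt l (col_mx f g)) /\
  chain_map (unshift (tt l f)) (pw l p1) (row_mx g 0).
Proof.
move=> hg hf; have [cT _] := two_term_tt hf.
have cF : chain_map (unshift (tt l f)) (pw l p1) (row_mx g 0).
  split; last by rewrite /= mul0mx mulmxN mul_row_block !mulmx0 !mul0mx !addr0 oppr0 mulmx0 row_mx0 oppr0.
  apply/homd_unshift_l; apply/(@homd_row _ _ _ (shift (pw (~~ l) q)) (pw l p)); split; last exact: homd0.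
  by apply/homd_shift_l; rewrite addrK; apply/homd_pw0.
split=> //; apply: isoK_sym.
have hfg : mxin l (~~ l) (col_mx f g) by move=> i j; rewrite mxE; case: split.
have [cT' _] := two_term_tt hfg.
apply: (@reindex_isoK K A e1 e2 cpo (tt l (col_mx f g)) (cone (unshift (tt l f)) (pw l p1) (row_mx g 0))
  (cast_ord (addnA q p p1))) => //.
- by exists (cast_ord (esym (addnA q p p1))); [apply: cast_ordK|apply: cast_ordKV].
- move=> i; rewrite /= /sumlab; case: (split_ordP i) => a ->; last case: (split_ordP a) => b ->;
    by rewrite ?assoc_l ?assoc_m ?assoc_r ?split_lsh ?split_rsh ?split_lsh ?split_rsh.
- move=> i; rewrite /= /sumdeg; case: (split_ordP i) => a ->; last case: (split_ordP a) => b ->;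
    by rewrite ?assoc_l ?assoc_m ?assoc_r ?split_lsh ?split_rsh ?split_lsh ?split_rsh ?addrK.
move=> i j; rewrite /= !oppr0 !opprK.
case: (split_ordP i) => a ->; last case: (split_ordP a) => b ->;
  (case: (split_ordP j) => a' ->; last case: (split_ordP a') => b' ->);
  rewrite ?assoc_l ?assoc_m ?assoc_r ?block_mxEul ?block_mxEur ?block_mxEdl ?block_mxEdr
    ?row_mxEl ?row_mxEr ?col_mxEu ?col_mxEd ?block_mxEul ?block_mxEur ?block_mxEdl ?block_mxEdr ?mxE ?split_lsh ?split_rsh ?mxE //.
Qed.

(** Three of the four vanishings hold because [x] generates on the left and (g, x) on the right; the
    fourth is the hypothesis [nh]. For generation, the second complex is the cone of a map from P_l'
    to the first, which gives back P_l' and then P_l. *)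
Lemma pair_L l (x g : 'M[A]_1) : lmin l x -> rmin l (row_mx g x) -> mxin l (~~ l) g ->
  nohom (tt l (row_mx g x)) (shift (tt l x)) -> silting_pair (tt l x) (tt l (row_mx g x)).
Proof.
move=> mx mg hg nh; have [gx _] := mx; have [hx _] := gx; have [gg _] := mg; have [hgx _] := gg.
apply: (silting_pair_intro (R := R)) => //.
- exact: two_term_tt.
- exact: two_term_tt.
- exact: lmin_trivial.
- exact: rmin_trivial.
- by rewrite gvec_ttE; apply: vP_neq0; rewrite oner_eq0.
- by rewrite gvec_ttE; apply: vP_neq0; rewrite oner_eq0.
- by rewrite !gvec_ttE => /vP_injl [_ /eqP]; rewrite eqr_opp eqr_nat.
- exact: lgen_nohom.
- exact: lgen_nohom.
- exact: rgen_nohom.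
move=> S h h'; have [iso cF] := tt_row_cone hg hx.
have tK : thick S (cone (pw (~~ l) 1) (tt l x) (col_mx 0 g)).
  apply: thick_iso h' _ (isoK_sym iso).
  by apply: is_cpx_cone => //; [apply: is_cpx_pw|case: (two_term_tt hx)].
have h0 : thick S (stalk (~~ l) 0).
  by apply: thick_cone_source h tK => //; [apply: (is_cpx_pw _ _ 1)|case: (two_term_tt hx)].
by apply: (@thick_both _ l) => //; apply: thick_tt_target h.
Qed.

(** The mirror image of [pair_L]: now the larger complex is the cone of a map from the shifted back
    [tt l x] to P_l, and P_l is recovered before P_l'. *)
Lemma pair_R l (x g : 'M[A]_1) : rmin l x -> lmin l (col_mx x g) -> mxin l (~~ l) g ->
  nohom (tt l x) (shift (tt l (col_mx x g))) -> silting_pair (tt l (col_mx x g)) (tt l x).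
Proof.
move=> mx mg hg nh; have [gx _] := mx; have [hx _] := gx; have [gg _] := mg; have [hgx _] := gg.
apply: (silting_pair_intro (R := R)) => //.
- exact: two_term_tt.
- exact: two_term_tt.
- exact: lmin_trivial.
- exact: rmin_trivial.
- by rewrite gvec_ttE; apply: vP_neq0; rewrite oppr_eq0 oner_eq0 orbT.
- by rewrite gvec_ttE; apply: vP_neq0; rewrite oner_eq0.
- by rewrite !gvec_ttE => /vP_injl [/eqP]; rewrite eqr_nat.
- exact: lgen_nohom.
- exact: rgen_nohom.
- exact: rgen_nohom.
move=> S h h'; have [iso cF] := tt_col_cone hg hx.
have [cT _] := two_term_tt hx; have cT' := is_cpx_unshift cT.
have tK : thick S (cone (unshift (tt l x)) (pw l 1) (row_mx g 0)).
  apply: thick_iso h _ (isoK_sym iso).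
  by apply: is_cpx_cone => //; apply: is_cpx_pw.
have h0 : thick S (stalk l 0).
  apply: thick_cone_target tK => //; first exact: (is_cpx_pw _ _ 1).
  exact: thick_unshift.
by apply: (@thick_both _ l) => //; apply: thick_tt_source h'.
Qed.
End Mutations.

(** * The conditions (L) and (R) *)

Section Conditions.
Variables (K : fieldType) (A : falgType K) (e1 e2 : A).
Hypotheses (cpo : complete_prim_orth e1 e2) (bas : basic2 e1 e2).
Local Notation eid := (eid e1 e2).
Local Notation nohom := (nohom e1 e2).
Local Notation mxin := (mxin e1 e2).
Local Notation lgen := (@lgen K A e1 e2).
Local Notation rgen := (@rgen K A e1 e2).
Local Notation lmin := (@lmin K A e1 e2).
Local Notation rmin := (@rmin K A e1 e2).
Local Notation corner l l' y := (y = eid l * y * eid l').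

Lemma cornl l l' y : corner l l' y -> eid l * y = y.
Proof. by move=> ->; rewrite !mulrA eidK. Qed.

Lemma cornr l l' y : corner l l' y -> y * eid l' = y.
Proof. by move=> ->; rewrite -!mulrA eidK. Qed.

Lemma cornM l l' l'' y z : corner l l' y -> corner l' l'' z -> corner l l'' (y * z).
Proof. by move=> hy hz; rewrite mulrA (cornl hy) -mulrA (cornr hz). Qed.

Lemma cornD l l' y z : corner l l' y -> corner l l' z -> corner l l' (y + z).
Proof. by move=> hy hz; rewrite mulrDr mulrDl -hy -hz. Qed.

Lemma cornN l l' y : corner l l' y -> corner l l' (- y).
Proof. by move=> hy; rewrite mulrN mulNr -hy. Qed.

Lemma corn_mid l l' y : corner l l' (eid l * y * eid l').
Proof. by rewrite !mulrA eidK // -!mulrA eidK. Qed.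

Lemma corn_eid l : corner l l (eid l).
Proof. by rewrite !eidK. Qed.

Definition cunit l a := exists2 i, corner l l i & i * a = eid l /\ a * i = eid l.

(** r p a and a r p are idempotents of the corner. They are nonzero since p a r = e_l, so
    primitivity makes both equal to e_l, and r p is a two-sided inverse of [a]. *)
Lemma cunit_factor l p a r : corner l l p -> corner l l a -> corner l l r -> p * a * r = eid l -> cunit l a.
Proof.
move=> hp ha hr e.
have idem1 : r * p * a * (r * p * a) = r * p * a.
  have -> : r * p * a * (r * p * a) = r * (p * a * r) * (p * a) by rewrite !mulrA.
  by rewrite e (cornr hr) mulrA.
have idem2 : a * r * p * (a * r * p) = a * r * p.
  have -> : a * r * p * (a * r * p) = a * r * (p * a * r) * p by rewrite !mulrA.
  by rewrite e -[a * r * eid l]mulrA (cornr hr).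
have nz : eid l <> 0 by move=> z; apply: (eid_neq0 cpo z).
exists (r * p); first exact: (cornM hr hp).
split.
  have [z|//] := corner_idem cpo (cornM (cornM hr hp) ha) idem1.
  case: nz; rewrite -(eidK cpo) -e.
  have -> : p * a * r * (p * a * r) = p * a * (r * p * a) * r by rewrite !mulrA.
  by rewrite z mulr0 mul0r.
rewrite mulrA; have [z|//] := corner_idem cpo (cornM (cornM ha hr) hp) idem2.
case: nz; rewrite -(eidK cpo) -e.
have -> : p * a * r * (p * a * r) = p * (a * r * p) * (a * r) by rewrite !mulrA.
by rewrite z mulr0 mul0r.
Qed.

Lemma cunit_sum l p a r p' a' r' : corner l l p -> corner l l a -> corner l l r ->
  corner l l p' -> corner l l a' -> corner l l r' ->
  cunit l (p * a * r + p' * a' * r') -> cunit l a \/ cunit l a'.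
Proof.
move=> hp ha hr hp' ha' hr' [i hi [_]]; rewrite mulrDl => e.
have hx : corner l l (p * a * r * i) by exact: (cornM (cornM (cornM hp ha) hr) hi).
have [[b hb [h _]]|[b hb [h _]]] := corner_local cpo hx; [left|right].
  apply: (@cunit_factor l p a (r * i * b)) => //; first exact: (cornM (cornM hr hi) hb).
  by rewrite -h !mulrA.
apply: (@cunit_factor l p' a' (r' * i * b)) => //; first exact: (cornM (cornM hr' hi) hb).
by rewrite -[RHS]h -e addrC addKr !mulrA.
Qed.

Section Fixed.
Variable l : bool.

Lemma lgen1 (x : 'M[A]_1) : lgen l x <-> left_gen (eid l) (eid (~~ l)) (x 0 0).
Proof.
split=> [[hx gx]|[hx gx]].
  split; first exact: hx.
  move=> y /gx [c hc ->]; exists (c 0 0).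
  by rewrite mxE big_ord1 (cornl (hc 0 0)).
split; first by move=> i j; rewrite !ord1; apply: hx.
move=> y /gx [a ->]; exists (eid l * a * eid l)%:M.
  by move=> i j; rewrite !ord1 mxE mulr1n; apply: corn_mid.
by rewrite mxE big_ord1 mxE mulr1n -[RHS]mulrA (cornl hx).
Qed.

Lemma rgen1 (x : 'M[A]_1) : rgen l x <-> right_gen (eid l) (eid (~~ l)) (x 0 0).
Proof.
split=> [[hx gx]|[hx gx]].
  split; first exact: hx.
  move=> y /gx [c hc ->]; exists (c 0 0).
  by rewrite mxE big_ord1 -mulrA (cornr (hc 0 0)).
split; first by move=> i j; rewrite !ord1; apply: hx.
move=> y /gx [a ->]; exists (eid (~~ l) * a * eid (~~ l))%:M.
  by move=> i j; rewrite !ord1 mxE mulr1n; apply: corn_mid.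
by rewrite mxE big_ord1 mxE mulr1n !mulrA (cornr hx).
Qed.

Lemma lgen0 : (exists f : 'cV[A]_0, lgen l f) <-> eAe'_zero (eid l) (eid (~~ l)).
Proof.
split=> [[f [_ gf]] y|z]; first by move/gf => [c _ ->]; rewrite mxE big_ord0.
by exists 0; split; [case|move=> y /z ->; exists 0; [move=> ? []|rewrite mxE big_ord0]].
Qed.

Lemma rgen0 : (exists g : 'rV[A]_0, rgen l g) <-> eAe'_zero (eid l) (eid (~~ l)).
Proof.
split=> [[f [_ gf]] y|z]; first by move/gf => [c _ ->]; rewrite mxE big_ord0.
by exists 0; split; [move=> ? []|move=> y /z ->; exists 0; [case|rewrite mxE big_ord0]].
Qed.

Lemma zero_cyclic : eAe'_zero (eid l) (eid (~~ l)) ->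
  left_cyclic (eid l) (eid (~~ l)) /\ right_cyclic (eid l) (eid (~~ l)).
Proof.
move=> z; have h0 : inEAE (eid l) (eid (~~ l)) 0 by rewrite /inEAE mulr0 mul0r.
by split; exists 0; split=> // y /z ->; exists 0; rewrite !mulr0 ?mul0r.
Qed.

Lemma left_cyclic_lmin k (f : 'cV[A]_k) : lmin l f -> left_cyclic (eid l) (eid (~~ l)) <-> (k <= 1)%N.
Proof.
move=> [gf mn]; split=> [[x gx]|].
  by apply: (mn 1%N x%:M); apply/lgen1; rewrite mxE mulr1n.
case: k f gf {mn} => [|[|//]] f gf _.
  by apply: (proj1 (zero_cyclic _)); apply/lgen0; exists f.
by exists (f 0 0); apply/lgen1.
Qed.

Lemma right_cyclic_rmin m (g : 'rV[A]_m) : rmin l g -> right_cyclic (eid l) (eid (~~ l)) <-> (m <= 1)%N.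
Proof.
move=> [gg mn]; split=> [[x gx]|].
  by apply: (mn 1%N x%:M); apply/rgen1; rewrite mxE mulr1n.
case: m g gg {mn} => [|[|//]] g gg _.
  by apply: (proj2 (zero_cyclic _)); apply/rgen0; exists g.
by exists (g 0 0); apply/rgen1.
Qed.

Lemma zero_lmin k (f : 'cV[A]_k) : lmin l f -> eAe'_zero (eid l) (eid (~~ l)) <-> k = 0%N.
Proof.
move=> [gf mn]; split=> [/lgen0 [f' /mn]|k0]; first by rewrite leqn0 => /eqP.
by subst k; apply/lgen0; exists f.
Qed.

Lemma zero_rmin m (g : 'rV[A]_m) : rmin l g -> eAe'_zero (eid l) (eid (~~ l)) <-> m = 0%N.
Proof.
move=> [gg mn]; split=> [/rgen0 [g' /mn]|m0]; first by rewrite leqn0 => /eqP.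
by subst m; apply/rgen0; exists g.
Qed.

Lemma cyclic_condL : left_cyclic (eid l) (eid (~~ l)) -> right_cyclic (eid l) (eid (~~ l)) ->
  condL (eid l) (eid (~~ l)).
Proof.
move=> lc [x [hx gx]]; split=> //; exists x, 0; split=> //; split.
  by rewrite /inEAE mulr0 mul0r.
split=> y; split.
- move=> hy; exists y, 0; rewrite mulr0 addr0; split.
    by split=> //; apply: gx; rewrite /inEAE mulrA (cornl hy) -mulrA (cornr hx).
  by split=> //; split; [rewrite /inEAE mulr0 mul0r|exists 0; rewrite mulr0 !mul0r].
- by move=> [r [s [[hr _] [_ ->]]]]; rewrite mulr0 addr0.
- by move/gx => [a ->]; exists a, 0; rewrite !(mulr0, mul0r) addr0.
by move=> [a [b ->]]; rewrite !mul0r addr0 /inEAE !mulrA (cornl hx) -!mulrA eidK.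
Qed.

Lemma cyclic_condR : left_cyclic (eid l) (eid (~~ l)) -> right_cyclic (eid l) (eid (~~ l)) ->
  condR (eid l) (eid (~~ l)).
Proof.
move=> [x [hx gx]] rc; split=> //; exists x, 0; split=> //; split.
  by rewrite /inEAE mulr0 mul0r.
split=> y; split.
- move=> hy; exists y, 0; rewrite mul0r addr0; split.
    by split=> //; apply: gx; rewrite /inEAE mulrA (cornl hx) -mulrA (cornr hy).
  by split=> //; split; [rewrite /inEAE mulr0 mul0r|exists 0; rewrite !(mulr0, mul0r)].
- by move=> [r [s [[hr _] [_ ->]]]]; rewrite mul0r addr0.
- by move/gx => [a ->]; exists a, 0; rewrite !(mulr0, mul0r) addr0.
by move=> [a [b ->]]; rewrite mulr0 addr0 /inEAE !mulrA eidK // -[in RHS]mulrA (cornr hx).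
Qed.

Lemma scal1 (a : A) : (a%:M : 'M[A]_1) 0 0 = a.
Proof. by rewrite mxE mulr1n. Qed.

Lemma mxin_scal b b' (a : A) : corner b b' a -> mxin b b' (a%:M : 'M[A]_1).
Proof. by move=> h i j; rewrite !ord1 scal1. Qed.

(** Condition (L) supplies a left generator x0 and a second element x = a x0, and its last equation
    makes [a] a unit. Then x generates on the left and (u x, x) on the right, while eAe = R_x + R_x
    u is the vanishing of the remaining extensions in the form of [nohom_ttP]. *)
Lemma condL_pair : condL (eid l) (eid (~~ l)) -> ~ right_cyclic (eid l) (eid (~~ l)) ->
  exists x g : 'M[A]_1, [/\ lmin l x, rmin l (row_mx g x), mxin l (~~ l) g &
    nohom (tt l (row_mx g x)) (shift (tt l x))].
Proof.
move=> [[x0 [hx0 gx0]] [x [u [hx [hu [hR hgen]]]]]] nrc.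
have nz : ~ eAe'_zero (eid l) (eid (~~ l)) by move/zero_cyclic => [_ /nrc].
have lead y : corner l (~~ l) y -> exists2 a, corner l l a & y = a * x0.
  move=> /gx0 [a ->]; exists (eid l * a * eid l); first exact: corn_mid.
  by rewrite -[RHS]mulrA (cornl hx0).
have [a ha ex] := lead x hx.
have ua : cunit l a.
  have /hgen [s [t e0]] := hx0.
  have hs : corner l (~~ l) (x0 * s * eid (~~ l)) by rewrite !mulrA (cornl hx0) -!mulrA eidK.
  have ht : corner l (~~ l) (x0 * t * eid (~~ l)) by rewrite !mulrA (cornl hx0) -!mulrA eidK.
  have [c1 hc1 ec1] := lead _ hs; have [c2 hc2 ec2] := lead _ ht.
  (* [j] fixes x0. If it were not a unit then e_l - j would be one, and x0 would be 0; so [j] is a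
     unit, and hence [a]. *)
  pose j := eid l * a * c1 + u * a * c2.
  have hj : corner l l j.
    by apply: cornD; [exact: (cornM (cornM (corn_eid l) ha) hc1)|exact: (cornM (cornM hu ha) hc2)].
  have ej : j * x0 = x0.
    by rewrite [RHS]e0 ex /j mulrDl (cornl ha) -!mulrA -ec1 -ec2 !mulrA.
  have [[i hi [h1 h2]]|[i hi [_ h2]]] := corner_local cpo hj.
    have [//|//] : cunit l a \/ cunit l a.
    by apply: (cunit_sum (corn_eid l) ha hc1 hu ha hc2); exists i.
  case: nz => y /lead [b hb ->].
  suff -> : x0 = 0 by rewrite mulr0.
  by rewrite -(cornl hx0) -h2 -mulrA mulrBl (cornl hx0) ej subrr mulr0.
have [i hi [ia ai]] := ua.
have genx y : corner l (~~ l) y -> exists2 b, corner l l b & y = b * x.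
  move=> /lead [b hb ->]; exists (b * i); first exact: (cornM hb hi).
  by rewrite ex mulrA -[b * i * a]mulrA ia (cornr hb).
have gx : lgen l (x%:M : 'M[A]_1).
  apply/lgen1; rewrite scal1; split=> // y /genx [b hb ->]; exists b.
  by rewrite (cornl hb).
have hux : corner l (~~ l) (u * x) by exact: (cornM hu hx).
exists x%:M, (u * x)%:M; split.
- split=> // -[|k] f' gf' //; case: nz; apply/lgen0; by exists f'.
- split.
    split.
      by move=> b j; rewrite mxE; case: split => k; rewrite !ord1 scal1.
    move=> y /hgen [s [t ->]].
    exists (col_mx (eid (~~ l) * t * eid (~~ l))%:M (eid (~~ l) * s * eid (~~ l))%:M : 'cV_(1 + 1)).
      by move=> b j; rewrite mxE; case: split => k; rewrite !ord1 scal1; apply: corn_mid.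
    rewrite mul_row_col !mxE !big_ord1 !scal1 !mulrA (cornr hux) (cornr hx).
    by rewrite addrC.
  move=> m' g' gg'; rewrite ltnNge; apply/negP => le; apply: nrc.
  have [m'' le'' [g'' mg'']] := exists_rmin gg'.
  by apply/(right_cyclic_rmin mg''); apply: leq_trans le'' le.
- exact: mxin_scal.
apply/nohom_ttP => //.
- by move=> b j; rewrite mxE; case: split => k; rewrite !ord1 scal1.
- exact: mxin_scal.
move=> M hM.
pose y := M 0 (lshift 1 0); pose z := M 0 (rshift 1 0).
have hy : corner l (~~ l) y by apply: hM.
have hz : corner l (~~ l) z by apply: hM.
have [y' hy' ey] := genx y hy; have [z' hz' ez] := genx z hz.
(* With H0 = z' + s, the two entries H0 u x and H0 x miss the targets y' x and z' x by r x and - s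
   x, and both errors are right multiples of x because r and s lie in R_x. *)
have /hR [r [s [[hr [br er]] [[hs [bs es]] e0]]]] : corner l l (y' - z' * u).
  by apply: cornD => //; apply: cornN; exact: (cornM hz' hu).
exists (z' + s)%:M, (row_mx (eid (~~ l) * br * eid (~~ l))%:M (- (eid (~~ l) * bs * eid (~~ l)))%:M); split.
- by apply: mxin_scal; apply: cornD.
- move=> b j; rewrite mxE; case: split => k; rewrite !ord1 scal1; first exact: corn_mid.
  by apply: cornN; apply: corn_mid.
apply/matrixP=> b j; rewrite ord1 mul_mx_row mul_mx_row add_row_mx mxE.
have er' : x * (eid (~~ l) * br * eid (~~ l)) = r * x by rewrite !mulrA (cornr hx) -er.
have es' : x * (eid (~~ l) * bs * eid (~~ l)) = s * x by rewrite !mulrA (cornr hx) -es.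
case: (split_ordP j) => k ->; rewrite !ord1 !mxE !big_ord1 !scal1.
  rewrite -/y er' ey mulrA -mulrDl; congr (_ * _).
  by rewrite mulrDl -addrA [s * u + r]addrC -e0 addrC subrK.
by rewrite -/z mulrN es' ez -mulrBl addrK.
Qed.

(** The left-right mirror of [condL_pair]: x generates on the right and the column (x, x u) on the
    left. *)
Lemma condR_pair : condR (eid l) (eid (~~ l)) -> ~ left_cyclic (eid l) (eid (~~ l)) ->
  exists x g : 'M[A]_1, [/\ rmin l x, lmin l (col_mx x g), mxin l (~~ l) g &
    nohom (tt l x) (shift (tt l (col_mx x g)))].
Proof.
move=> [[x0 [hx0 gx0]] [x [u [hx [hu [hR hgen]]]]]] nlc.
have nz : ~ eAe'_zero (eid l) (eid (~~ l)) by move/zero_cyclic => [/nlc].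
have lead y : corner l (~~ l) y -> exists2 a, corner (~~ l) (~~ l) a & y = x0 * a.
  move=> /gx0 [a ->]; exists (eid (~~ l) * a * eid (~~ l)); first exact: corn_mid.
  by rewrite !mulrA (cornr hx0).
have [a ha ex] := lead x hx.
have ua : cunit (~~ l) a.
  have /hgen [s [t e0]] := hx0.
  have hs : corner l (~~ l) (eid l * s * x0) by rewrite !mulrA eidK // -[in RHS]mulrA (cornr hx0).
  have ht : corner l (~~ l) (eid l * t * x0) by rewrite !mulrA eidK // -[in RHS]mulrA (cornr hx0).
  have [c1 hc1 ec1] := lead _ hs; have [c2 hc2 ec2] := lead _ ht.
  pose j := c1 * a * eid (~~ l) + c2 * a * u.
  have hj : corner (~~ l) (~~ l) j.
    by apply: cornD; [exact: (cornM (cornM hc1 ha) (corn_eid _))|exact: (cornM (cornM hc2 ha) hu)].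
  have ej : x0 * j = x0.
    by rewrite [RHS]e0 ex /j mulrDr -[c1 * a * _]mulrA (cornr ha) !mulrA -ec1 -ec2.
  have [[i hi [h1 h2]]|[i hi [h2 _]]] := corner_local cpo hj.
    have [//|//] : cunit (~~ l) a \/ cunit (~~ l) a.
    by apply: (cunit_sum hc1 ha (corn_eid _) hc2 ha hu); exists i.
  case: nz => y /lead [b hb ->].
  suff -> : x0 = 0 by rewrite mul0r.
  by rewrite -(cornr hx0) -h2 mulrA mulrBr (cornr hx0) ej subrr mul0r.
have [i hi [ia ai]] := ua.
have genx y : corner l (~~ l) y -> exists2 b, corner (~~ l) (~~ l) b & y = x * b.
  move=> /lead [b hb ->]; exists (i * b); first exact: (cornM hi hb).
  by rewrite ex -mulrA [a * _]mulrA ai (cornl hb).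
have gx : rgen l (x%:M : 'M[A]_1).
  apply/rgen1; rewrite scal1; split=> // y /genx [b hb ->]; exists b.
  by rewrite -mulrA (cornr hb).
have hxu : corner l (~~ l) (x * u) by exact: (cornM hx hu).
have hcol : mxin l (~~ l) (col_mx x%:M (x * u)%:M : 'M[A]_(1 + 1, 1)).
  by move=> b j; rewrite mxE; case: split => k; rewrite !ord1 scal1.
exists x%:M, (x * u)%:M; split.
- split=> // -[|k] f' gf' //; case: nz; apply/rgen0; by exists f'.
- split.
    split=> // y /hgen [s [t ->]].
    exists (row_mx (eid l * s * eid l)%:M (eid l * t * eid l)%:M : 'rV_(1 + 1)).
      by move=> b j; rewrite mxE; case: split => k; rewrite !ord1 scal1; apply: corn_mid.
    rewrite mul_row_col !mxE !big_ord1 !scal1.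
    by rewrite -[_ * eid l * x]mulrA (cornl hx) -[_ * eid l * (x * u)]mulrA (cornl hxu) !mulrA.
  move=> m' g' gg'; rewrite ltnNge; apply/negP => le; apply: nlc.
  have [m'' le'' [g'' mg'']] := exists_lmin gg'.
  by apply/(left_cyclic_lmin mg''); apply: leq_trans le'' le.
- exact: mxin_scal.
apply/nohom_ttP => //; first exact: mxin_scal.
move=> M hM.
pose y := M (lshift 1 0) 0; pose z := M (rshift 1 0) 0.
have hy : corner l (~~ l) y by apply: hM.
have hz : corner l (~~ l) z by apply: hM.
have [y' hy' ey] := genx y hy; have [z' hz' ez] := genx z hz.
have /hR [r [s [[hr [br er]] [[hs [bs es]] e0]]]] : corner (~~ l) (~~ l) (z' - u * y').
  by apply: cornD => //; apply: cornN; exact: (cornM hu hy').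
exists (col_mx (- (eid l * bs * eid l))%:M (eid l * br * eid l)%:M), (y' + s)%:M; split.
- move=> b j; rewrite mxE; case: split => k; rewrite !ord1 scal1; last exact: corn_mid.
  by apply: cornN; apply: corn_mid.
- by apply: mxin_scal; apply: cornD.
apply/matrixP=> b j; rewrite !ord1 !mul_col_mx add_col_mx mxE.
have er' : (eid l * br * eid l) * x = x * r by rewrite -mulrA (cornl hx) -er.
have es' : (eid l * bs * eid l) * x = x * s by rewrite -mulrA (cornl hx) -es.
case: (split_ordP b) => k ->; rewrite !ord1 !mxE !big_ord1 !scal1.
  by rewrite -/y mulNr es' ey mulrDr addrCA addNr addr0.
rewrite -/z er' ez -mulrA -mulrDr; congr (_ * _).
by rewrite mulrDr addrCA -e0 addrC subrK.
Qed.

(** A converse to [condL_pair] when [b] is invertible: p can be traded for x, so that x and q = u x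
    generate on the right, and eAe = R_x + R_x u comes from solving the extension condition for a
    well chosen pair. *)
Lemma condL_core x p q b c : left_gen (eid l) (eid (~~ l)) x ->
  corner l (~~ l) p -> corner l (~~ l) q ->
  (forall y, corner l (~~ l) y -> exists s t,
    [/\ corner (~~ l) (~~ l) s, corner (~~ l) (~~ l) t & y = p * s + q * t]) ->
  (forall y z, corner l (~~ l) y -> corner l (~~ l) z -> exists a h h',
    [/\ corner l l a, corner (~~ l) (~~ l) h, corner (~~ l) (~~ l) h' &
       y = a * p + x * h /\ z = a * q + x * h']) ->
  corner (~~ l) (~~ l) b -> corner (~~ l) (~~ l) c -> x = p * b + q * c -> cunit (~~ l) b ->
  condL (eid l) (eid (~~ l)).
Proof.
move=> [hx gx] hp hq gen ext hb hc ex [i hi [ib bi]].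
split; first by exists x.
have [u0 eu0] := gx q hq; pose u := eid l * u0 * eid l.
have hu : corner l l u by exact: corn_mid.
have eu : q = u * x by rewrite /u -mulrA (cornl hx).
have ep : p = (x - q * c) * i by rewrite ex addrK -mulrA bi (cornr hp).
exists x, u; split=> //; split=> //; split=> y; split.
- move=> hy.
  have hz : corner l (~~ l) (y * x) by exact: (cornM hy hx).
  (* In a x = (a p) b + (a q) c the two occurrences of y x c cancel for this choice, which puts [a]
     in R_x; the second entry puts y - a u in R_x. *)
  have [||a [h [h' [ha hh hh' [ey ez]]]]] := ext (- (y * x * c * i)) (y * x).
  - by apply: cornN; exact: (cornM (cornM hz hc) hi).
  - by [].
  have Ra : Rset (eid l) (eid (~~ l)) x a.
    split=> //; exists (- (h * b + h' * c)).
    have e1' : a * p = - (y * x * c * i) - x * h by rewrite ey addrK.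
    have e2' : a * q = y * x - x * h' by rewrite ez addrK.
    have hH := cornD (cornM hh hb) (cornM hh' hc).
    rewrite -[RHS]mulrA (cornr (cornN hH)) mulrN mulrDr [in LHS]ex mulrDr !mulrA e1' e2' !mulrBl mulNr.
    rewrite -[y * x * c * i * b]mulrA ib -[y * x * c * eid _]mulrA (cornr hc).
    by rewrite addrACA addNr add0r opprD.
  exists (y - a * u), a; split.
    split; first by apply: cornD => //; apply: cornN; exact: (cornM ha hu).
    exists h'; rewrite -mulrA (cornr hh') mulrBl -mulrA -eu ez.
    by rewrite addrC addKr.
  by split=> //; rewrite subrK.
- by move=> [r [s [[hr _] [[hs _] ->]]]]; apply: cornD => //; exact: (cornM hs hu).
- move=> /gen [s [t [hs ht ->]]]; exists (i * s), (t - c * i * s).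
  rewrite -eu -[x * _ * _]mulrA (cornr (cornM hi hs)).
  rewrite -[q * _ * _]mulrA (cornr (cornD ht (cornN (cornM (cornM hc hi) hs)))).
  by rewrite [in LHS]ep mulrBr !mulrBl !mulrA addrAC addrA.
have cx z w : corner l (~~ l) z -> corner l (~~ l) (z * w * eid (~~ l)).
  by move=> hz; rewrite !mulrA (cornl hz) -!mulrA eidK.
by move=> [s [t ->]]; apply: cornD; apply: cx => //; exact: (cornM hu hx).
Qed.

Lemma condR_core x p q b c : right_gen (eid l) (eid (~~ l)) x ->
  corner l (~~ l) p -> corner l (~~ l) q ->
  (forall y, corner l (~~ l) y -> exists s t, [/\ corner l l s, corner l l t & y = s * p + t * q]) ->
  (forall y z, corner l (~~ l) y -> corner l (~~ l) z -> exists a h h',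
    [/\ corner (~~ l) (~~ l) a, corner l l h, corner l l h' &
       y = p * a + h * x /\ z = q * a + h' * x]) ->
  corner l l b -> corner l l c -> x = b * p + c * q -> cunit l b ->
  condR (eid l) (eid (~~ l)).
Proof.
move=> [hx gx] hp hq gen ext hb hc ex [i hi [ib bi]].
split; first by exists x.
have [u0 eu0] := gx q hq; pose u := eid (~~ l) * u0 * eid (~~ l).
have hu : corner (~~ l) (~~ l) u by exact: corn_mid.
have eu : q = x * u by rewrite /u !mulrA (cornr hx).
have ep : p = i * (x - c * q) by rewrite ex addrK mulrA ib (cornl hp).
exists x, u; split=> //; split=> //; split=> y; split.
- move=> hy.
  have hz : corner l (~~ l) (x * y) by exact: (cornM hx hy).
  have [||a [h [h' [ha hh hh' [ey ez]]]]] := ext (- (i * c * x * y)) (x * y).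
  - by apply: cornN; exact: (cornM (cornM (cornM hi hc) hx) hy).
  - by [].
  have La : Lset (eid l) (eid (~~ l)) x a.
    split=> //; exists (- (b * h + c * h')).
    have e1' : p * a = - (i * c * x * y) - h * x by rewrite ey addrK.
    have e2' : q * a = x * y - h' * x by rewrite ez addrK.
    have hH := cornD (cornM hb hh) (cornM hc hh').
    rewrite (cornl (cornN hH)) mulNr mulrDl [in LHS]ex mulrDl -!mulrA e1' e2' !mulrBr mulrN.
    rewrite !mulrA bi (cornl hc).
    by rewrite addrACA addNr add0r opprD.
  exists (y - u * a), a; split.
    split; first by apply: cornD => //; apply: cornN; exact: (cornM hu ha).
    exists h'; rewrite (cornl hh') mulrBr mulrA -eu ez.
    by rewrite addrC addKr.
  by split=> //; rewrite subrK.
- by move=> [r [s [[hr _] [[hs _] ->]]]]; apply: cornD => //; exact: (cornM hu hs).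
- move=> /gen [s [t [hs ht ->]]]; exists (s * i), (t - s * i * c).
  rewrite -[_ * _ * x * u]mulrA -eu (cornl (cornM hs hi)).
  rewrite (cornl (cornD ht (cornN (cornM (cornM hs hi) hc)))).
  by rewrite [in LHS]ep mulrBl !mulrBr !mulrA addrAC addrA.
have cx z w : corner l (~~ l) z -> corner l (~~ l) (eid l * w * z).
  by move=> hz; rewrite !mulrA eidK // -[in RHS]mulrA (cornr hz).
move=> [s [t ->]]; apply: cornD; first exact: cx.
by rewrite -mulrA; apply: cx; exact: (cornM hx hu).
Qed.

(** Let x = p b + q c in terms of the two right generators. [condL_core] applies if b or c is a
    unit. Otherwise p = p t + q (...) with t = al b + ga c not a unit, so p is a right multiple of q
    and one generator suffices, against minimality. *)
Lemma pair_condL (x : 'M[A]_1) (g : 'rV[A]_2) : lmin l x -> rmin l g ->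
  nohom (tt l g) (shift (tt l x)) -> condL (eid l) (eid (~~ l)).
Proof.
move=> [gx _] mg nh; have [[hg gg] _] := mg; have [hx _] := gx.
have nrc : ~ right_cyclic (eid l) (eid (~~ l)) by move/(right_cyclic_rmin mg).
move/(nohom_ttP hg hx): nh => ext0.
pose p := g 0 0; pose q := g 0 1; pose x0 := x 0 0.
have hp : corner l (~~ l) p by apply: hg.
have hq : corner l (~~ l) q by apply: hg.
have hx0 : corner l (~~ l) x0 by apply: hx.
have gx0 := proj1 (lgen1 x) gx.
have two (F : 'I_2 -> A) : \sum_i F i = F 0 + F 1.
  by rewrite big_ord_recl big_ord1; congr (_ + F _); apply/val_inj.
have gen y : corner l (~~ l) y -> exists s t,
    [/\ corner (~~ l) (~~ l) s, corner (~~ l) (~~ l) t & y = p * s + q * t].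
  by move=> /gg [c hc ->]; exists (c 0 0), (c 1 0); rewrite mxE two; split.
have ext y z : corner l (~~ l) y -> corner l (~~ l) z -> exists a h h',
    [/\ corner l l a, corner (~~ l) (~~ l) h, corner (~~ l) (~~ l) h' &
       y = a * p + x0 * h /\ z = a * q + x0 * h'].
  move=> hy hz; have [|H0 [H1 [i0 i1 eM]]] := ext0 (\row_j (if j == 0 then y else z)).
    by move=> i j; rewrite mxE; case: ifP.
  exists (H0 0 0), (H1 0 0), (H1 0 1); split=> //.
  by split; [have /rowP/(_ 0) := eM|have /rowP/(_ 1) := eM]; rewrite !mxE !big_ord1.
have [b [c [hb hc exb]]] := gen x0 hx0.
have [[u hu eu]|[u hu eu]] : cunit (~~ l) b \/ cunit (~~ l) c; last first.
- apply: (@condL_core x0 q p c b) => //.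
  + by move=> y /gen [s [t [hs ht ->]]]; exists t, s; split=> //; rewrite addrC.
  + move=> y z hy hz; have [a [h [h' [ha hh hh' [ey ez]]]]] := ext z y hz hy.
    by exists a, h', h.
  + by rewrite exb addrC.
  by exists u.
- by apply: (@condL_core x0 p q b c) => //; exists u.
have [p0 ep0] := proj2 gx0 p hp; pose p' := eid l * p0 * eid l.
have hp' : corner l l p' by exact: corn_mid.
have ep : p = p' * x0 by rewrite /p' -mulrA (cornl hx0).
have [al [be [hal hbe e1']]] := gen _ (cornM hp' hp).
have [ga [de [hga hde e2']]] := gen _ (cornM hp' hq).
pose t := al * b * eid (~~ l) + ga * c * eid (~~ l).
have ht : corner (~~ l) (~~ l) t.
  by apply: cornD; [exact: (cornM (cornM hal hb) (corn_eid _))|exact: (cornM (cornM hga hc) (corn_eid _))].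
have et : p = p * t + q * (be * b + de * c).
  rewrite {1}ep {1}exb mulrDr !mulrA e1' e2' !mulrDl !mulrDr /t.
  by rewrite -[al * b * _]mulrA (cornr hb) -[ga * c * _]mulrA (cornr hc) !mulrA addrACA.
have [[i hi [h1 h2]]|[i hi [h2 _]]] := corner_local cpo ht.
  by apply: (cunit_sum hal hb (corn_eid _) hga hc (corn_eid _)); exists i.
case: nrc; exists q; split=> // y /gen [s [t' [hs ht' ->]]].
have eq : p = q * ((be * b + de * c) * i).
  have -> : p = p * (eid (~~ l) - t) * i by rewrite -mulrA h2 (cornr hp).
  by rewrite mulrBr (cornr hp) {1}et addrC addKr !mulrA.
exists ((be * b + de * c) * i * s + t').
rewrite -mulrA (cornr (cornD (cornM (cornM (cornD (cornM hbe hb) (cornM hde hc)) hi) hs) ht')).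
by rewrite mulrDr [in RHS]mulrA -eq.
Qed.

Lemma pair_condR (x : 'M[A]_1) (f : 'cV[A]_2) : rmin l x -> lmin l f ->
  nohom (tt l x) (shift (tt l f)) -> condR (eid l) (eid (~~ l)).
Proof.
move=> [gx _] mf nh; have [[hf gf] _] := mf; have [hx _] := gx.
have nlc : ~ left_cyclic (eid l) (eid (~~ l)) by move/(left_cyclic_lmin mf).
move/(nohom_ttP hx hf): nh => ext0.
pose p := f 0 0; pose q := f 1 0; pose x0 := x 0 0.
have hp : corner l (~~ l) p by apply: hf.
have hq : corner l (~~ l) q by apply: hf.
have hx0 : corner l (~~ l) x0 by apply: hx.
have gx0 := proj1 (rgen1 x) gx.
have two (F : 'I_2 -> A) : \sum_i F i = F 0 + F 1.
  by rewrite big_ord_recl big_ord1; congr (_ + F _); apply/val_inj.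
have gen y : corner l (~~ l) y -> exists s t,
    [/\ corner l l s, corner l l t & y = s * p + t * q].
  by move=> /gf [c hc ->]; exists (c 0 0), (c 0 1); rewrite mxE two; split.
have ext y z : corner l (~~ l) y -> corner l (~~ l) z -> exists a h h',
    [/\ corner (~~ l) (~~ l) a, corner l l h, corner l l h' &
       y = p * a + h * x0 /\ z = q * a + h' * x0].
  move=> hy hz; have [|H0 [H1 [i0 i1 eM]]] := ext0 (\col_j (if j == 0 then y else z)).
    by move=> i j; rewrite mxE; case: ifP.
  exists (H1 0 0), (H0 0 0), (H0 1 0); split=> //.
  by split; [have /colP/(_ 0) := eM|have /colP/(_ 1) := eM]; rewrite !mxE !big_ord1 addrC.
have [b [c [hb hc exb]]] := gen x0 hx0.
have [[u hu eu]|[u hu eu]] : cunit l b \/ cunit l c; last first.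
- apply: (@condR_core x0 q p c b) => //.
  + by move=> y /gen [s [t [hs ht ->]]]; exists t, s; split=> //; rewrite addrC.
  + move=> y z hy hz; have [a [h [h' [ha hh hh' [ey ez]]]]] := ext z y hz hy.
    by exists a, h', h.
  + by rewrite exb addrC.
  by exists u.
- by apply: (@condR_core x0 p q b c) => //; exists u.
have [p0 ep0] := proj2 gx0 p hp; pose p' := eid (~~ l) * p0 * eid (~~ l).
have hp' : corner (~~ l) (~~ l) p' by exact: corn_mid.
have ep : p = x0 * p' by rewrite /p' !mulrA (cornr hx0).
have [al [be [hal hbe e1']]] := gen _ (cornM hp hp').
have [ga [de [hga hde e2']]] := gen _ (cornM hq hp').
pose t := eid l * b * al + eid l * c * ga.
have ht : corner l l t.
  by apply: cornD; [exact: (cornM (cornM (corn_eid _) hb) hal)|exact: (cornM (cornM (corn_eid _) hc) hga)].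
have et : p = t * p + (b * be + c * de) * q.
  rewrite {1}ep {1}exb mulrDl -!mulrA e1' e2' !mulrDr !mulrDl /t.
  by rewrite (cornl hb) (cornl hc) !mulrA addrACA.
have [[i hi [h1 h2]]|[i hi [_ h2]]] := corner_local cpo ht.
  by apply: (cunit_sum (corn_eid _) hb hal (corn_eid _) hc hga); exists i.
case: nlc; exists q; split=> // y /gen [s [t' [hs ht' ->]]].
have eq : p = i * (b * be + c * de) * q.
  have -> : p = i * ((eid l - t) * p) by rewrite mulrA h2 (cornl hp).
  by rewrite mulrBl (cornl hp) {1}et addrC addKr !mulrA.
exists (s * (i * (b * be + c * de)) + t').
rewrite mulrDr mulrDl (cornl (cornM hs (cornM hi (cornD (cornM hb hbe) (cornM hc hde))))).
by rewrite (cornl ht') {1}eq !mulrA.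
Qed.
End Fixed.
End Conditions.

(** * The shape of P(A) *)

Section Shape.
Variables (K : fieldType) (A : falgType K) (e1 e2 : A) (R : realType).
Hypotheses (cpo : complete_prim_orth e1 e2) (bas : basic2 e1 e2).
Local Notation cpx := (cpx A).
Local Notation eid := (eid e1 e2).
Local Notation isoK := (isoK e1 e2).
Local Notation two_term := (two_term e1 e2).
Local Notation silting_pair := (basic_two_silting e1 e2).
Local Notation gvec := (gvec R).
Local Notation lmin := (@lmin K A e1 e2).
Local Notation rmin := (@rmin K A e1 e2).
Local Notation PA := (PA R e1 e2).
Local Notation pt l a b := (a *: vP R l + b *: vP R (~~ l)).

Lemma pt_comb l (p q a b c d : R) :
  p *: pt l a b + q *: pt l c d = pt l (p * a + q * c) (p * b + q * d).
Proof. by rewrite !scalerDr !scalerA addrACA -!scalerDl. Qed.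

Lemma silting_coord l T1 T2 : silting_pair T1 T2 -> exists a b c d : int,
  [/\ gvec T1 = pt l a%:~R b%:~R, gvec T2 = pt l c%:~R d%:~R &
      a * d - b * c = 1 \/ a * d - b * c = -1].
Proof.
move=> /(silting_unimodular R cpo bas) [a [b [c [d [h1 h2 dt]]]]]; case: l; last by exists a, b, c, d.
exists b, a, d, c; split; first by rewrite h1 addrC.
  by rewrite h2 addrC.
by case: dt => dt; [right|left]; lia.
Qed.

Lemma silting_indep T1 T2 (a b c d : R) : silting_pair T1 T2 ->
  a *: gvec T1 + b *: gvec T2 = c *: gvec T1 + d *: gvec T2 -> a = c /\ b = d.
Proof.
move=> /(silting_coord false) [p [q [r [s [-> -> dt]]]]]; rewrite !pt_comb => /vP_injl [h1 h2].
have dt' : (p%:~R * s%:~R - q%:~R * r%:~R) ^+ 2 = 1 :> R.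
  by rewrite -!rmorphM -rmorphB /=; case: dt => -> /=; rewrite ?rmorphN ?sqrrN /= expr1n.
move: (p%:~R : R) (q%:~R : R) (r%:~R : R) (s%:~R : R) dt' h1 h2 => p' q' r' s' dt' h1 h2.
have d0 : p' * s' - q' * r' != 0.
  by apply/eqP => z; move: dt'; rewrite z expr0n /= => /esym /eqP; rewrite oner_eq0.
by split; apply: (mulIf d0); [transitivity (s' * (a * p' + b * r') - r' * (a * q' + b * s')); [ring|]|
  transitivity (p' * (a * q' + b * s') - q' * (a * p' + b * r')); [ring|]]; rewrite h1 h2; ring.
Qed.

(* By [noncrossing] the simplices of PA have disjoint interiors, so a single one decides membership on its cone. *)
Lemma PA_cone U1 U2 (c1 c2 : R) : silting_pair U1 U2 -> 0 <= c1 -> 0 <= c2 ->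
  PA (c1 *: gvec U1 + c2 *: gvec U2) <-> c1 + c2 <= 1.
Proof.
move=> sU c10 c20; split=> [[V1 [V2 [sV [a [b [c [a0 [b0 [c0 [s e]]]]]]]]]]|le]; last first.
  exists U1, U2; split=> //; exists (1 - c1 - c2), c1, c2; split; first by rewrite -addrA -opprD subr_ge0.
  by do !split=> //; ring.
have [u1 u2 _] := pair_two_term sU; have [v1 v2 _] := pair_two_term sV.
have [n1 n2] := noncrossing cpo sU sV c10 c20 b0 c0 e.
have red w V : 0 <= w -> two_term V -> (0 < w -> isoK V U1 \/ isoK V U2) -> exists w1 w2 : R,
    w1 + w2 = w /\ w *: gvec V = w1 *: gvec U1 + w2 *: gvec U2.
  move=> w0 tV h; have [->|nw] := eqVneq w 0; first by exists 0, 0; rewrite addr0 !scale0r addr0.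
  have [|i|i] := h; first by rewrite lt0r nw.
    by exists w, 0; rewrite addr0 scale0r addr0 (gvec_isoK R cpo bas tV u1 i).
  by exists 0, w; rewrite add0r scale0r add0r (gvec_isoK R cpo bas tV u2 i).
have [b1 [b2 [sb eb]]] := red _ _ b0 v1 n1; have [d1 [d2 [sd ed]]] := red _ _ c0 v2 n2.
move: e; rewrite eb ed addrACA -!scalerDl => /(silting_indep sU) [-> ->].
by lra.
Qed.

(** A convex P(A) lies on one side of the line through any edge [U1, U2]. Join the given point to
    the midpoint of the edge: near the midpoint the segment runs inside the cone of the pair, where
    [PA_cone] applies. *)
Lemma PA_convex_bound U1 U2 (c1 c2 : R) : g_convex R e1 e2 -> silting_pair U1 U2 ->
  PA (c1 *: gvec U1 + c2 *: gvec U2) -> c1 + c2 <= 1.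
Proof.
move=> cv sU px.
have py : PA (2^-1 *: gvec U1 + 2^-1 *: gvec U2) by apply/PA_cone => //; lra.
(* With this t, each t |c_i| is at most 1/4 and (1 - t) / 2 is at least 3/8, so both coefficients at
   parameter t are positive. *)
pose N := 4 * (1 + `|c1| + `|c2|); pose t := N^-1.
have n1 := normr_ge0 c1; have n2 := normr_ge0 c2.
have N4 : 4 <= N by rewrite /N; lra.
have t0 : 0 < t by rewrite invr_gt0; lra.
have tN : t * N = 1 by rewrite mulVf //; apply/eqP; lra.
have b1 : - `|c1| <= c1 by rewrite lerNl -normrN ler_norm.
have b2 : - `|c2| <= c2 by rewrite lerNl -normrN ler_norm.
have tc1 : - (t * `|c1|) <= t * c1 by rewrite -mulrN ler_pM2l.
have tc2 : - (t * `|c2|) <= t * c2 by rewrite -mulrN ler_pM2l.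
have m1 : 0 <= t * `|c1| by rewrite mulr_ge0 // ltW.
have m2 : 0 <= t * `|c2| by rewrite mulr_ge0 // ltW.
have tN' : 4 * t + 4 * (t * `|c1|) + 4 * (t * `|c2|) = 1 by transitivity (t * N) => [|//]; rewrite /N; ring.
have t01 : 0 <= t <= 1 by apply/andP; split; lra.
have := cv _ _ t px py t01.
have -> : t *: (c1 *: gvec U1 + c2 *: gvec U2) + (1 - t) *: (2^-1 *: gvec U1 + 2^-1 *: gvec U2) =
   (t * c1 + (1 - t) / 2) *: gvec U1 + (t * c2 + (1 - t) / 2) *: gvec U2.
  by rewrite !scalerDr !scalerA addrACA -!scalerDl.
move/PA_cone => h.
have le : t * (c1 + c2) <= t * 1 by rewrite mulrDr mulr1; have := h sU; lra.
by rewrite ler_pM2l in le.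
Qed.

Section Quadrant.
Variable l : bool.

Lemma PA_left k (f : 'cV[A]_k) (a b : R) : lmin l f -> b <= 0 -> 0 <= a + k%:R * b ->
  PA (pt l a b) <-> a + k%:R * b - b <= 1.
Proof.
move=> mf b0 c0; have sU := pair_left R cpo bas mf.
have := PA_cone sU c0 (_ : 0 <= - b); rewrite oppr_ge0 => /(_ b0).
rewrite gvec_stalk0 gvec_ttE pt_comb.
by have -> : pt l ((a + k%:R * b) * 1 + - b * k%:R) ((a + k%:R * b) * 0 + - b * - 1%:R) = pt l a b
  by congr (_ *: _ + _ *: _); ring.
Qed.

Lemma PA_right m (g : 'rV[A]_m) (a b : R) : rmin l g -> 0 <= a -> 0 <= - b - m%:R * a ->
  PA (pt l a b) <-> a - b - m%:R * a <= 1.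
Proof.
move=> mg a0 c0; have sU := pair_right R cpo bas mg.
have := PA_cone sU a0 c0; rewrite gvec_stalk1 gvec_ttE pt_comb.
have -> : pt l (a * 1%:R + (- b - m%:R * a) * 0) (a * - m%:R + (- b - m%:R * a) * -1) = pt l a b
  by congr (_ *: _ + _ *: _); ring.
by rewrite addrA.
Qed.

Lemma PA_tt_left k (f : 'cV[A]_k) : lmin l f -> PA (pt l k%:R (-1)).
Proof. by move=> mf; apply/(PA_left mf); rewrite ?lerN10 //; lra. Qed.

Lemma PA_tt_right m (g : 'rV[A]_m) : rmin l g -> PA (pt l 1 (- m%:R)).
Proof. by move=> mg; apply/(PA_right mg) => //; lra. Qed.

Lemma PA_zero (a b : R) : eAe'_zero (eid l) (eid (~~ l)) -> 0 <= a -> b <= 0 ->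
  PA (pt l a b) <-> a - b <= 1.
Proof.
move=> z a0 b0; have [k0 [f0 h0]] := exists_lgen cpo l; have [k _ [f mf]] := exists_lmin h0.
have ek := proj1 (zero_lmin mf) z; subst k.
by have := PA_left (a := a) (b := b) mf b0; rewrite mul0r addr0; apply.
Qed.

Lemma PA_cyclic (a b : R) : eAe'_nonzero (eid l) (eid (~~ l)) ->
  left_cyclic (eid l) (eid (~~ l)) -> right_cyclic (eid l) (eid (~~ l)) -> 0 <= a -> b <= 0 ->
  PA (pt l a b) <-> a <= 1 /\ - b <= 1.
Proof.
move=> [y [hy ny]] lc rc a0 b0.
have nz : ~ eAe'_zero (eid l) (eid (~~ l)) by move/(_ y hy).
have [k0 [f0 h0]] := exists_lgen cpo l; have [k _ [f mf]] := exists_lmin h0.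
have [m0 [g0 h0']] := exists_rgen cpo l; have [m _ [g mg]] := exists_rmin h0'.
have := proj1 (left_cyclic_lmin cpo mf) lc; have := proj1 (right_cyclic_rmin cpo mg) rc.
have := fun h => nz (proj2 (zero_lmin mf) h); have := fun h => nz (proj2 (zero_rmin mg) h).
case: m g mg {h0' g0} => [|[|//]] g mg nz1; first by case: nz1.
case: k f mf {h0 f0} => [|[|//]] f mf nz2 _ _; first by case: nz2.
have [h|h] := lerP 0 (a + b).
  rewrite (PA_left mf) ?mul1r //; split=> [|[]]; lra.
rewrite (PA_right mg) ?mul1r //; last lra.
by split=> [|[]]; lra.
Qed.

(** The three cones spanned by neighbours among (1, 0), (1, -1), (1, -2), (0, -1) cover the
    quadrant, and each of them belongs to a silting pair. *)
Lemma PA_condL (a b : R) : condL (eid l) (eid (~~ l)) -> ~ right_cyclic (eid l) (eid (~~ l)) ->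
  0 <= a -> b <= 0 -> PA (pt l a b) <-> a <= 1 /\ - a - b <= 1.
Proof.
move=> cL nrc a0 b0; have [x [g [mx mg hg nh]]] := condL_pair cpo cL nrc.
have [h|h] := lerP 0 (a + b).
  rewrite (PA_left mx) ?mul1r //; split=> [|[]]; lra.
have [h'|h'] := lerP (2 * a + b) 0.
  by rewrite (PA_right mg) //=; [split=> [|[]]; lra|lra].
have sU := pair_L R cpo bas mx mg hg nh.
(* The coordinates of (a, b) in the basis (1, -1), (1, -2). *)
have := PA_cone (c1 := 2 * a + b) (c2 := - a - b) sU.
rewrite !gvec_ttE pt_comb.
have -> : pt l ((2 * a + b) * 1%:R + (- a - b) * 1%:R) ((2 * a + b) * - 1%:R + (- a - b) * - (1 + 1)%:R) = pt l a b
  by congr (_ *: _ + _ *: _); ring.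
by move=> ->; lra.
Qed.

Lemma PA_condR (a b : R) : condR (eid l) (eid (~~ l)) -> ~ left_cyclic (eid l) (eid (~~ l)) ->
  0 <= a -> b <= 0 -> PA (pt l a b) <-> - b <= 1 /\ a + b <= 1.
Proof.
move=> cR nlc a0 b0; have [x [g [mx mg hg nh]]] := condR_pair cpo cR nlc.
have [h|h] := lerP (a + b) 0.
  rewrite (PA_right mx) ?mul1r //; [split=> [|[]]; lra|lra].
have [h'|h'] := lerP 0 (a + 2 * b).
  by rewrite (PA_left mg) //=; split=> [|[]]; lra.
have sU := pair_R R cpo bas mx mg hg nh.
have := PA_cone (c1 := a + b) (c2 := - 2 * b - a) sU.
rewrite !gvec_ttE pt_comb.
have -> : pt l ((a + b) * (1 + 1)%:R + (- 2 * b - a) * 1%:R) ((a + b) * - 1%:R + (- 2 * b - a) * - 1%:R) = pt l a b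
  by congr (_ *: _ + _ *: _); ring.
by move=> ->; lra.
Qed.

(** If V1 were outside the quadrant, some t (a, b) + V1 in the open cone of the pair would lie on
    the ray of [P_l] or of -[P_l'], which is an edge of the cone of A, respectively of A[1]. By
    [noncrossing] both V1 and V2 would be summands there, and that cone misses the open quadrant. *)
Lemma cone_quadrant V1 V2 (w1 w2 a b a1 b1 : R) : silting_pair V1 V2 -> 0 < w1 -> 0 <= w2 ->
  w1 *: gvec V1 + w2 *: gvec V2 = pt l a b -> 0 < a -> b < 0 -> gvec V1 = pt l a1 b1 ->
  0 <= a1 /\ b1 <= 0.
Proof.
move=> sV w10 w20 ez a0 b0 e1'.
have [a2 [b2 e2']] : exists a2 b2 : R, gvec V2 = pt l a2 b2.
  by have [_ [_ [c [d [_ h _]]]]] := silting_coord l sV; exists c%:~R, d%:~R.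
move: (ez); rewrite e1' e2' pt_comb => /vP_injl [ea eb].
have [z|w2n] := eqVneq w2 0.
  move: ea eb; rewrite z !mul0r !addr0 => ea eb; split.
    by rewrite -(ler_pM2l w10) mulr0 ea ltW.
  by rewrite -(ler_pM2l w10) mulr0 eb ltW.
have w2p : 0 < w2 by rewrite lt0r w2n.
have [v1 v2 _] := pair_two_term sV.
(* moving from an interior point of the cone towards [V1] stays inside the cone *)
have mv t : t *: pt l a b + gvec V1 = (1 + t * w1) *: gvec V1 + (t * w2) *: gvec V2.
  by rewrite -ez scalerDr !scalerA scalerDl scale1r addrAC [gvec V1 + _]addrC.
have ray t U1 U2 c : 0 < t -> 0 <= c -> silting_pair U1 U2 ->
    t *: pt l a b + gvec V1 = c *: gvec U1 ->
    (gvec V1 = gvec U1 \/ gvec V1 = gvec U2) /\ (gvec V2 = gvec U1 \/ gvec V2 = gvec U2).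
  move=> t0 c0 sU; rewrite mv => e; have [u1 u2 _] := pair_two_term sU.
  have p1 : 0 < 1 + t * w1 by rewrite addr_gt0 // mulr_gt0.
  have p2 : 0 < t * w2 by rewrite mulr_gt0.
  have [|n1 n2] := noncrossing cpo (a := c) (b := 0) sU sV c0 (lexx 0) (ltW p1) (ltW p2).
    by rewrite scale0r addr0.
  by split; [case: (n1 p1)|case: (n2 p2)] => i; [left|right|left|right]; apply: (gvec_isoK R cpo bas _ _ i).
have q1 := mulr_gt0 w10; have q2 := mulr_gt0 w2p.
(* The sign of the determinant of (a, b) and (a1, b1) decides which of the two rays can be
   crossed. *)
have [D|D] := lerP (a * b1) (a1 * b); last first.
  have [|b1p] := lerP b1 0; first by move=> h; split=> //; nra.
  pose t := b1 / - b; have t0 : 0 < t by rewrite divr_gt0 ?oppr_gt0.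
  have tb : t * b = - b1 by rewrite /t invrN mulrN mulNr divfK //; apply/eqP; lra.
  have [||n1 n2] := ray t (stalk l 0) (stalk (~~ l) 0) (t * a + a1) t0 _ (pair_A R cpo bas l).
  - by rewrite -(pmulr_rge0 _ (_ : 0 < - b)) ?oppr_gt0 //; nra.
  - rewrite e1' gvec_stalk0 -[pt l a1 b1]scale1r pt_comb tb scalerDr !scalerA; congr (_ *: _ + _ *: _); ring.
  have g2 : gvec (stalk (~~ l) 0 : cpx) = pt l 0 1 by rewrite gvec_stalk0 negbK addrC.
  rewrite e1' e2' gvec_stalk0 g2 in n1 n2.
  case: n1 => /vP_injl [h1 h2]; case: n2 => /vP_injl [h3 h4]; nra.
have [a1p|a1n] := lerP 0 a1; first by split=> //; nra.
pose t := - a1 / a; have t0 : 0 < t by rewrite divr_gt0 ?oppr_gt0.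
have ta : t * a = - a1 by rewrite /t divfK //; apply/eqP; lra.
have [||n1 n2] := ray t (stalk (~~ l) (-1)) (stalk l (-1)) (- (t * b + b1)) t0 _
    (eq_ind _ (fun l' => silting_pair (stalk (~~ l) (-1)) (stalk l' (-1))) (pair_A1 R cpo bas (~~ l)) _ (negbK l)).
- by rewrite -(pmulr_rge0 _ a0); nra.
- rewrite e1' gvec_stalk1 -[pt l a1 b1]scale1r pt_comb ta scalerDr !scalerA; congr (_ *: _ + _ *: _); ring.
have g2 : gvec (stalk l (-1) : cpx) = pt l (-1) 0.
  by have := gvec_stalk1 A R (~~ l); rewrite negbK addrC.
rewrite e1' e2' gvec_stalk1 g2 in n1 n2.
case: n1 => /vP_injl [h1 h2]; case: n2 => /vP_injl [h3 h4]; nra.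
Qed.

End Quadrant.
End Shape.

(** * Recovering (L) and (R) from the shape *)

Section Decide.
Variables (K : fieldType) (A : falgType K) (e1 e2 : A) (R : realType).
Hypotheses (cpo : complete_prim_orth e1 e2) (bas : basic2 e1 e2).
Local Notation eid := (eid e1 e2).
Local Notation isoK := (isoK e1 e2).
Local Notation nohom := (nohom e1 e2).
Local Notation silting_pair := (basic_two_silting e1 e2).
Local Notation gvec := (gvec R).
Local Notation lmin := (@lmin K A e1 e2).
Local Notation rmin := (@rmin K A e1 e2).
Local Notation PA := (PA R e1 e2).
Local Notation pt l a b := (a *: vP R l + b *: vP R (~~ l)).

Lemma silting_pairC V1 V2 : silting_pair V1 V2 -> silting_pair V2 V1.
Proof.
move=> sV; have [t1 [t2 [i1 [i2 [n12 [cT [_ gen]]]]]]] := sV.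
have [c1 _] := t1; have [c2 _] := t2; have c21 := is_cpx_dsum c2 c1.
have [r1 r2] := pair_retract cpo sV.
split=> //; split=> //; split=> //; split=> //; split; first by move/isoK_sym.
split=> //; split=> [n F n0|X /gen].
  have : nohom (dsum V2 V1) (shiftn n (dsum V2 V1)).
    by apply: two_term_nohom => //; [exact: two_term_dsum|exact: two_term_dsum|];
      apply: nohom_dsum_l; apply: nohom_shift_dsum_r; apply: (pair_nohom cpo sV).
  by apply.
elim=> {X} [X _ ->|X Y _ h cY i|X _ h|X _ h|X Y F _ hX _ hY cF|X Y _ h cX sm].
- by apply: (@thick_iso _ _ _ _ (dsum V2 V1)) => //; [exact: thick_base|exact: dsum_swap].
- exact: thick_iso h cY i.
- exact: thick_shift.
- exact: thick_unshift.
- exact: thick_cone.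
exact: thick_summand h cX sm.
Qed.

Lemma PA_gvec U1 U2 : silting_pair U1 U2 -> PA (gvec U1).
Proof.
move=> sU; have -> : gvec U1 = 1 *: gvec U1 + 0 *: gvec U2 by rewrite scale1r scale0r addr0.
by apply/(PA_cone cpo bas sU); rewrite ?addr0 ?ler01.
Qed.

Section Quadrant.
Variable l : bool.

(** The arithmetic input of the case analyses below: the representing vectors are integral of
    determinant 1 or -1, and those of positive weight lie in the quadrant. *)
Lemma PA_active (a b : R) : PA (pt l a b) -> 0 < a -> b < 0 ->
  exists V1 V2 (a1 b1 a2 b2 : int) (w1 w2 : R),
  [/\ silting_pair V1 V2,
      gvec V1 = pt l a1%:~R b1%:~R /\ gvec V2 = pt l a2%:~R b2%:~R,
      a1 * b2 - b1 * a2 = 1 \/ a1 * b2 - b1 * a2 = -1,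
      [/\ 0 <= w1, 0 <= w2, w1 + w2 <= 1, w1 * a1%:~R + w2 * a2%:~R = a & w1 * b1%:~R + w2 * b2%:~R = b] &
      (0 < w1 -> 0 <= a1 /\ b1 <= 0) /\ (0 < w2 -> 0 <= a2 /\ b2 <= 0)].
Proof.
move=> [V1 [V2 [sV [w0 [w1 [w2 [w00 [w10 [w20 [s e]]]]]]]]]] a0 b0.
have [a1 [b1 [a2 [b2 [h1 h2 dt]]]]] := silting_coord R cpo bas l sV.
exists V1, V2, a1, b1, a2, b2, w1, w2; split=> //.
  by have := e; rewrite h1 h2 pt_comb => /vP_injl [ea eb]; split=> //; lra.
have sV' : silting_pair V2 V1 by exact: silting_pairC.
have e' : w2 *: gvec V2 + w1 *: gvec V1 = pt l a b by rewrite addrC -e.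
split=> wp.
  by have [] := cone_quadrant cpo bas sV wp w20 (esym e) a0 b0 h1; rewrite ler0z lerz0.
by have [] := cone_quadrant cpo bas sV' wp w10 e' a0 b0 h2; rewrite ler0z lerz0.
Qed.

Lemma nonneg_comb (w1 w2 c x y : R) : 0 <= w1 -> 0 <= w2 -> (0 < w1 -> x <= c) -> (0 < w2 -> y <= c) ->
  w1 * x + w2 * y <= (w1 + w2) * c /\
  (w1 * x + w2 * y = (w1 + w2) * c -> (0 < w1 -> x = c) /\ (0 < w2 -> y = c)).
Proof.
have H w z : 0 <= w -> (0 < w -> z <= c) -> w * z <= w * c /\ (w * z = w * c -> 0 < w -> z = c).
  move=> w0 h; split=> [|e w0']; last by apply: (mulfI _ e); apply/eqP; lra.
  have [->|n] := eqVneq w 0; first by rewrite !mul0r.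
  by apply: ler_wpM2l => //; apply: h; rewrite lt0r n.
move=> w10 w20 h1 h2; have [l1 k1] := H _ _ w10 h1; have [l2 k2] := H _ _ w20 h2.
rewrite mulrDl; split=> [|e]; first exact: lerD.
by split; [apply: k1|apply: k2]; lra.
Qed.

(** [noncrossing] with weights 0 and 1; the g-vector rules out the other member of the explicit
    pair. *)
Lemma isoK_tt_left k (f : 'cV[A]_k) V1 V2 : lmin l f -> silting_pair V1 V2 ->
  gvec V1 = pt l k%:R (-1) -> isoK V1 (tt l f).
Proof.
move=> mf sV g1; have sU := pair_left R cpo bas mf.
have [u1 _ _] := pair_two_term sU; have [v1 _ _] := pair_two_term sV.
have [|n _] := noncrossing cpo (R := R) sU sV (lexx 0) ler01 ler01 (lexx 0).
  by rewrite !scale0r add0r addr0 !scale1r g1 gvec_ttE.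
have [i|//] := n ltr01.
have := gvec_isoK R cpo bas v1 u1 i; rewrite g1 gvec_stalk0 => /vP_injl [_ /eqP].
by rewrite oppr_eq0 oner_eq0.
Qed.

Lemma isoK_tt_right m (g : 'rV[A]_m) V1 V2 : rmin l g -> silting_pair V1 V2 ->
  gvec V1 = pt l 1 (- m%:R) -> isoK V1 (tt l g).
Proof.
move=> mg sV g1; have sU := pair_right R cpo bas mg.
have [_ u2 _] := pair_two_term sU; have [v1 _ _] := pair_two_term sV.
have [|n _] := noncrossing cpo (R := R) sU sV ler01 (lexx 0) ler01 (lexx 0).
  by rewrite !scale0r !addr0 !scale1r g1 gvec_ttE.
have [//|i] := n ltr01.
have := gvec_isoK R cpo bas v1 u2 i; rewrite g1 gvec_stalk1 => /vP_injl [/eqP].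
by rewrite oner_eq0.
Qed.

Lemma silting_pair_nohom V1 V2 X Y : silting_pair V1 V2 -> isoK V1 X -> isoK V2 Y ->
  nohom X (shift Y) /\ nohom Y (shift X).
Proof.
move=> sV /isoK_sym/isoK_retract rX /isoK_sym/isoK_retract rY; have [r1 r2] := pair_retract cpo sV.
have r1' := retract_trans cpo rX r1; have r2' := retract_trans cpo rY r2.
by split; apply: (pair_nohom cpo sV).
Qed.

(** The bound a <= 1 is attained at (1, -3/2), so the weights add up to 1 and the active vectors
    have first coordinate 1. Their second coordinates are integers >= -2 that differ by 1 and have
    weighted mean -3/2, so they are -1 and -2. The corresponding complexes are [tt l x] and
    [tt l g], and [pair_condL] applies to their vanishing extensions. *)
Lemma shape_condL (x : 'M[A]_1) (g : 'rV[A]_2) : lmin l x -> rmin l g ->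
  PA (pt l 1 (- (3 / 2))) -> (forall a b : R, 0 <= a -> b <= 0 -> PA (pt l a b) -> a <= 1 /\ - a - b <= 1) ->
  condL (eid l) (eid (~~ l)).
Proof.
move=> mx mg pz bnd; have z0 : - (3 / 2) < 0 :> R by lra.
have [V1 [V2 [a1 [b1 [a2 [b2 [w1 [w2 [sV [g1 g2] dt [w10 w20 ws ea eb] [q1 q2]]]]]]]]]] := PA_active pz ltr01 z0.
have sV' := silting_pairC sV.
have B X Y (c d : int) (w : R) : silting_pair X Y -> gvec X = pt l c%:~R d%:~R -> (0 < w -> 0 <= c /\ d <= 0) ->
    0 < w -> c%:~R <= 1 :> R /\ -2 <= d.
  move=> s e q wp; have [c0 d0] := q wp.
  have [|||h1 h2] := bnd c%:~R d%:~R; rewrite ?ler0z ?lerz0 //; first by rewrite -e; exact: PA_gvec s.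
  split=> //; have : (- c - d)%:~R <= 1%:~R :> R by rewrite rmorphB rmorphN.
  by have : c%:~R <= 1%:~R :> R by []; rewrite !ler_int; lia.
have B1 := B _ _ _ _ _ sV g1 q1; have B2 := B _ _ _ _ _ sV' g2 q2.
have [h1 h2] := nonneg_comb w10 w20 (fun p => proj1 (B1 p)) (fun p => proj1 (B2 p)).
have ws1 : w1 + w2 = 1 by lra.
have [|k1 k2] := h2; first by rewrite ea ws1 mulr1.
have int_eq1 (c : int) : c%:~R = 1 :> R -> c = 1 by move=> h; apply/eqP; rewrite -(eqr_int R) h.
(* Since -3/2 is not an integer, neither weight can be 0. *)
have half (d : int) : d%:~R <> - (3 / 2) :> R.
  move=> e; have : (d * 2)%:~R = (- 3)%:~R :> R by rewrite intrM e; lra.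
  by move=> /eqP; rewrite eqr_int => /eqP; lia.
have [z1|n1] := eqVneq w1 0.
  by case: (half b2); move: eb ws1; rewrite z1 mul0r !add0r => + w21; rewrite w21 mul1r.
have [z2|n2] := eqVneq w2 0.
  by case: (half b1); move: eb ws1; rewrite z2 mul0r !addr0 => + w11; rewrite w11 mul1r.
have p1 : 0 < w1 by rewrite lt0r n1.
have p2 : 0 < w2 by rewrite lt0r n2.
have ea1 := int_eq1 _ (k1 p1); have ea2 := int_eq1 _ (k2 p2).
have [_ c1] := B1 p1; have [_ c2] := B2 p2.
have [[eb1 eb2]|[[eb1 eb2]|[l1 l2]]] : (b1 = -1 /\ b2 = -2) \/ (b1 = -2 /\ b2 = -1) \/ (-1 <= b1 /\ -1 <= b2).
  by rewrite ea1 ea2 in dt; clear -dt c1 c2; lia.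
- rewrite ea1 eb1 in g1; rewrite ea2 eb2 in g2.
  apply: (pair_condL cpo mx mg).
  by have [] := silting_pair_nohom sV (isoK_tt_left mx sV g1) (isoK_tt_right mg sV' g2).
- rewrite ea1 eb1 in g1; rewrite ea2 eb2 in g2.
  apply: (pair_condL cpo mx mg).
  by have [] := silting_pair_nohom sV (isoK_tt_right mg sV g1) (isoK_tt_left mx sV' g2).
have m1 : -1 <= b1%:~R :> R by rewrite -(ler_int R) in l1.
have m2 : -1 <= b2%:~R :> R by rewrite -(ler_int R) in l2.
by have := ler_wpM2l w10 m1; have := ler_wpM2l w20 m2; lra.
Qed.

Lemma shape_condR (x : 'M[A]_1) (f : 'cV[A]_2) : rmin l x -> lmin l f ->
  PA (pt l (3 / 2) (-1)) -> (forall a b : R, 0 <= a -> b <= 0 -> PA (pt l a b) -> - b <= 1 /\ a + b <= 1) ->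
  condR (eid l) (eid (~~ l)).
Proof.
move=> mx mg pz bnd; have z0 : 0 < 3 / 2 :> R by lra.
have [V1 [V2 [a1 [b1 [a2 [b2 [w1 [w2 [sV [g1 g2] dt [w10 w20 ws ea eb] [q1 q2]]]]]]]]]] := PA_active pz z0 (ltrN10 R).
have sV' := silting_pairC sV.
have B X Y (c d : int) (w : R) : silting_pair X Y -> gvec X = pt l c%:~R d%:~R -> (0 < w -> 0 <= c /\ d <= 0) ->
    0 < w -> - d%:~R <= 1 :> R /\ c <= 2.
  move=> s e q wp; have [c0 d0] := q wp.
  have [|||h1 h2] := bnd c%:~R d%:~R; rewrite ?ler0z ?lerz0 //; first by rewrite -e; exact: PA_gvec s.
  split=> //; have : (c + d)%:~R <= 1%:~R :> R by rewrite rmorphD.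
  have : (- d)%:~R <= 1%:~R :> R by rewrite rmorphN.
  by rewrite !ler_int; lia.
have B1 := B _ _ _ _ _ sV g1 q1; have B2 := B _ _ _ _ _ sV' g2 q2.
have [h1 h2] := nonneg_comb w10 w20 (fun p => proj1 (B1 p)) (fun p => proj1 (B2 p)).
have ws1 : w1 + w2 = 1 by lra.
have [|k1 k2] := h2; first by rewrite !mulrN; lra.
have int_eq1 (c : int) : - c%:~R = 1 :> R -> c = -1.
  by move=> h; apply/eqP; rewrite -(eqr_int R) -[_%:~R]opprK h.
have half (d : int) : d%:~R <> 3 / 2 :> R.
  move=> e; have : (d * 2)%:~R = (3)%:~R :> R by rewrite intrM e; lra.
  by move=> /eqP; rewrite eqr_int => /eqP; lia.
have [z1|n1] := eqVneq w1 0.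
  by case: (half a2); move: ea ws1; rewrite z1 mul0r !add0r => + w21; rewrite w21 mul1r.
have [z2|n2] := eqVneq w2 0.
  by case: (half a1); move: ea ws1; rewrite z2 mul0r !addr0 => + w11; rewrite w11 mul1r.
have p1 : 0 < w1 by rewrite lt0r n1.
have p2 : 0 < w2 by rewrite lt0r n2.
have eb1 := int_eq1 _ (k1 p1); have eb2 := int_eq1 _ (k2 p2).
have [_ c1] := B1 p1; have [_ c2] := B2 p2.
have [[ea1 ea2]|[[ea1 ea2]|[l1 l2]]] : (a1 = 1 /\ a2 = 2) \/ (a1 = 2 /\ a2 = 1) \/ (a1 <= 1 /\ a2 <= 1).
  by rewrite eb1 eb2 in dt; clear -dt c1 c2; lia.
- rewrite ea1 eb1 in g1; rewrite ea2 eb2 in g2.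
  apply: (pair_condR cpo mx mg).
  by have [] := silting_pair_nohom sV (isoK_tt_right mx sV g1) (isoK_tt_left mg sV' g2).
- rewrite ea1 eb1 in g1; rewrite ea2 eb2 in g2.
  apply: (pair_condR cpo mx mg).
  by have [] := silting_pair_nohom sV (isoK_tt_left mg sV g1) (isoK_tt_right mx sV' g2).
have m1 : a1%:~R <= 1 :> R by rewrite -(ler_int R) in l1.
have m2 : a2%:~R <= 1 :> R by rewrite -(ler_int R) in l2.
by have := ler_wpM2l w10 m1; have := ler_wpM2l w20 m2; lra.
Qed.

End Quadrant.
End Decide.

(** * Convexity *)

Section Main.
Variables (K : fieldType) (A : falgType K) (e1 e2 : A) (R : realType).
Hypotheses (cpo : complete_prim_orth e1 e2) (bas : basic2 e1 e2).
Local Notation eid := (eid e1 e2).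
Local Notation silting_pair := (basic_two_silting e1 e2).
Local Notation gvec := (gvec R).
Local Notation lmin := (@lmin K A e1 e2).
Local Notation rmin := (@rmin K A e1 e2).
Local Notation PA := (PA R e1 e2).
Local Notation pt l a b := (a *: vP R l + b *: vP R (~~ l)).

(** The midpoint (3/2, -3/2) of (2, -1) and (1, -2) would lie in P(A). Put s_i = a_i + b_i, which is
    -1, 0 or 1: the determinant is a1 s2 - s1 a2 and the weighted sum of the s_i is 0. The cases
    compatible with determinant 1 or -1 have active a_i <= 1, and then the weighted sum of the a_i
    is at most 1, not 3/2. *)
Lemma convex_no_22 l (f : 'cV[A]_2) (g : 'rV[A]_2) : g_convex R e1 e2 ->
  (forall a b : R, PA (pt l a b) -> -1 <= a + b <= 1) -> lmin l f -> rmin l g -> False.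
Proof.
move=> cv bnd mf mg.
have pz : PA (pt l (3 / 2) (- (3 / 2))).
  have h : 0 <= (2^-1 : R) <= 1 by apply/andP; split; lra.
  have := cv _ _ _ (PA_tt_left R cpo bas mf) (PA_tt_right R cpo bas mg) h.
  rewrite pt_comb; have -> // : pt l (2^-1 * 2%:R + (1 - 2^-1) * 1) (2^-1 * -1 + (1 - 2^-1) * - 2%:R) = pt l (3 / 2) (- (3 / 2)).
  by congr (_ *: _ + _ *: _); field.
have z0 : 0 < 3 / 2 :> R by lra.
have z1 : - (3 / 2) < 0 :> R by lra.
have [V1 [V2 [a1 [b1 [a2 [b2 [w1 [w2 [sV [g1 g2] dt [w10 w20 ws ea eb] [q1 q2]]]]]]]]]] := PA_active cpo bas pz z0 z1.
have B X Y (c d : int) : silting_pair X Y -> gvec X = pt l c%:~R d%:~R -> -1 <= c + d <= 1.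
  move=> s e; have := bnd c%:~R d%:~R; rewrite -e => /(_ (PA_gvec R cpo bas s)).
  by rewrite -rmorphD /= -[-1]/((-1)%:~R) -[X in _ <= _ <= X]/(1%:~R) !ler_int.
have B1 := B _ _ _ _ sV g1; have B2 := B _ _ _ _ (silting_pairC cpo sV) g2.
have es : w1 * (a1 + b1)%:~R + w2 * (a2 + b2)%:~R = 0 by rewrite !intrD !mulrDr; lra.
have small (c : int) (w : R) : 0 <= w -> c <= 1 -> w * c%:~R <= w.
  by move=> w0 c1; rewrite -[X in _ <= X]mulr1; apply: ler_wpM2l => //; rewrite -[1]/(1%:~R) ler_int.
have zsum c : 0 < c -> forall s : int, c * s%:~R = 0 :> R -> s = 0.
  by move=> c0 s /eqP; rewrite mulf_eq0 gt_eqF //= intr_eq0 => /eqP.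
have [e1'|n1] := eqVneq w1 0.
  have p2 : 0 < w2 by rewrite lt0r w20 andbT; apply/eqP => e; move: ea; rewrite e1' e !mul0r; lra.
  have s2 : a2 + b2 = 0 by apply: (zsum _ p2); rewrite -es e1' mul0r add0r.
  have [c2 _] := q2 p2.
  have a2E : a2 <= 1.
    have dE : a1 * b2 - b1 * a2 = - (a2 * (a1 + b1)) by rewrite (_ : b2 = - a2); [ring|clear -s2; lia].
    by rewrite dE in dt; clear -dt c2 B1; move: (a1 + b1) B1 dt => t B1 dt;
      case: (ltgtP t 0) => tE; [have tE' : t = -1 by lia|have tE' : t = 1 by lia|have tE' := tE]; rewrite tE' in dt; lia.
  by have := small _ _ w20 a2E; move: ea; rewrite e1' mul0r; lra.
have p1 : 0 < w1 by rewrite lt0r n1.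
have [c1 _] := q1 p1.
have [e2'|n2] := eqVneq w2 0.
  have s1 : a1 + b1 = 0 by apply: (zsum _ p1); rewrite -es e2' mul0r addr0.
  have a1E : a1 <= 1.
    have dE : a1 * b2 - b1 * a2 = a1 * (a2 + b2) by rewrite (_ : b1 = - a1); [ring|clear -s1; lia].
    by rewrite dE in dt; clear -dt c1 B2; move: (a2 + b2) B2 dt => t B2 dt;
      case: (ltgtP t 0) => tE; [have tE' : t = -1 by lia|have tE' : t = 1 by lia|have tE' := tE]; rewrite tE' in dt; lia.
  by have := small _ _ w10 a1E; move: ea; rewrite e2' mul0r; lra.
have p2 : 0 < w2 by rewrite lt0r n2.
have [c2 _] := q2 p2.
have [a1E a2E] : a1 <= 1 /\ a2 <= 1.
  have dE : (a1 * b2 - b1 * a2 = a1 * (a2 + b2) - (a1 + b1) * a2)%R by ring.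
  have N1 : (-1)%:~R = -1 :> R by [].
  rewrite dE in dt; have [s1|[s1|s1]] : a1 + b1 = 0 \/ a1 + b1 = 1 \/ a1 + b1 = -1 by clear -B1; lia.
  - have [s2|[s2|s2]] : a2 + b2 = 0 \/ a2 + b2 = 1 \/ a2 + b2 = -1 by clear -B2; lia.
    + by rewrite s1 s2 in dt; clear -dt c1 c2; lia.
    + by exfalso; move: es; rewrite s1 s2 ?N1; clear -p1 p2 cpo bas; lra.
    + by exfalso; move: es; rewrite s1 s2 ?N1; clear -p1 p2 cpo bas; lra.
  - have [s2|[s2|s2]] : a2 + b2 = 0 \/ a2 + b2 = 1 \/ a2 + b2 = -1 by clear -B2; lia.
    + by exfalso; move: es; rewrite s1 s2 ?N1; clear -p1 p2 cpo bas; lra.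
    + by exfalso; move: es; rewrite s1 s2 ?N1; clear -p1 p2 cpo bas; lra.
    + by rewrite s1 s2 in dt; clear -dt c1 c2; lia.
  - have [s2|[s2|s2]] : a2 + b2 = 0 \/ a2 + b2 = 1 \/ a2 + b2 = -1 by clear -B2; lia.
    + by exfalso; move: es; rewrite s1 s2 ?N1; clear -p1 p2 cpo bas; lra.
    + by rewrite s1 s2 in dt; clear -dt c1 c2; lia.
    + by exfalso; move: es; rewrite s1 s2 ?N1; clear -p1 p2 cpo bas; lra.
by have := small _ _ w10 a1E; have := small _ _ w20 a2E; clear -ea ws cpo bas; lra.
Qed.

Lemma convex_condition l : g_convex R e1 e2 ->
  condL (eid l) (eid (~~ l)) \/ condR (eid l) (eid (~~ l)).
Proof.
move=> cv.
(* The two bounds come from the edges of the pairs A and A[1]. *)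
have bnd (a b : R) : PA (pt l a b) -> -1 <= a + b <= 1.
  move=> p; have h1 : a + b <= 1.
    apply: (PA_convex_bound cpo bas cv (pair_A R cpo bas l)); rewrite !gvec_stalk0 negbK !scalerDr !scalerA.
    by rewrite !mulr1 !mulr0 !scale0r addr0 addr0.
  have h2 : - b + - a <= 1.
    apply: (PA_convex_bound cpo bas cv (pair_A1 R cpo bas (~~ l))).
    rewrite gvec_stalk1 (gvec_stalk1 A R (~~ l)) negbK !scalerDr !scalerA.
    by rewrite !mulrN1 !opprK !mulr0 !scale0r add0r add0r addrC.
  by apply/andP; split; lra.
have [k0 [f0 h0]] := exists_lgen cpo l; have [k _ [f mf]] := exists_lmin h0.
have [m0 [g0 h0']] := exists_rgen cpo l; have [m _ [g mg]] := exists_rmin h0'.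
have pT := PA_tt_left R cpo bas mf; have pS := PA_tt_right R cpo bas mg.
have k2 : (k <= 2)%N by rewrite -(ler_nat R); have := bnd _ _ pT; lra.
have m2 : (m <= 2)%N by rewrite -(ler_nat R); have := bnd _ _ pS; lra.
have cyc : (k <= 1)%N -> (m <= 1)%N -> condL (eid l) (eid (~~ l)).
  by move=> /(left_cyclic_lmin cpo mf) h /(right_cyclic_rmin cpo mg) h'; exact: cyclic_condL.
have z : k = 0%N <-> m = 0%N by rewrite -(zero_lmin mf) -(zero_rmin mg).
have mid (x y : 'rV[R]_2) : PA x -> PA y -> PA (2^-1 *: x + (1 - 2^-1) *: y).
  by move=> px py; apply: cv => //; apply/andP; split; lra.
move: {h0 h0' f0 g0} k2 m2 cyc z => {k0 m0}.
case: k f mf pT => [|[|[|//]]] f mf pT _; case: m g mg pS => [|[|[|//]]] g mg pS _ cyc [z1 z2];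
  try by left; apply: cyc.
- by have := z1 erefl.
(* k = 1 and m = 2: the test point is the midpoint of (1, -1) and (1, -2), and a <= 1 comes from the
   edge of [pair_left]. *)
- left; apply: (shape_condL cpo bas (R := R) mf mg).
    have := mid _ _ pT pS; rewrite pt_comb.
    have -> // : pt l (2^-1 * 1%:R + (1 - 2^-1) * 1) (2^-1 * -1 + (1 - 2^-1) * - 2%:R) = pt l 1 (- (3 / 2)).
    by congr (_ *: _ + _ *: _); field.
  move=> a b a0 b0 p; split; last by have := bnd _ _ p; lra.
  have <- : (a + b) + (- b) = a by ring.
  apply: (PA_convex_bound cpo bas cv (pair_left R cpo bas mf)).
  rewrite gvec_stalk0 gvec_ttE pt_comb.
  by have -> // : pt l ((a + b) * 1 + - b * 1%:R) ((a + b) * 0 + - b * - 1%:R) = pt l a b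
    by congr (_ *: _ + _ *: _); ring.
- by have := z2 erefl.
(* k = 2 and m = 1: the test point is the midpoint of (2, -1) and (1, -1), and - b <= 1 comes from
   the edge of [pair_right]. *)
- right; apply: (shape_condR cpo bas (R := R) mg mf).
    have := mid _ _ pT pS; rewrite pt_comb.
    have -> // : pt l (2^-1 * 2%:R + (1 - 2^-1) * 1) (2^-1 * -1 + (1 - 2^-1) * - 1%:R) = pt l (3 / 2) (-1).
    by congr (_ *: _ + _ *: _); field.
  move=> a b a0 b0 p; split; last by have := bnd _ _ p; lra.
  have <- : a + (- b - a) = - b by ring.
  apply: (PA_convex_bound cpo bas cv (pair_right R cpo bas mg)).
  rewrite gvec_stalk1 gvec_ttE pt_comb.
  by have -> // : pt l (a * 1%:R + (- b - a) * 0) (a * - 1%:R + (- b - a) * -1) = pt l a b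
    by congr (_ *: _ + _ *: _); ring.
by case: (convex_no_22 cv bnd mf mg).
Qed.

(* On the quadrant the shape is cut out by at most two inequalities, which hold on the other
   three quadrants as soon as [-1 <= a + b <= 1]; hence PA is an intersection of half-planes. *)
Lemma condition_shape l : condL (eid l) (eid (~~ l)) \/ condR (eid l) (eid (~~ l)) ->
  exists p q r s : R, [/\ 0 <= p <= 1, 0 <= q <= 1, 0 <= r <= 1 & 0 <= s <= 1] /\
    forall a b, 0 <= a -> b <= 0 ->
      PA (pt l a b) <-> [/\ -1 <= a + b <= 1, p * a - q * b <= 1 & r * a - s * b <= 1].
Proof.
move=> h.
have [z|nz] := pselect (eAe'_zero (eid l) (eid (~~ l))).
  exists 1, 1, 1, 1; rewrite !ler01 lexx; split=> // a b a0 b0; rewrite (PA_zero cpo bas z a0 b0) !mul1r.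
  by split=> [?|[]//]; split=> //; lra.
have {}nz : eAe'_nonzero (eid l) (eid (~~ l)).
  by apply: contrapT => n; apply: nz => y hy; apply: contrapT => ny; apply: n; exists y.
have [lc|nlc] := pselect (left_cyclic (eid l) (eid (~~ l))); last first.
  have cR : condR (eid l) (eid (~~ l)) by case: h => // -[].
  exists 0, 1, 0, 1; rewrite !ler01 !lexx; split=> // a b a0 b0; rewrite (PA_condR cpo bas cR nlc a0 b0) !mul0r !mul1r !sub0r.
  by split=> [[] ? ?|[/andP[_ ?] ? _]//]; split=> //; lra.
have [rc|nrc] := pselect (right_cyclic (eid l) (eid (~~ l))); last first.
  have cL : condL (eid l) (eid (~~ l)) by case: h => // -[].
  exists 1, 0, 1, 0; rewrite !ler01 !lexx; split=> // a b a0 b0; rewrite (PA_condL cpo bas cL nrc a0 b0) !mul0r !mul1r !subr0.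
  by split=> [[] ? ?|[/andP[? _] ? _]]; split=> //; lra.
exists 1, 0, 0, 1; rewrite !ler01 !lexx; split=> // a b a0 b0; rewrite (PA_cyclic cpo bas nz lc rc a0 b0) !mul0r !mul1r subr0 sub0r.
by split=> [[] ? ?|[_ ? ?]//]; split=> //; lra.
Qed.

Lemma condition_convex :
  condL e1 e2 \/ condR e1 e2 -> condL e2 e1 \/ condR e2 e1 -> g_convex R e1 e2.
Proof.
move=> /(@condition_shape false) [p [q [r [s [[hp hq hr hs] F]]]]].
move=> /(@condition_shape true) [p' [q' [r' [s' [[hp' hq' hr' hs'] F']]]]].
(* In the strip -1 <= a + b <= 1, a <= 0 gives - b <= 1 and b >= 0 gives a <= 1; with coefficients
   in [0, 1] either implies the inequality. *)
have out u v (a b : R) : 0 <= u <= 1 -> 0 <= v <= 1 -> -1 <= a + b <= 1 -> a <= 0 \/ 0 <= b -> u * a - v * b <= 1.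
  by clear -cpo bas; move=> /andP[u0 u1] /andP[v0 v1] /andP[m1 m2] [h|h]; [case: (lerP 0 b) | case: (lerP 0 a)] => h'; nra.
have all a b : PA (pt false a b) <-> [/\ -1 <= a + b <= 1,
    p * a - q * b <= 1 /\ r * a - s * b <= 1 & p' * b - q' * a <= 1 /\ r' * b - s' * a <= 1].
  have tr : pt false a b = pt true b a by rewrite addrC.
  have [a0|a0] := lerP 0 a; have [b0|b0] := lerP b 0.
  - rewrite (F a b a0 b0); split=> [[m h1 h2]|[m [h1 h2] _]]; split=> //.
    by split; apply: out; rewrite // 1?addrC //; left.
  - have := PA_cone cpo bas (pair_A R cpo bas false) a0 (ltW b0).
    rewrite !gvec_stalk0 !scalerDr !scalerA !mulr1 !mulr0 !scale0r !addr0 => ->.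
    split=> [h|[/andP[]//]].
    have m : -1 <= a + b <= 1 by apply/andP; split=> //; lra.
    split=> //; split; apply: out => //; rewrite 1?addrC //; right; lra.
  - have na : 0 <= - a by lra.
    have nb : 0 <= - b by lra.
    have := PA_cone cpo bas (pair_A1 R cpo bas false) na nb.
    rewrite gvec_stalk1 (gvec_stalk1 A R true) /= !scalerDr !scalerA !mulrN1 !opprK !mulr0 !scale0r !(add0r, addr0) => ->.
    split=> [h|[/andP[]]]; last by lra.
    have m : -1 <= a + b <= 1 by apply/andP; split=> //; lra.
    split=> //; split; apply: out => //; rewrite 1?addrC //; left; lra.
  - rewrite tr (F' b a (ltW b0) (ltW a0)) addrC.
    split=> [[m h1 h2]|[m _ [h1 h2]]]; split=> //.
    by split; apply: out; rewrite // 1?addrC //; left; exact: ltW.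
have lin (u v t a b c d : R) : 0 <= t <= 1 -> u * a + v * b <= 1 -> u * c + v * d <= 1 ->
    u * (t * a + (1 - t) * c) + v * (t * b + (1 - t) * d) <= 1.
  clear -cpo bas; move=> /andP[t0 t1] h1 h2.
  have t1' : 0 <= 1 - t by lra.
  have := lerD (ler_wpM2l t0 h1) (ler_wpM2l t1' h2); lra.
have coord (x : 'rV[R]_2) : x = pt false (x 0 0) (x 0 1).
  apply/rowP => i; rewrite !mxE /=; case: i => -[|[|//]] i; rewrite /= !mulr0 !mulr1 ?addr0 ?add0r.
    by congr (x _ _); apply/val_inj.
  by congr (x _ _); apply/val_inj.
move=> x y t; rewrite (coord x) (coord y) pt_comb.
move: (x 0 0) (x 0 1) (y 0 0) (y 0 1) => a b c d.
move=> /all [m [h1 h2] [h3 h4]] /all [m' [k1 k2] [k3 k4]] ht; apply/all.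
have L := @lin _ _ t a b c d ht.
split; [|split|split].
- have := L 1 1; have := L (-1) (-1); rewrite !mul1r !mulN1r; move/andP: m => [? ?]; move/andP: m' => [? ?].
  by move=> l1 l2; apply/andP; split; [have := l1 _ _|have := l2 _ _]; lra.
- by have := L p (- q); rewrite !mulNr; apply.
- by have := L r (- s); rewrite !mulNr; apply.
- by have := L (- q') p'; rewrite !mulNr ![- _ + _]addrC; apply.
by have := L (- s') r'; rewrite !mulNr ![- _ + _]addrC; apply.
Qed.

End Main.

(** * The four shapes in the quadrant *)

Section Regions.
Variables (K : fieldType) (A : falgType K) (e1 e2 : A) (R : realType).
Hypotheses (cpo : complete_prim_orth e1 e2) (bas : basic2 e1 e2).
Local Notation lmin := (@lmin K A e1 e2).
Local Notation rmin := (@rmin K A e1 e2).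
Local Notation PA := (PA R e1 e2).

Local Notation quad a b := (a *: vP1 R + b *: vP2 R).

Lemma Delta1 (u x : 'rV[R]_2) : ~ Delta R [:: u] x.
Proof. by move=> [[|[|t]] []]. Qed.

Lemma Delta_cons (u v : 'rV[R]_2) us x : Delta R [:: u, v & us] x <-> conv0 R u v x \/ Delta R (v :: us) x.
Proof.
split=> [[[|[|t]] [//]]|[h|[t [lt h]]]]; first by left.
- by move=> lt h; right; exists t.+1.
- by exists 1%N.
by exists t.+1; split=> //; case: t lt h.
Qed.

Lemma conv0_quad (p q p' q' : R) x : conv0 R (quad p q) (quad p' q') x <->
  exists b c, [/\ 0 <= b, 0 <= c & b + c <= 1] /\ x = quad (b * p + c * p') (b * q + c * q').
Proof.
split=> [[a [b [c [a0 [b0 [c0 [s ->]]]]]]]|[b [c [[b0 c0 s] ->]]]].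
  by exists b, c; split; [split=> //; lra|exact: vP_comb].
by exists (1 - b - c), b, c; split; [lra|split=> //; split=> //; split; [ring|rewrite vP_comb]].
Qed.

(** Coordinates are unique, so an equality of regions can be tested point by point against
    inequalities. *)
Lemma PAQ_shape us (F : R -> R -> Prop) :
  (forall x, Delta R us x <-> exists a b, [/\ 0 <= a, b <= 0, F a b & x = quad a b]) ->
  PAQ_is R e1 e2 us <-> forall a b, 0 <= a -> b <= 0 -> PA (quad a b) <-> F a b.
Proof.
move=> dE; split=> [h a b a0 b0|h x].
  split=> [p|f].
    have /h/dE [a' [b' [_ _ f /vP_inj [-> ->]]]] // : PA (quad a b) /\ Qreg R (quad a b) by split=> //; exists a, b.
  by have /h [] : Delta R us (quad a b) by apply/dE; exists a, b.
rewrite dE; split=> [[p [a [b [a0 [b0 e]]]]]|[a [b [a0 b0 f e]]]].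
  by exists a, b; split=> //; apply/h => //; rewrite -e.
by rewrite e; split; [apply/h|exists a, b].
Qed.

Lemma PAQ_zero : PAQ_is R e1 e2 [:: vP1 R; - vP2 R] <-> forall a b, 0 <= a -> b <= 0 -> PA (quad a b) <-> a - b <= 1.
Proof.
apply: PAQ_shape => x.
have -> : [:: vP1 R; - vP2 R] = [:: quad 1 0; quad 0 (-1)].
  by rewrite !(scale0r, scaleNr, scale1r, addr0, add0r).
rewrite !Delta_cons !conv0_quad.
split=> [[[b [c [[b0 c0 s] ->]]]|/Delta1//]|[a [b [a0 b0 f ->]]]].
  by exists (b * 1 + c * 0), (b * 0 + c * -1); split=> //; lra.
by left; exists a, (- b); split; [split; lra|congr (_ *: _ + _ *: _); ring].
Qed.

Lemma PAQ_cyclic : PAQ_is R e1 e2 [:: vP1 R; vP1 R - vP2 R; - vP2 R] <->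
  forall a b, 0 <= a -> b <= 0 -> PA (quad a b) <-> a <= 1 /\ - b <= 1.
Proof.
apply: PAQ_shape => x.
have -> : [:: vP1 R; vP1 R - vP2 R; - vP2 R] = [:: quad 1 0; quad 1 (-1); quad 0 (-1)].
  by rewrite !(scale0r, scaleNr, scale1r, addr0, add0r).
rewrite !Delta_cons !conv0_quad.
split=> [[[b [c [[b0 c0 s] ->]]]|[[b [c [[b0 c0 s] ->]]]|/Delta1//]]|[a [b [a0 b0 [f g] ->]]]].
- by exists (b * 1 + c * 1), (b * 0 + c * -1); split=> //; lra.
- by exists (b * 1 + c * 0), (b * -1 + c * -1); split=> //; lra.
have [h|h] := lerP 0 (a + b).
  by left; exists (a + b), (- b); split; [split; lra|congr (_ *: _ + _ *: _); ring].
by right; left; exists a, (- b - a); split; [split; lra|congr (_ *: _ + _ *: _); ring].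
Qed.

Lemma PAQ_condL : PAQ_is R e1 e2 [:: vP1 R; vP1 R - vP2 R; vP1 R - 2 *: vP2 R; - vP2 R] <->
  forall a b, 0 <= a -> b <= 0 -> PA (quad a b) <-> a <= 1 /\ - a - b <= 1.
Proof.
apply: PAQ_shape => x.
have -> : [:: vP1 R; vP1 R - vP2 R; vP1 R - 2 *: vP2 R; - vP2 R] = [:: quad 1 0; quad 1 (-1); quad 1 (-2); quad 0 (-1)].
  by rewrite !(scale0r, scaleNr, scale1r, addr0, add0r).
rewrite !Delta_cons !conv0_quad.
split=> [[[b [c [[b0 c0 s] ->]]]|[[b [c [[b0 c0 s] ->]]]|[[b [c [[b0 c0 s] ->]]]|/Delta1//]]]|[a [b [a0 b0 [f g] ->]]]].
- by exists (b * 1 + c * 1), (b * 0 + c * -1); split=> //; lra.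
- by exists (b * 1 + c * 1), (b * -1 + c * -2); split=> //; lra.
- by exists (b * 1 + c * 0), (b * -2 + c * -1); split=> //; lra.
(* The signs of a + b and 2 a + b select the cone; the witnesses are the coordinates with respect to
   its two generators. *)
have [h|h] := lerP 0 (a + b).
  by left; exists (a + b), (- b); split; [split; lra|congr (_ *: _ + _ *: _); ring].
right; have [h'|h'] := lerP 0 (2 * a + b).
  by left; exists (2 * a + b), (- a - b); split; [split; lra|congr (_ *: _ + _ *: _); ring].
by right; left; exists a, (- b - 2 * a); split; [split; lra|congr (_ *: _ + _ *: _); ring].
Qed.

Lemma PAQ_condR : PAQ_is R e1 e2 [:: vP1 R; 2 *: vP1 R - vP2 R; vP1 R - vP2 R; - vP2 R] <->
  forall a b, 0 <= a -> b <= 0 -> PA (quad a b) <-> - b <= 1 /\ a + b <= 1.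
Proof.
apply: PAQ_shape => x.
have -> : [:: vP1 R; 2 *: vP1 R - vP2 R; vP1 R - vP2 R; - vP2 R] = [:: quad 1 0; quad 2 (-1); quad 1 (-1); quad 0 (-1)].
  by rewrite !(scale0r, scaleNr, scale1r, addr0, add0r).
rewrite !Delta_cons !conv0_quad.
split=> [[[b [c [[b0 c0 s] ->]]]|[[b [c [[b0 c0 s] ->]]]|[[b [c [[b0 c0 s] ->]]]|/Delta1//]]]|[a [b [a0 b0 [f g] ->]]]].
- by exists (b * 1 + c * 2), (b * 0 + c * -1); split=> //; lra.
- by exists (b * 2 + c * 1), (b * -1 + c * -1); split=> //; lra.
- by exists (b * 1 + c * 0), (b * -1 + c * -1); split=> //; lra.
have [h|h] := lerP 0 (a + 2 * b).
  by left; exists (a + 2 * b), (- b); split; [split; lra|congr (_ *: _ + _ *: _); ring].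
right; have [h'|h'] := lerP 0 (a + b).
  by left; exists (a + b), (- a - 2 * b); split; [split; lra|congr (_ *: _ + _ *: _); ring].
by right; left; exists a, (- b - a); split; [split; lra|congr (_ *: _ + _ *: _); ring].
Qed.

Lemma eAe'_nonzeroP (e e' : A) : eAe'_nonzero e e' <-> ~ eAe'_zero e e'.
Proof.
split=> [[y [hy ny]] z|nz]; first exact/ny/z.
by apply: contrapT => n; apply: nz => y hy; apply: contrapT => ny; apply: n; exists y.
Qed.

Lemma minimal_generators : exists k m (f : 'cV[A]_k) (g : 'rV[A]_m),
  [/\ lmin false f, rmin false g, PA (quad k%:R (-1)), PA (quad 1 (- m%:R)) & k = 0%N <-> m = 0%N].
Proof.
have [k0 [f0 h0]] := exists_lgen cpo false; have [k _ [f mf]] := exists_lmin h0.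
have [m0 [g0 h0']] := exists_rgen cpo false; have [m _ [g mg]] := exists_rmin h0'.
exists k, m, f, g; split=> //; [exact: (PA_tt_left R cpo bas mf)|exact: (PA_tt_right R cpo bas mg)|].
by rewrite -(zero_lmin mf) -(zero_rmin mg).
Qed.

(** The point (k, -1) always belongs to P(A), and a - b <= 1 leaves only k = 0. *)
Lemma zero_iff : PAQ_is R e1 e2 [:: vP1 R; - vP2 R] <-> eAe'_zero e1 e2.
Proof.
rewrite PAQ_zero; split=> [h|z a b a0 b0]; last exact: (PA_zero cpo bas (l := false) z).
have [k [m [f [g [mf mg pT pS _]]]]] := minimal_generators.
apply/(zero_lmin (l := false) mf); move: pT => /(h _ _ (ler0n _ _) (lerN10 R)) le.
by apply/eqP; rewrite -leqn0 -(ler_nat R); lra.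
Qed.

(** The points (k, -1) and (1, - m) belong to P(A), so the square forces k, m <= 1; the corner (1,
    -1) excludes e1 A e2 = 0. *)
Lemma cyclic_iff : PAQ_is R e1 e2 [:: vP1 R; vP1 R - vP2 R; - vP2 R] <->
  eAe'_nonzero e1 e2 /\ left_cyclic e1 e2 /\ right_cyclic e1 e2.
Proof.
rewrite PAQ_cyclic; split=> [h|[nz [lc rc]] a b a0 b0]; last exact: (PA_cyclic cpo bas (l := false)).
have [k [m [f [g [mf mg pT pS _]]]]] := minimal_generators.
split; last split.
- apply/eAe'_nonzeroP => /zero_iff/PAQ_zero/(_ 1 (-1) ler01 (lerN10 R)) h'.
  have /h' : PA (quad 1 (-1)) by apply/h; rewrite ?lerN10 ?ler01 ?opprK.
  by lra.
- apply/(left_cyclic_lmin cpo (l := false) mf); rewrite -(ler_nat R).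
  by have [] := proj1 (h _ _ (ler0n _ _) (lerN10 R)) pT.
apply/(right_cyclic_rmin cpo (l := false) mg); rewrite -(ler_nat R).
have nm : (- m%:R <= 0 :> R) by rewrite oppr_le0.
by have [_] := proj1 (h _ _ ler01 nm) pS; rewrite opprK.
Qed.

(** The shape gives k <= 1 and m <= 2. It contains (1, -2), which the triangle and the square do
    not, so e1 A e2 is not right cyclic: this yields k = 1, m = 2, and also the failure of (R),
    which includes right cyclicity. *)
Lemma condL_iff : PAQ_is R e1 e2 [:: vP1 R; vP1 R - vP2 R; vP1 R - 2 *: vP2 R; - vP2 R] <->
  condL e1 e2 /\ ~ condR e1 e2.
Proof.
rewrite PAQ_condL; split=> [h|[cL ncR] a b a0 b0]; last first.
  apply: (PA_condL cpo bas (l := false)) => // rc; apply: ncR.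
  by case: cL => lc _; exact: (cyclic_condR cpo (l := false)).
have [k [m [f [g [mf mg pT pS [z1 z2]]]]]] := minimal_generators.
have nm : (- m%:R <= 0 :> R) by rewrite oppr_le0.
have [k1 _] := proj1 (h _ _ (ler0n _ _) (lerN10 R)) pT; rewrite -[1]/(1%:R) ler_nat in k1.
have m2 : (m <= 2)%N by have [_] := proj1 (h _ _ ler01 nm) pS; rewrite -(ler_nat R); lra.
have lc := proj2 (left_cyclic_lmin cpo (l := false) mf) k1.
have n2 : -2 <= 0 :> R by lra.
have p12 : PA (quad 1 (-2)) by apply/h; [lra|lra|split; lra].
have nrc : ~ right_cyclic e1 e2.
  move=> rc; have [z|nz] := pselect (eAe'_zero e1 e2).
    have /PAQ_zero hz := proj2 zero_iff z.
    by have := proj1 (hz _ _ ler01 n2) p12; lra.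
  have /PAQ_cyclic hz := proj2 cyclic_iff (conj (proj2 (eAe'_nonzeroP _ _) nz) (conj lc rc)).
  by have [_] := proj1 (hz _ _ ler01 n2) p12; lra.
have m1 : ~ (m <= 1)%N by move=> h'; apply: nrc; apply/(right_cyclic_rmin cpo (l := false) mg).
split; last by move=> [].
case: m g mg pS z1 z2 nm m2 m1 => [|[|[|//]]] g mg pS z1 z2 _ _ m1 //.
case: k f mf pT k1 z1 z2 => [|[|//]] f mf pT _ z1 _; first by have := z1 erefl.
apply: (shape_condL cpo bas (R := R) (l := false) mf mg); first by apply/h; [lra|lra|split; lra].
by move=> a b a0 b0 p; apply/h.
Qed.

(** The mirror argument, with (2, -1) as the point that excludes left cyclicity. *)
Lemma condR_iff : PAQ_is R e1 e2 [:: vP1 R; 2 *: vP1 R - vP2 R; vP1 R - vP2 R; - vP2 R] <->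
  condR e1 e2 /\ ~ condL e1 e2.
Proof.
rewrite PAQ_condR; split=> [h|[cR ncL] a b a0 b0]; last first.
  apply: (PA_condR cpo bas (l := false)) => // lc; apply: ncL.
  by case: cR => rc _; exact: (cyclic_condL cpo (l := false)).
have [k [m [f [g [mf mg pT pS [z1 z2]]]]]] := minimal_generators.
have nm : (- m%:R <= 0 :> R) by rewrite oppr_le0.
have [m1 _] := proj1 (h _ _ ler01 nm) pS; rewrite opprK -[1]/(1%:R) ler_nat in m1.
have k2 : (k <= 2)%N by have [_] := proj1 (h _ _ (ler0n _ _) (lerN10 R)) pT; rewrite -(ler_nat R); lra.
have rc := proj2 (right_cyclic_rmin cpo (l := false) mg) m1.
have p21 : PA (quad 2 (-1)) by apply/h; [lra|lra|split; lra].
have nlc : ~ left_cyclic e1 e2.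
  move=> lc; have [z|nz] := pselect (eAe'_zero e1 e2).
    have /PAQ_zero hz := proj2 zero_iff z.
    by have := proj1 (hz _ _ (ler0n _ _) (lerN10 R)) p21; lra.
  have /PAQ_cyclic hz := proj2 cyclic_iff (conj (proj2 (eAe'_nonzeroP _ _) nz) (conj lc rc)).
  by have [] := proj1 (hz _ _ (ler0n _ _) (lerN10 R)) p21; lra.
have k1 : ~ (k <= 1)%N by move=> h'; apply: nlc; apply/(left_cyclic_lmin cpo (l := false) mf).
split; last by move=> [].
case: k f mf pT z1 z2 k2 k1 => [|[|[|//]]] f mf pT z1 z2 _ k1 //.
case: m g mg pS nm m1 z1 z2 => [|[|//]] g mg pS _ _ _ z2; first by have := z2 erefl.
apply: (shape_condR cpo bas (R := R) (l := false) mg mf); first by apply/h; [lra|lra|split; lra].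
by move=> a b a0 b0 p; apply/h.
Qed.
End Regions.

Theorem theorem6p5 (K : fieldType) (A : falgType K) (e1 e2 : A) (R : realType) :
  complete_prim_orth e1 e2 -> basic2 e1 e2 ->
  (g_convex R e1 e2 <->
     ((condL e1 e2 \/ condR e1 e2) /\ (condL e2 e1 \/ condR e2 e1))) /\
  (PAQ_is R e1 e2 [:: vP1 R; - vP2 R] <-> eAe'_zero e1 e2) /\
  (PAQ_is R e1 e2 [:: vP1 R; vP1 R - vP2 R; - vP2 R] <->
     eAe'_nonzero e1 e2 /\ left_cyclic e1 e2 /\ right_cyclic e1 e2) /\
  (PAQ_is R e1 e2 [:: vP1 R; vP1 R - vP2 R; vP1 R - 2 *: vP2 R; - vP2 R] <->
     condL e1 e2 /\ ~ condR e1 e2) /\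
  (PAQ_is R e1 e2 [:: vP1 R; 2 *: vP1 R - vP2 R; vP1 R - vP2 R; - vP2 R] <->
     condR e1 e2 /\ ~ condL e1 e2).

Proof.
move=> cpo bas; split.
  split=> [cv|[h1 h2]]; last exact: condition_convex.
  by split; [exact: (convex_condition cpo bas false cv)|exact: (convex_condition cpo bas true cv)].
split; first exact: zero_iff.
split; first exact: cyclic_iff.
by split; [exact: condL_iff|exact: condR_iff].
Qed.
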